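(* Consider the multi-armed bandit model described in the context, with discount rate $q>0$, and assume the integrability condition $\mathbb{E}\big[\sum_{s=0}^\infty |X^j_s|\int_{T^j_s}^{T^j_{s+1}} e^{-qr}\,{\rm d}r\big]<\infty$ for every $j\in\mathcal{J}$. Then the Gittins index strategy, which at the onset of each period $t\in\mathbb{N}_0$ operates an arm in $\arg\max_{j\in\mathcal{J}}\Gamma^j_{\pi^j(t)}$, is optimal, i.e. it attains $\sup_{\pi\in\Pi}V(\pi)$.
   Context: There are $J\in\mathbb{N}$ arms, $\mathcal{J}=\{1,\dots,J\}$, on a complete probability space $(\Omega,\mathcal{F},\mathbb{P})$. Arm $j$ is associated with a sequence $\{X^j_s,W^j_s,\mathcal{F}^j_s; s\in\mathbb{N}_0\}$, where $\mathbb{F}^j=(\mathcal{F}^j_s)_{s\ge0}$ is a $\mathbb{P}$-completed filtration, $X^j_s$ is real-valued and $\mathcal{F}^j_s$-measurable (the reward when arm $j$ is selected after $s$ previous operations), and $(W^j_s)_{s\in\mathbb{N}_0}$ is an i.i.d. sequence of strictly positive random variables with common law $G^j$, with $W^j_s$ independent of $\mathcal{F}^j_s$ but $\mathcal{F}^j_{s+1}$-measurable. The $\sigma$-algebras $\mathcal{F}^j:=\bigvee_{s}\mathcal{F}^j_s$, $j\in\mathcal{J}$, are independent. Let $T^j_0=0$ and $T^j_s=W^j_0+\dots+W^j_{s-1}$ for $s\ge1$. A strategy is an $\mathbb{N}_0^J$-valued process $\pi(t)=(\pi^1(t),\dots,\pi^J(t))$, $t\in\mathbb{N}_0$ ($\pi^j(t)$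 = number of times arm $j$ was selected in periods $0,\dots,t-1$), with $\pi(0)=0$, $\pi^1(t)+\dots+\pi^J(t)=t$, $\pi(t+1)=\pi(t)+\mathbf{e}_j$ for some $j$ (with $\mathbf{e}_j$ the $j$-th unit vector), and $\{\pi(t)=\mathbf{s}\}\in\mathcal{F}_{\mathbf{s}}:=\mathcal{F}^1_{s^1}\vee\dots\vee\mathcal{F}^J_{s^J}$ for all $\mathbf{s}=(s^1,\dots,s^J)\in\mathbb{N}_0^J$; $\Pi$ is the set of such strategies. Let $\mathrm{j}_t$ be the arm selected in period $t$ (so $\pi(t+1)=\pi(t)+\mathbf{e}_{\mathrm{j}_t}$), $\mathcal{W}_t:=W^{\mathrm{j}_t}_{\pi^{\mathrm{j}_t}(t)}$, $\mathcal{T}_0=0$, $\mathcal{T}_t=\mathcal{W}_0+\dots+\mathcal{W}_{t-1}$, $\mathcal{X}_t:=X^{\mathrm{j}_t}_{\pi^{\mathrm{j}_t}(t)}$, and $V(\pi)=\mathbb{E}^\pi\big[\sum_{t=0}^\infty \mathcal{X}_t\int_{\mathcal{T}_t}^{\mathcal{T}_{t+1}}e^{-qr}{\rm d}r\,\big|\,\mathcal{F}_{\pi(0)}\big]$. The Gittins index process of arm $j$ is $\Gamma^j_s:=\operatorname{ess\,sup}_{\tau>s}\dfrac{\mathbb{E}\big[\sum_{u=s}^{\tau-1}e^{-qT^j_u}X^j_u\,|\,\mathcal{F}^j_s\big]}{\mathbb{E}\big[\sum_{u=s}^{\tau-1}e^{-qT^j_u}\,|\,\mathcal{F}^j_s\big]}$,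 $s\in\mathbb{N}_0$, the supremum over $\mathbb{F}^j$-stopping times $\tau>s$. *)

(* Defs.v *)
From HB Require Import structures.
From mathcomp Require Import all_boot all_order all_algebra.
From mathcomp Require Import all_classical all_reals all_analysis.
From mathcomp Require Import measurable_realfun.
Import Order.TTheory GRing.Theory Num.Theory.
Import numFieldNormedType.Exports.

Set Implicit Arguments.
Unset Strict Implicit.
Unset Printing Implicit Defensive.

Local Open Scope classical_set_scope.
Local Open Scope ring_scope.

Section bandit_defs.
Context {R : realType} {d : measure_display} {Omega : measurableType d}.
Variable P : probability Omega R.

Definition sub_sigma (G : set (set Omega)) :=
  sigma_algebra setT G /\ G `<=` measurable.

Definition Gmeas {d'} {U : measurableType d'} (G : set (set Omega))
  (f : Omega -> U) := forall B : set U, measurable B -> G (f @^-1` B).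

Definition Gmeas_e (G : set (set Omega)) (f : Omega -> \bar R) :=
  forall B : set (\bar R), measurable B -> G (f @^-1` B).

Definition completed_filtration (F : nat -> set (set Omega)) :=
  (forall s, sub_sigma (F s)) /\ (forall s, F s `<=` F s.+1) /\
  (forall s (N : set Omega), measurable N -> P N = 0%E -> F s N).

Definition Finf (F : nat -> set (set Omega)) := <<s \bigcup_s F s >>.

Definition indep_sigmas (J : nat) (G : 'I_J -> set (set Omega)) :=
  forall A : 'I_J -> set Omega, (forall j, G j (A j)) ->
    P (\bigcap_j A j) = (\prod_(j < J) P (A j))%E.

Definition indep_rv_sigma (G : set (set Omega)) (W : Omega -> R) :=
  forall (A : set Omega) (B : set R), G A -> measurable B ->
    P (A `&` W @^-1` B) = (P A * P (W @^-1` B))%E.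

Definition iid (W : nat -> Omega -> R) :=
  (forall s, measurable_fun setT (W s)) /\
  (forall n (B : nat -> set R), (forall i, measurable (B i)) ->
     P (\bigcap_(i in [set k | (k < n)%N]) (W i @^-1` B i)) =
     (\prod_(i < n) P (W i @^-1` B i))%E) /\
  (forall s (B : set R), measurable B -> P (W s @^-1` B) = P (W 0%N @^-1` B)).

Definition optime (W : nat -> Omega -> R) (s : nat) (w : Omega) : R :=
  \sum_(u < s) W u w.

Definition disc (q a b : R) : R :=
  Rintegral lebesgue_measure `[a, b]%classic (fun r => expR (- (q * r))).

Definition arm_model (F : nat -> set (set Omega)) (X W : nat -> Omega -> R) :=
  completed_filtration F /\
  (forall s, Gmeas (F s) (X s)) /\
  (forall s w, 0 < W s w) /\
  (forall s, Gmeas (F s.+1) (W s)) /\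
  (forall s, indep_rv_sigma (F s) (W s)) /\
  iid W.

Definition arm_integrable (q : R) (X W : nat -> Omega -> R) :=
  (\int[P]_w (\sum_(s <oo) ((`|X s w| * disc q (optime W s w) (optime W s.+1 w))%:E))
     < +oo)%E.

Definition cond_exp (G : set (set Omega)) (Y Z : Omega -> R) :=
  P.-integrable setT (EFin \o Y) /\ Gmeas G Z /\
  P.-integrable setT (EFin \o Z) /\
  forall A, G A -> (\int[P]_(w in A) (Z w)%:E = \int[P]_(w in A) (Y w)%:E)%E.

(* stopping times with values in N_0 \cup {oo}; None stands for +oo *)
Definition stopping_time (F : nat -> set (set Omega)) (tau : Omega -> option nat) :=
  forall n, F n [set w | exists2 k, (k <= n)%N & tau w = Some k].

Definition lt_opt (u : nat) (o : option nat) : bool :=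
  if o is Some k then (u < k)%N else true.

Definition stop_sum (s : nat) (tau : Omega -> option nat) (f : nat -> Omega -> R)
  (w : Omega) : R :=
  limn (fun n => \sum_(s <= u < n | lt_opt u (tau w)) f u w).

Definition gittins_index (q : R) (F : nat -> set (set Omega)) (X W : nat -> Omega -> R)
  (s : nat) (Gam : Omega -> \bar R) :=
  let num tau := stop_sum s tau (fun u w => expR (- (q * optime W u w)) * X u w) in
  let den tau := stop_sum s tau (fun u w => expR (- (q * optime W u w))) in
  let ratio_family (Z : Omega -> \bar R) :=
    forall tau, stopping_time F tau -> (forall w, lt_opt s (tau w)) ->
    forall N D, cond_exp (F s) (num tau) N -> cond_exp (F s) (den tau) D ->
      {ae P, forall w, ((N w / D w)%:E <= Z w)%E} in
  Gmeas_e (F s) Gam /\ ratio_family Gam /\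
  (forall Z : Omega -> \bar R, measurable_fun setT Z -> ratio_family Z ->
     {ae P, forall w, (Gam w <= Z w)%E}).

Definition joinF (J : nat) (F : 'I_J -> nat -> set (set Omega)) (s : 'I_J -> nat) :=
  <<s \bigcup_j F j (s j) >>.

Definition is_strategy (J : nat) (F : 'I_J -> nat -> set (set Omega))
  (pi : nat -> Omega -> 'I_J -> nat) :=
  (forall w j, pi 0%N w j = 0%N) /\
  (forall t w, (\sum_(j < J) pi t w j)%N = t) /\
  (forall t w, exists j : 'I_J, forall k, pi t.+1 w k = (pi t w k + (k == j))%N) /\
  (forall t (s : 'I_J -> nat), joinF F s [set w | pi t w = s]).

Definition sel (J : nat) (pi : nat -> Omega -> 'I_J -> nat) (t : nat) (w : Omega)
  (j : 'I_J) : bool := pi t.+1 w j == (pi t w j).+1.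

Definition caltime (J : nat) (W : 'I_J -> nat -> Omega -> R)
  (pi : nat -> Omega -> 'I_J -> nat) (t : nat) (w : Omega) : R :=
  \sum_(u < t) \sum_(j < J) (sel pi u w j)%:R * W j (pi u w j) w.

Definition total_reward (J : nat) (q : R) (X W : 'I_J -> nat -> Omega -> R)
  (pi : nat -> Omega -> 'I_J -> nat) (w : Omega) : R :=
  limn (fun n => \sum_(t < n)
    ((\sum_(j < J) (sel pi t w j)%:R * X j (pi t w j) w) *
     disc q (caltime W pi t w) (caltime W pi t.+1 w))).

End bandit_defs.

(* Main.v *)
Require Import Defs.
From HB Require Import structures.
From mathcomp Require Import all_boot all_order all_algebra.
From mathcomp Require Import all_classical all_reals all_analysis.
From mathcomp Require Import measurable_realfun.
From mathcomp Require Import ring lra.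
Import Order.TTheory GRing.Theory Num.Theory.
Import numFieldNormedType.Exports.

(** The index [Gam j s] is the largest charge per discounted operation at which it
   is worth operating arm [j] after [s] operations.  If the charge is lowered to the index
   whenever playing on would make a loss, one pays the prevailing charge
   [g j s = min_(u <= s) Gam j u], and the discounted excess of the rewards over the
   charges has expectation at most [0] for every stopping rule, with equality if the
   arm is never left while its index is above its running minimum.  The value [S j s]
   of this one-armed game is a Snell envelope: it is nonnegative, it vanishes when the
   index is at its running minimum, [E S j s] tends to [0], and [S j s] is the
   conditional expectation of [al j s + S j s.+1], where [al j s] is the discounted
   excess of period [s].

   By independence this identity persists conditionally on the histories of the other
   arms, so [sum_j S j (pi^j t)], each term being weighted by the discount accumulated
   on the other arms, is a potential whose decrease dominates the expected excess of
   period [t].  Hence any strategy earns at most what it is charged.  The index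
   strategy never leaves an arm whose index is above its running minimum, so it earns
   exactly what it is charged.  Since the charges of each arm are nonincreasing and
   the index strategy always operates an arm of largest charge, it serves the charges
   in decreasing order, and an Abel summation shows pathwise that it is charged at
   least as much as any other strategy. *)

Set Implicit Arguments.
Unset Strict Implicit.
Unset Printing Implicit Defensive.

Local Open Scope classical_set_scope.
Local Open Scope ring_scope.

(** * Measurability and expectation *)

(** The reward of a period is weighted by [dsc], which involves the duration of that very period,
    whereas the Gittins ratio weights it by [edisc], known at its onset. Since [W j s] is
    independent of [F j s] and its law does not depend on [s], the two weights have the same mean
    against [F j s]-measurable quantities up to the constant [cdisc / q]. The same identity bounds
    the expected sum of present and later discounts by [cdisc^-1] times the present one, which
    controls all tails. An essential supremum comes without an optimal stopping time. Its two
    defining properties are therefore used as tests: stopping rules show that a charge at or above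
    the index never pays, and minimality shows that a negative [F j s]-measurable bound on all
    excesses over a charge [la] pushes the index below [la]. The value [S] is a limit of
    finite-horizon envelopes, and stopping rules are handled as nested events, so that gains are
    finite sums of expectations. *)

Section gmeas.
Context {R : realType} {d : measure_display} {Omega : measurableType d}.
Implicit Types (G : set (set Omega)) (f g : Omega -> R).

(** Makes the library's closure properties of measurable functions available for a
    sub-sigma-algebra: [G] equals the sigma-algebra it generates, which carries a measurable
    type. *)
Lemma GmeasP {d'} {U : measurableType d'} G (f : Omega -> U) : sigma_algebra setT G ->
  Gmeas G f <-> measurable_fun setT (f : g_sigma_algebraType G -> U).
Proof.
move=> sG; have GE : <<s G >> = G.
  by apply/seteqP; split; [exact: smallest_sub|exact: sub_sigma_algebra].
split=> [Gf _ B mB|mf B mB].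
  by rewrite setTI; apply: sub_sigma_algebra; exact: Gf.
by have := mf measurableT B mB; rewrite setTI /measurable/= GE.
Qed.

Variable G : set (set Omega).
Hypothesis sG : sigma_algebra setT G.

Lemma Gset0 : G set0. Proof. by case: sG. Qed.
Lemma GsetC A : G A -> G (~` A).
Proof. by case: sG => _ h _ /h; rewrite setTD. Qed.
Lemma GsetT : G setT. Proof. by rewrite -setC0; apply: GsetC; exact: Gset0. Qed.
Lemma Gbigcup (A : (set Omega)^nat) : (forall n, G (A n)) -> G (\bigcup_n A n).
Proof. by case: sG => _ _; exact. Qed.
Lemma GsetU A B : G A -> G B -> G (A `|` B).
Proof.
move=> GA GB; rewrite -bigcup2E; apply: Gbigcup => -[//|[//|n]]/=; exact: Gset0.
Qed.
Lemma GsetI A B : G A -> G B -> G (A `&` B).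
Proof.
by move=> GA GB; rewrite -(setCK (A `&` B)) setCI; apply/GsetC/GsetU; exact: GsetC.
Qed.
Lemma GsetD A B : G A -> G B -> G (A `\` B).
Proof. by move=> GA GB; rewrite setDE; apply: GsetI => //; exact: GsetC. Qed.
Lemma Gbigcap (A : (set Omega)^nat) : (forall n, G (A n)) -> G (\bigcap_n A n).
Proof.
by move=> GA; rewrite -(setCK (\bigcap_n _)) setC_bigcap; apply/GsetC/Gbigcup => n; exact/GsetC.
Qed.

Lemma Gm_cst {d'} {U : measurableType d'} (r : U) : Gmeas G (cst r).
Proof. by apply/GmeasP => //; exact: measurable_cst. Qed.
Lemma GmD f g : Gmeas G f -> Gmeas G g -> Gmeas G (fun w => f w + g w).
Proof. by move=> /(GmeasP _ sG) ? /(GmeasP _ sG) ?; apply/GmeasP => //; exact: measurable_funD. Qed.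
Lemma GmM f g : Gmeas G f -> Gmeas G g -> Gmeas G (fun w => f w * g w).
Proof. by move=> /(GmeasP _ sG) ? /(GmeasP _ sG) ?; apply/GmeasP => //; exact: measurable_funM. Qed.
Lemma GmB f g : Gmeas G f -> Gmeas G g -> Gmeas G (fun w => f w - g w).
Proof. by move=> /(GmeasP _ sG) ? /(GmeasP _ sG) ?; apply/GmeasP => //; exact: measurable_funB. Qed.
Lemma Gm_max f g : Gmeas G f -> Gmeas G g -> Gmeas G (fun w => Num.max (f w) (g w)).
Proof. by move=> /(GmeasP _ sG) ? /(GmeasP _ sG) ?; apply/GmeasP => //; exact: measurable_maxr. Qed.
Lemma Gm_min f g : Gmeas G f -> Gmeas G g -> Gmeas G (fun w => Num.min (f w) (g w)).
Proof. by move=> /(GmeasP _ sG) ? /(GmeasP _ sG) ?; apply/GmeasP => //; exact: measurable_minr. Qed.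
Lemma Gm_comp {d1 d2} {U1 : measurableType d1} {U2 : measurableType d2}
    (h : U1 -> U2) (f : Omega -> U1) :
  measurable_fun setT h -> Gmeas G f -> Gmeas G (fun w => h (f w)).
Proof.
by move=> mh Gf B mB; have := Gf _ (mh measurableT B mB); rewrite setTI.
Qed.
Lemma Gm_ind A : G A -> Gmeas G (\1_A : Omega -> R).
Proof.
move=> GA; apply/GmeasP => //; apply: measurable_indic; exact: sub_sigma_algebra.
Qed.
Lemma Gm_sum (I : Type) (s : seq I) (p : pred I) (f : I -> Omega -> R) :
  (forall i, p i -> Gmeas G (f i)) -> Gmeas G (fun w => \sum_(i <- s | p i) f i w).
Proof.
move=> mf; elim: s => [|i s IH].
  by under eq_fun do rewrite big_nil; exact: Gm_cst.
under eq_fun do rewrite big_cons.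
by case pi: (p i) => //; apply: GmD => //; exact: mf.
Qed.
Lemma Gm_lt f g : Gmeas G f -> Gmeas G g -> G [set w | f w < g w].
Proof.
move=> mf mg; have := GmB mg mf; move=> /(_ `]0, +oo[%classic (measurable_itv _)).
by congr (G _); apply/seteqP; split=> w /=; rewrite in_itv/= andbT subr_gt0.
Qed.
Lemma Gm_le f g : Gmeas G f -> Gmeas G g -> G [set w | f w <= g w].
Proof.
move=> mf mg; have := GsetC (Gm_lt mg mf).
by congr (G _); apply/seteqP; split=> w /=; rewrite leNgt => /negP.
Qed.
Lemma Gm_eq f g : Gmeas G f -> Gmeas G g -> G [set w | f w = g w].
Proof.
move=> mf mg; have := GsetI (Gm_le mf mg) (Gm_le mg mf).
congr (G _); apply/seteqP; split=> w /= => [[fg gf]|->]; last by rewrite lexx.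
by apply/le_anti; rewrite fg gf.
Qed.
End gmeas.

Lemma Gmeas_sub {d d'} {Omega : measurableType d} {U : measurableType d'}
    (G H : set (set Omega)) (f : Omega -> U) :
  G `<=` H -> Gmeas G f -> Gmeas H f.
Proof. by move=> GH Gf B mB; exact/GH/Gf. Qed.

Lemma sub_sigma_measurable {d} {Omega : measurableType d} :
  @sub_sigma d Omega (@measurable d Omega).
Proof.
split=> //; split; [exact: measurable0| |by move=> A mA; exact: bigcupT_measurable].
by move=> A mA; exact: measurableD.
Qed.

Section expectation.
Context {R : realType} {d : measure_display} {Omega : measurableType d}.
Variable P : probability Omega R.
Implicit Types (f g h : Omega -> R).

Definition L1 f := P.-integrable setT (EFin \o f).
Definition Ex f : R := \int[P]_w f w.

Lemma ae_mono (A B : Omega -> Prop) : {ae P, forall w, A w} ->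
  (forall w, A w -> B w) -> {ae P, forall w, B w}.
Proof. by move=> hA AB; apply: filterS hA. Qed.

Lemma ae_mono2 (A B C : Omega -> Prop) :
  {ae P, forall w, A w} -> {ae P, forall w, B w} ->
  (forall w, A w -> B w -> C w) -> {ae P, forall w, C w}.
Proof. by move=> hA hB AB; apply: filterS2 hA hB. Qed.

Lemma ae_all (A : nat -> Omega -> Prop) : (forall n, {ae P, forall w, A n w}) ->
  {ae P, forall w, forall n, A n w}.
Proof. by move=> /(ae_foralln). Qed.

Lemma L1_meas f : L1 f -> measurable_fun setT f.
Proof. by move=> /measurable_int /measurable_EFinP. Qed.

Lemma L1_le_ae f g : measurable_fun setT f -> L1 g ->
  {ae P, forall w, `|f w| <= `|g w|} -> L1 f.
Proof.
move=> mf Lg fg; apply/integrableP; split; first exact/measurable_EFinP.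
have /integrableP[mg] := Lg; apply: le_lt_trans.
apply: ae_ge0_le_integral => //.
- by apply: measurableT_comp => //; exact/measurable_EFinP.
- by apply: measurableT_comp => //; exact/measurable_EFinP/(L1_meas Lg).
- by apply: filterS fg => w fg _ /=; rewrite lee_fin.
Qed.

Lemma L1_le f g : measurable_fun setT f -> L1 g ->
  (forall w, `|f w| <= g w) -> L1 f.
Proof.
move=> mf Lg fg; apply: L1_le_ae mf Lg _; apply: aeW => w.
by rewrite (le_trans (fg w))// ler_norm.
Qed.

Lemma L1D f g : L1 f -> L1 g -> L1 (fun w => f w + g w).
Proof. by move=> Lf Lg; exact: (integrableD measurableT Lf Lg). Qed.
Lemma L1B f g : L1 f -> L1 g -> L1 (fun w => f w - g w).
Proof. by move=> Lf Lg; exact: (integrableB measurableT Lf Lg). Qed.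
Lemma L1Z k f : L1 f -> L1 (fun w => k * f w).
Proof. by move=> Lf; exact: (integrableZl measurableT k Lf). Qed.
Lemma L1_cst k : L1 (cst k).
Proof. exact: finite_measure_integrable_cst. Qed.
Lemma L1_sum (I : Type) (s : seq I) (p : pred I) (f : I -> Omega -> R) :
  (forall i, p i -> L1 (f i)) -> L1 (fun w => \sum_(i <- s | p i) f i w).
Proof.
move=> mf; elim: s => [|i s IH].
  by under eq_fun do rewrite big_nil; exact: L1_cst.
under eq_fun do rewrite big_cons.
by case pi: (p i) => //; apply: L1D => //; exact: mf.
Qed.
Lemma L1_abs f : L1 f -> L1 (fun w => `|f w|).
Proof. exact: integrable_norm. Qed.

Lemma L1_mulb f h k : measurable_fun setT h -> (forall w, `|h w| <= k) -> L1 f ->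
  L1 (fun w => h w * f w).
Proof.
move=> mh hk Lf; apply: (@L1_le _ (fun w => k * `|f w|)).
- by apply: measurable_funM => //; exact: L1_meas.
- exact/L1Z/L1_abs.
- by move=> w; rewrite normrM ler_wpM2r.
Qed.

Lemma L1_ind f C : measurable C -> L1 f -> L1 (fun w => \1_C w * f w).
Proof.
move=> mC; apply: (@L1_mulb _ _ 1); first exact: measurable_indic.
by move=> w; rewrite indicE; case: (_ \in _); rewrite ?normr1 ?normr0.
Qed.

Lemma ExD f g : L1 f -> L1 g -> Ex (fun w => f w + g w) = Ex f + Ex g.
Proof. exact: RintegralD. Qed.
Lemma ExB f g : L1 f -> L1 g -> Ex (fun w => f w - g w) = Ex f - Ex g.
Proof. exact: RintegralB. Qed.
Lemma ExZ k f : L1 f -> Ex (fun w => k * f w) = k * Ex f.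
Proof. exact: RintegralZl. Qed.
Lemma Ex_cst k : Ex (cst k) = k.
Proof. by rewrite /Ex Rintegral_cst//= probability_setT mulr1. Qed.
Lemma Ex_sum (I : Type) (s : seq I) (p : pred I) (f : I -> Omega -> R) :
  (forall i, p i -> L1 (f i)) ->
  Ex (fun w => \sum_(i <- s | p i) f i w) = \sum_(i <- s | p i) Ex (f i).
Proof.
move=> mf; elim: s => [|i s IH].
  by under eq_fun do rewrite big_nil; rewrite big_nil Ex_cst.
under eq_fun do rewrite big_cons.
rewrite big_cons; case pi: (p i) => //.
rewrite -IH -ExD//; [exact: mf|exact: L1_sum].
Qed.
Lemma eq_Ex f g : f =1 g -> Ex f = Ex g.
Proof. by move=> fg; congr Ex; exact/funext. Qed.
Lemma eq_L1 f g : f =1 g -> L1 f -> L1 g.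
Proof. by move=> /funext ->. Qed.
Lemma Ex_ge0 f : (forall w, 0 <= f w) -> 0 <= Ex f.
Proof. by move=> f0; apply: Rintegral_ge0. Qed.
Lemma Ex_le f g : L1 f -> L1 g -> (forall w, f w <= g w) -> Ex f <= Ex g.
Proof. by move=> Lf Lg fg; apply: le_Rintegral. Qed.
Lemma eq_Ex_ae f g : measurable_fun setT f -> measurable_fun setT g ->
  {ae P, forall w, f w = g w} -> Ex f = Ex g.
Proof.
move=> mf mg fg; congr fine; apply: ae_eq_integral => //; try exact/measurable_EFinP.
by apply: filterS fg => w -> _.
Qed.
Lemma Ex_le_ae f g : L1 f -> L1 g -> {ae P, forall w, f w <= g w} -> Ex f <= Ex g.
Proof.
move=> Lf Lg fg; have [mf mg] := (L1_meas Lf, L1_meas Lg).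
(* [f] agrees almost everywhere with its minimum with [g], for which the inequality holds
   everywhere. *)
have -> : Ex f = Ex (fun w => Num.min (f w) (g w)).
  apply: eq_Ex_ae => //; first exact: measurable_minr.
  by apply: filterS fg => w /min_idPl.
apply: Ex_le => //; last by move=> w; rewrite ge_min lexx orbT.
apply: (@L1_le _ (fun w => `|f w| + `|g w|)); first exact: measurable_minr.
  by apply: L1D; exact: L1_abs.
by move=> w; rewrite /Num.min; case: ifP => _; rewrite ?lerDl ?lerDr.
Qed.

Lemma Ex_eq0 f : L1 f -> (forall w, 0 <= f w) -> Ex f <= 0 -> {ae P, forall w, f w = 0}.
Proof.
move=> Lf f0 Ef.
have E0 : (\int[P]_w `|(EFin \o f) w|)%E = 0%E.
  have -> : (\int[P]_w `|(EFin \o f) w|)%E = (\int[P]_w (f w)%:E)%E.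
    by apply: eq_integral => w _ /=; rewrite ger0_norm.
  rewrite -[LHS]fineK; last exact: integrable_fin_num Lf.
  by congr (_%:E); apply/le_anti; rewrite Ef Ex_ge0.
have := (ae_eq_integral_abs P measurableT (measurable_int P Lf)).1 E0.
by apply: filterS => w /(_ I) [].
Qed.

Lemma Ex_dct (f_ : nat -> Omega -> R) f h :
  (forall n, measurable_fun setT (f_ n)) -> measurable_fun setT f -> L1 h ->
  {ae P, forall w, f_ ^~ w @ \oo --> f w} ->
  {ae P, forall w, forall n, `|f_ n w| <= h w} ->
  L1 f /\ Ex (f_ n) @[n --> \oo] --> Ex f.
Proof.
move=> mf_ mf Lh ff fh.
have [] := @dominated_convergence _ _ _ P setT measurableT (fun n => EFin \o f_ n)
  (EFin \o f) (EFin \o h) _ _ _ Lh _.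
- by move=> n; exact/measurable_EFinP.
- exact/measurable_EFinP.
- apply: filterS ff => w ffw _; apply/fine_cvgP; split; first exact: nearW.
  exact: ffw.
- by apply: filterS fh => w fhw n _ /=; rewrite lee_fin.
move=> Lf _ H; split => //.
have := @fine_cvg _ _ \oo _ (fun n => \int[P]_x (EFin \o f_ n) x)%E (Ex f); apply.
by rewrite /Ex/Rintegral fineK//; exact: integrable_fin_num Lf.
Qed.

End expectation.

Section convergence_theorems.
Context {R : realType} {d : measure_display} {Omega : measurableType d}.
Variable P : probability Omega R.
Implicit Types (f g h : Omega -> R).
Notation L1 := (L1 P).
Notation Ex := (Ex P).

Lemma Gmeas_mf (G : set (set Omega)) f : G `<=` measurable -> Gmeas G f -> measurable_fun setT f.
Proof. by move=> Gm Gf _ B mB; rewrite setTI; exact/Gm/Gf. Qed.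

(** The limit is taken in the extended reals, where it exists everywhere and is measurable for [G];
    [fine] then sends its infinite values, a null set by the bound [M], to 0. The last clause holds
    everywhere and will make the value of an arm vanish at every point of [rec]. *)
Lemma Ex_mct (G : set (set Omega)) (f_ : nat -> Omega -> R) M :
  sub_sigma G -> (forall n, Gmeas G (f_ n)) -> (forall n, L1 (f_ n)) ->
  (forall n w, 0 <= f_ n w) -> (forall n w, f_ n w <= f_ n.+1 w) ->
  (forall n, Ex (f_ n) <= M) ->
  exists f, [/\ Gmeas G f, L1 f, (forall w, 0 <= f w),
    {ae P, forall w, f_ ^~ w @ \oo --> f w} &
    (forall w, (forall n, f_ n w = 0) -> f w = 0)].
Proof.
move=> [sG Gm] Gf Lf f0 fS fM.
pose F w := limn (fun n => (f_ n w)%:E).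
have ndF w : {homo (fun n => (f_ n w)%:E) : m n / (m <= n)%N >-> (m <= n)%E}.
  by apply/nondecreasing_seqP => n; rewrite lee_fin.
have cF w : (fun n => (f_ n w)%:E) @ \oo --> F w by apply: ereal_nondecreasing_is_cvgn.
have F0 w : (0 <= F w)%E.
  by apply: lime_ge; [exact: ereal_nondecreasing_is_cvgn|apply: nearW => n; rewrite lee_fin].
have mFG : measurable_fun setT (F : g_sigma_algebraType G -> \bar R).
  apply: (@emeasurable_fun_cvg _ (g_sigma_algebraType G) _ _ (fun n w => (f_ n w)%:E)).
    by move=> n; apply/measurable_EFinP; exact/GmeasP.
  by move=> w _; exact: cF.
have GF : Gmeas G F by apply/GmeasP.
have mF : measurable_fun setT F.
  by move=> _ B mB; rewrite setTI; exact/Gm/GF.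
have IF : (\int[P]_w F w <= M%:E)%E.
  have := @cvg_monotone_convergence _ _ _ P setT measurableT (fun n w => (f_ n w)%:E) _ _ _.
  rewrite -/F; move=> /(_ (fun n => (measurable_EFinP _ _).2 (L1_meas (Lf n)))).
  move=> /(_ (fun n w _ => f0 n w)) /(_ (fun w _ => ndF w)) H.
  rewrite -(cvg_lim _ H)//; apply: lime_le; first by apply/cvg_ex; eexists; exact: H.
  apply: nearW => n; rewrite -[leLHS]fineK; first by rewrite lee_fin; exact: fM.
  by apply: integrable_fin_num => //; exact: Lf.
have LF : P.-integrable setT F.
  apply/integrableP; split => //; under eq_integral do rewrite gee0_abs//.
  by apply: le_lt_trans IF _; rewrite ltry.
have Ffin : {ae P, forall w, F w \is a fin_num}.
  by apply: filterS (integrable_ae measurableT LF) => w; exact.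
exists (fine \o F); split.
- exact: Gm_comp GF.
- apply/integrableP; split.
    apply/measurable_EFinP; exact: measurableT_comp.
  have /integrableP[_] := LF; apply: le_lt_trans; apply: ge0_le_integral => //.
  + by do 3 apply: measurableT_comp => //.
  + by apply: measurableT_comp.
  + by move=> w _ /=; case: (F w) => [r| |] //=; rewrite normr0 leey.
- by move=> w /=; rewrite fine_ge0.
- apply: filterS Ffin => w Fw.
  by have := cF w; rewrite -(fineK Fw) => /fine_cvgP[].
- move=> w fw; rewrite /= /F.
  under eq_fun do rewrite fw.
  by rewrite lim_cst.
Qed.

(** Testing on the event [g < f], which belongs to [G], exhibits a nonnegative function of
    nonpositive expectation. *)
Lemma Ex_test (G : set (set Omega)) f g : sub_sigma G -> Gmeas G f -> Gmeas G g ->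
  L1 f -> L1 g ->
  (forall C, G C -> Ex (fun w => \1_C w * f w) <= Ex (fun w => \1_C w * g w)) ->
  {ae P, forall w, f w <= g w}.
Proof.
move=> [sG Gm] Gf Gg Lf Lg fg; pose C := [set w | g w < f w].
have GC : G C by exact: Gm_lt.
have mC := Gm _ GC.
have L : L1 (fun w => \1_C w * (f w - g w)) by apply: L1_ind => //; exact: L1B.
have := @Ex_eq0 _ _ _ P _ L.
have -> : Ex (fun w => \1_C w * (f w - g w)) =
    Ex (fun w => \1_C w * f w) - Ex (fun w => \1_C w * g w).
  rewrite -ExB; [by apply: eq_Ex => w; ring|exact: L1_ind|exact: L1_ind].
rewrite subr_le0 => /(_ _ (fg _ GC)) H.
have {}H : {ae P, forall w, \1_C w * (f w - g w) = 0}.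
  apply: H => w; rewrite indicE; case: (boolP (w \in C)) => [/set_mem/= wC|_].
    by rewrite mul1r subr_ge0 ltW.
  by rewrite mul0r.
apply: filterS H => w; rewrite indicE; case: (boolP (w \in C)) => [/set_mem/= wC|/negP wC _].
  by move/eqP; rewrite mul1r subr_eq0 => /eqP ->.
by rewrite leNgt; apply/negP => gf; apply: wC; rewrite inE.
Qed.

(* A [[0, 1]]-valued function is thus uniformly approximated by averages of the
   indicators of its upper level sets. *)
Lemma level_approx (n : nat) (x : R) : 0 <= x <= 1 ->
  `|x - n.+1%:R^-1 * \sum_(k < n.+1) (k.+1%:R / n.+1%:R <= x)%R%:R| <= n.+1%:R^-1.
Proof.
move=> /andP[x0 x1]; set N := n.+1.
have N0 : 0 < N%:R :> R by rewrite ltr0n.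
have [m' [mN' mx' xm']] : exists m, [/\ (m <= N)%N,
    \sum_(k < N) (k.+1%:R / N%:R <= x)%R%:R = m%:R :> R & (m%:R <= x * N%:R <= m.+1%:R)].
  exists (Num.truncn (x * N%:R)).
  have xN0 : 0 <= x * N%:R by rewrite mulr_ge0// ltW.
  have /andP[h1 h2] := truncn_itv xN0.
  have mN' : (Num.truncn (x * N%:R)%R <= N)%N.
    rewrite -(ler_nat R); apply: (le_trans h1).
    by rewrite ler_piMl// ltW.
  split=> //; last by rewrite h1 ltW.
  rewrite -natr_sum; congr (_%:R).
  transitivity (\sum_(0 <= k < N) (k < Num.truncn (x * N%:R)))%N.
    rewrite big_mkord; apply: eq_bigr => k _; congr nat_of_bool.
    by rewrite ler_pdivrMr// truncn_ge_nat.
  rewrite (big_cat_nat (n:=Num.truncn (x * N%:R)))//=.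
  rewrite [X in (_ + X)%N]big_nat_cond [X in (_ + X)%N]big1 ?addn0; last first.
    by move=> i /andP[/andP[h _] _]; rewrite ltnNge h.
  rewrite (eq_big_nat _ _ (F2 := fun=> 1%N)); last by move=> i /andP[_ ->].
  by rewrite sum_nat_const_nat subn0 muln1.
rewrite mx' -(ler_pM2r N0) -[X in _ * X <= _]gtr0_norm// -normrM mulrBl mulVf ?gt_eqF//.
rewrite mulrAC mulVf ?gt_eqF// mul1r.
case/andP: xm' => h1 h2; rewrite ger0_norm ?subr_ge0//.
by rewrite lerBlDr -natr1 in h2 *; lra.
Qed.

End convergence_theorems.

(** * Pulling a known factor out of an expectation *)

Section pull_out.
Context {R : realType} {d : measure_display} {Omega : measurableType d}.
Variable P : probability Omega R.
Implicit Types (f g h : Omega -> R).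
Notation L1 := (L1 P).
Notation Ex := (Ex P).

Lemma le0_of_bounded_multiples (x K : R) : (forall n, x * n.+1%:R <= K) -> x <= 0.
Proof.
move=> xK; rewrite leNgt; apply/negP => x0.
have := xK (Num.truncn (K / x)); apply/negP; rewrite -ltNge mulrC -ltr_pdivrMr//.
exact: truncnS_gt.
Qed.

Variable G : set (set Omega).
Hypothesis sG : sub_sigma G.

(** An average of indicators of the level sets of [f] satisfies the inequality by hypothesis. It
    differs from [f] by at most [1 / n.+1], so the expectation is at most [Ex |Y| / n.+1] for every
    [n]. *)
Lemma Ex_pull01 f Y : Gmeas G f -> (forall w, 0 <= f w <= 1) -> L1 Y ->
  (forall C, G C -> Ex (fun w => \1_C w * Y w) <= 0) -> Ex (fun w => f w * Y w) <= 0.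
Proof.
move=> Gf f01 LY H; apply: (@le0_of_bounded_multiples _ (Ex (fun w => `|Y w|))) => n.
pose C k := [set w | k.+1%:R / n.+1%:R <= f w].
have GC k : G (C k) by apply: Gm_le => //; [case: sG|apply: Gm_cst; case: sG].
have mC k : measurable (C k) by case: sG => _; apply.
pose fn w := n.+1%:R^-1 * \sum_(k < n.+1) (k.+1%:R / n.+1%:R <= f w)%R%:R : R.
have fnE w : fn w * Y w = n.+1%:R^-1 * \sum_(k < n.+1) (\1_(C k) w * Y w).
  rewrite /fn -mulrA; congr (_ * _); rewrite mulr_suml; apply: eq_bigr => k _.
  congr (_ * _); rewrite indicE; congr (nat_of_bool _)%:R.
  by apply/idP/idP => [h|/set_mem//]; exact/mem_set.
have Ln : L1 (fun w => fn w * Y w).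
  apply: (eq_L1 (fun w => esym (fnE w))); apply: L1Z; apply: L1_sum => k _.
  exact: L1_ind.
have mf : measurable_fun setT f by apply: Gmeas_mf Gf; case: sG.
have Lf : L1 (fun w => f w * Y w).
  by apply: (@L1_mulb _ _ _ _ _ _ 1) => // w; case/andP: (f01 w) => *; rewrite ger0_norm.
have En : Ex (fun w => fn w * Y w) <= 0.
  rewrite (eq_Ex _ fnE) ExZ ?Ex_sum; last 2 first.
  - by move=> k _; exact: L1_ind.
  - by apply: L1_sum => k _; exact: L1_ind.
  rewrite mulr_ge0_le0 ?invr_ge0//.
  by apply: sumr_le0 => k _; exact: H.
rewrite -ler_pdivlMr ?ltr0n// mulrC -ExZ; last exact: L1_abs.
rewrite -[X in X <= _](subrK (Ex (fun w => fn w * Y w))) -ExB//.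
rewrite -[leRHS]addr0 lerD//; apply: Ex_le; [exact: L1B|exact/L1Z/L1_abs|move=> w].
rewrite -mulrBl (le_trans (ler_norm _))// normrM ler_wpM2r//.
exact: level_approx.
Qed.

(** The truncations of [f] at [n.+1], divided by [n.+1], fall under the previous lemma; dominated
    convergence removes the truncation. *)
Lemma Ex_pull_le0 f Y : Gmeas G f -> (forall w, 0 <= f w) -> L1 Y ->
  L1 (fun w => f w * Y w) ->
  (forall C, G C -> Ex (fun w => \1_C w * Y w) <= 0) -> Ex (fun w => f w * Y w) <= 0.
Proof.
move=> Gf f0 LY LfY H; have mf : measurable_fun setT f by apply: Gmeas_mf Gf; case: sG.
pose fn n w := Num.min (f w) n.+1%:R.
have fn0 n w : 0 <= fn n w by rewrite le_min f0/=.
have mfn n : measurable_fun setT (fn n) by apply: measurable_minr => //.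
have [| |_ cv] := @Ex_dct _ _ _ P (fun n w => fn n w * Y w) (fun w => f w * Y w)
  (fun w => `|f w * Y w|) (fun n => measurable_funM (mfn n) (L1_meas LY)) (L1_meas LfY)
  (L1_abs LfY).
- apply: aeW => w; apply: cvgM; last exact: cvg_cst.
  apply: cvg_near_cst; near=> n.
  apply/min_idPl; near: n; exists (Num.truncn (f w)) => // n /= hn.
  by apply: ltW; apply: lt_le_trans (truncnS_gt _) _; rewrite ler_nat ltnS.
- apply: aeW => w n; rewrite !normrM ler_wpM2r// !ger0_norm//.
  by rewrite ge_min lexx.
rewrite -(cvg_lim _ cv)//; apply: limr_le; first by apply/cvg_ex; eexists; exact: cv.
apply: nearW => n.
have -> : Ex (fun w => fn n w * Y w) = n.+1%:R * Ex (fun w => fn n w / n.+1%:R * Y w).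
  rewrite -ExZ; first by apply: eq_Ex => w; rewrite mulrA [n.+1%:R * _]mulrC divfK ?pnatr_eq0.
  apply: (@L1_mulb _ _ _ _ _ _ 1) => //; first exact: measurable_funM.
  by move=> w; rewrite ger0_norm ?divr_ge0// ler_pdivrMr// mul1r ge_min lexx orbT.
rewrite mulr_ge0_le0//; apply: Ex_pull01 => //.
  by case: sG => ? ?; apply: GmM => //; [apply: Gm_min => //; exact: Gm_cst|exact: Gm_cst].
move=> w; rewrite divr_ge0//= ler_pdivrMr// mul1r ge_min lexx orbT//.
Unshelve. all: by end_near. Qed.

(** The hypothesis on events says that [Y] has zero conditional mean given [G]; positive and
    negative parts of [f] are treated separately. Independence, too, is brought in through this
    lemma: an independent indicator minus its probability is such a [Y]. *)
Lemma Ex_pull f Y : Gmeas G f -> L1 Y -> L1 (fun w => f w * Y w) ->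
  (forall C, G C -> Ex (fun w => \1_C w * Y w) = 0) -> Ex (fun w => f w * Y w) = 0.
Proof.
move=> Gf LY LfY H; have [sG1 sG2] := sG.
have key g : Gmeas G g -> (forall w, 0 <= g w <= `|f w|) ->
    L1 (fun w => g w * Y w) /\ Ex (fun w => g w * Y w) = 0.
  move=> Gg g0; have L : L1 (fun w => g w * Y w).
    apply: (@L1_le _ _ _ _ _ (fun w => `|f w * Y w|)); last 2 first.
    - exact: L1_abs.
    - by move=> w; case/andP: (g0 w) => *; rewrite !normrM ler_wpM2r// ger0_norm.
    by apply: measurable_funM; [exact: Gmeas_mf Gg|exact: L1_meas LY].
  split=> //; apply/le_anti/andP; split.
    by apply: Ex_pull_le0 => // [w|C /H ->//]; case/andP: (g0 w).
  rewrite -oppr_le0 -mulN1r -ExZ//.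
  rewrite (eq_Ex _ (g := fun w => g w * (-1 * Y w))); last by move=> w; ring.
  apply: Ex_pull_le0 => //; [by move=> w; case/andP: (g0 w)|exact: L1Z| |].
    by apply: eq_L1 (L1Z (-1) L) => w; ring.
  move=> C GC; rewrite (eq_Ex _ (g := fun w => -1 * (\1_C w * Y w))); last by move=> w; ring.
  by rewrite ExZ ?H ?mulr0//; apply: L1_ind => //; exact: sG2.
have [||L1p E1] := key (fun w => Num.max (f w) 0).
- by apply: Gm_max => //; exact: Gm_cst.
- by move=> w; rewrite le_max lexx orbT/= ge_max ler_norm normr_ge0.
have [||L1n E2] := key (fun w => Num.max (0 - f w) 0).
- by apply: Gm_max => //; [apply: GmB => //; exact: Gm_cst|exact: Gm_cst].
- by move=> w; rewrite le_max lexx orbT/= ge_max sub0r -normrN ler_norm normr_ge0.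
rewrite (eq_Ex _ (g := fun w => Num.max (f w) 0 * Y w - Num.max (0 - f w) 0 * Y w)).
  by rewrite ExB// E1 E2 subrr.
move=> w; rewrite -mulrBl; congr (_ * _); rewrite sub0r.
by have [] := leP (f w) 0 => h; have [] := leP (- f w) 0 => h'; lra.
Qed.

Lemma cond_expP Y Z : cond_exp P G Y Z <->
  [/\ L1 Y, Gmeas G Z, L1 Z &
      forall C, G C -> Ex (fun w => \1_C w * Z w) = Ex (fun w => \1_C w * Y w)].
Proof.
have key f C : G C -> L1 f -> (\int[P]_(w in C) (f w)%:E)%E = (Ex (fun w => \1_C w * f w))%:E.
  move=> GC Lf; have mC : measurable C by case: sG => _; apply.
  rewrite /Ex /Rintegral fineK; last by apply: integrable_fin_num => //; exact: L1_ind.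
  rewrite [LHS]integral_mkcond; apply: eq_integral => w _.
  by rewrite /patch indicE; case: (w \in C); rewrite ?mul1r ?mul0r.
split=> [[LY [GZ [LZ H]]]|[LY GZ LZ H]].
  by split=> // C GC; have := H C GC; rewrite !key// => -[].
by do 3 split => //; move=> C GC; rewrite !key// H.
Qed.
End pull_out.

(** * Existence of conditional expectations *)

Section conditional_expectation.
Context {R : realType} {d : measure_display} {Omega : measurableType d}.
Variables (P : probability Omega R) (G : set (set Omega)) (sG : sub_sigma G).
Variables (Y : Omega -> R) (LY : L1 P Y).
Local Open Scope ereal_scope.

Local Notation gT := (g_sigma_algebraType G).
Let gm (A : set gT) : measurable A -> d.-measurable A.
Proof.
case: sG => sG1 sG2; rewrite /measurable/= => mA; apply: sG2.
by move: A mA; exact: smallest_sub.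
Qed.

Definition restr_prob (A : set gT) : \bar R := P A.
Local Notation rP := restr_prob.
Let rP0 : rP set0 = 0. Proof. exact: measure0. Qed.
Let rP_ge0 A : 0 <= rP A. Proof. exact: measure_ge0. Qed.
Let rP_sigma : semi_sigma_additive rP.
Proof.
move=> F mF tF mUF; apply: (@measure_semi_sigma_additive _ _ _ P F) => //.
  by move=> i; exact: gm.
exact: gm.
Qed.
HB.instance Definition _ := isMeasure.Build _ _ _ rP rP0 rP_ge0 rP_sigma.
Let rPT : rP setT = 1. Proof. exact: probability_setT. Qed.
HB.instance Definition _ := Measure_isProbability.Build _ _ _ rP rPT.

Definition restr_charge (A : set gT) : \bar R := induced_charge LY A.
Local Notation nu := restr_charge.
Let nu0 : nu set0 = 0. Proof. exact: charge0. Qed.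
Let nufin A : measurable A -> nu A \is a fin_num.
Proof. by move=> mA; apply: fin_num_measure; exact: gm. Qed.
Let nu_sigma : semi_sigma_additive nu.
Proof.
move=> F mF tF mUF; apply: (@charge_semi_sigma_additive _ _ _ (induced_charge LY)) => //.
  by move=> i; exact: gm.
exact: gm.
Qed.
HB.instance Definition _ := isCharge.Build _ _ _ nu nu0 nufin nu_sigma.

(** The Radon-Nikodym derivative, on the coarser measurable space, of the charge with density [Y]
    with respect to the restriction of [P]. *)
Lemma cond_exp_ex : exists Z, cond_exp P G Y Z.
Proof.
have dom : nu `<< rP.
  apply/null_content_dominatesP => A mA PA0.
  apply: null_set_integral => //; first exact: gm.
  by apply: measurable_funTS; exact/measurable_EFinP/(L1_meas LY).
pose h := Radon_Nikodym nu rP.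
have hfin w : h w \is a fin_num by exact: Radon_Nikodym_fin_num.
have hint : rP.-integrable setT h by exact: Radon_Nikodym_integrable.
have hE A : measurable A -> nu A = \int[rP]_(w in A) h w by exact: Radon_Nikodym_integral.
have mh : measurable_fun setT h by apply: measurable_int hint.
(* The identity onto the coarser space pushes [P] forward to [rP], so integrals against [rP] become
   integrals against [P]. *)
have mid : measurable_fun setT (id : Omega -> gT).
  by move=> _ A mA; rewrite setTI; exact: gm.
have rPE A g : measurable A -> measurable_fun setT g -> (forall w, 0 <= g w) ->
    \int[rP]_(w in A) g w = \int[P]_(w in A) g w.
  move=> mA mg g0.
  have := ge0_integral_pushforward mid P mA (measurable_funTS mg) (fun w _ => g0 w).
  by move=> <-; apply: eq_measure_integral.
have mhO : measurable_fun setT (h : Omega -> \bar R).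
  exact: (measurableT_comp mh mid).
have hP : P.-integrable setT h.
  apply/integrableP; split => //; rewrite -rPE//; last exact: measurableT_comp.
  by case/integrableP : hint.
have [sG1 sG2] := sG.
exists (fine \o h); split=> //; split; last split.
- by apply/(GmeasP _ sG1); exact: measurableT_comp mh.
- by apply: eq_integrable hP => // w _ /=; rewrite fineK.
- move=> A GA; have mA : measurable (A : set gT) by exact: sub_sigma_algebra.
  under eq_integral do rewrite /= fineK//.
  rewrite -[RHS]/(nu A) hE//.
  have := @integral_pushforward _ _ _ _ R _ mid P A h mh _ mA.
  move=> <-; last by apply: integrableS hP => //; exact: gm.
  by apply: eq_measure_integral.
Qed.

End conditional_expectation.

Section discount.
Context {R : realType}.

Lemma discE (q a b : R) : 0 < q -> a < b ->
  disc q a b = (expR (- (q * a)) - expR (- (q * b))) / q.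
Proof.
move=> q0 ab; rewrite /disc /Rintegral.
pose Fq (r : R) := - q^-1 * expR (- (q * r)) : R.
have dF (x : R) : is_derive x (1 : R) Fq (expR (- (q * x))).
  rewrite /Fq; apply: is_derive_eq.
  by rewrite /GRing.scale/=; field; rewrite gt_eqF.
have ce (f : R -> R) : (forall x, derivable f x 1) -> continuous f.
  by move=> df x; apply: differentiable_continuous; exact/derivable1_diffP.
have cF : continuous Fq by apply: ce => x; exact: ex_derive.
have cf : continuous (fun r : R => expR (- (q * r))).
  by apply: ce => x; exact: ex_derive.
rewrite (@continuous_FTC2 _ _ Fq)//.
- rewrite -EFinB/= /Fq; field; rewrite gt_eqF//.
- exact: continuous_subspaceT.
- split.
  + by move=> z _; exact: ex_derive.
  + by apply/cvg_at_right_filter; exact: cF.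
  + by apply/cvg_at_left_filter; exact: cF.
- by move=> x _; rewrite derive1E derive_val.
Qed.

End discount.

(** * Serving jobs in decreasing order *)

Section rearrangement.
Context {R : realType} (J : nat) (q : R) (T : 'I_J -> nat -> R).
Hypothesis q0 : 0 < q.
Hypothesis T0 : forall j, T j 0%N = 0.
Hypothesis TS : forall j s, T j s <= T j s.+1.

Definition is_path (p : nat -> 'I_J -> nat) (a : nat -> 'I_J) :=
  (forall k, p 0%N k = 0%N) /\ forall t k, p t.+1 k = (p t k + (k == a t))%N.

Definition clock (p : nat -> 'I_J -> nat) t := \sum_k T k (p t k).

(** The integral of [exp (- q r)] over [r >= x], so that [slot] is the discounted length of a
    period. *)
Definition ddisc (x : R) := expR (- (q * x)) / q.

Definition slot p t := ddisc (clock p t) - ddisc (clock p t.+1).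

Lemma ddisc_le x y : x <= y -> ddisc y <= ddisc x.
Proof.
by move=> xy; rewrite /ddisc ler_pM2r ?invr_gt0// ler_expR lerN2 ler_pM2l.
Qed.

Lemma ddisc_ge0 x : 0 <= ddisc x.
Proof. by rewrite /ddisc divr_ge0 ?expR_ge0// ltW. Qed.

Lemma T_le j m n : (m <= n)%N -> T j m <= T j n.
Proof. by move: m n; apply/nondecreasing_seqP => s. Qed.

Lemma clockS p a t : is_path p a ->
  clock p t.+1 = clock p t + (T (a t) (p t (a t)).+1 - T (a t) (p t (a t))).
Proof.
move=> [_ pS]; rewrite /clock (bigD1 (a t))//= [in RHS](bigD1 (a t))//=.
rewrite pS eqxx addn1 (eq_bigr (fun k => T k (p t k))); first by ring.
by move=> k ka; rewrite pS (negbTE ka) addn0.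
Qed.

Lemma clock_leS p a t : is_path p a -> clock p t <= clock p t.+1.
Proof. by move=> pa; rewrite (clockS _ pa) lerDl subr_ge0. Qed.

Lemma clock0 p a : is_path p a -> clock p 0 = 0.
Proof. by move=> [p0 _]; rewrite /clock big1// => k _; rewrite p0. Qed.

Lemma slot_ge0 p a t : is_path p a -> 0 <= slot p t.
Proof. by move=> pa; rewrite subr_ge0 ddisc_le// (clock_leS _ pa). Qed.

Lemma sum_slot p N : \sum_(t < N) slot p t = ddisc (clock p 0) - ddisc (clock p N).
Proof.
elim: N => [|N IH]; first by rewrite big_ord0 subrr.
by rewrite big_ord_recr/= IH /slot; ring.
Qed.

(* Whatever the order of service, a family of jobs occupies the most valuable
   part of the time axis when it is served first. *)
Lemma slot_capacity p a (r : 'I_J -> nat) N : is_path p a ->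
  \sum_(t < N) (p t (a t) < r (a t))%N%:R * slot p t
    <= ddisc 0 - ddisc (\sum_k T k (r k)).
Proof.
(* [c N] is the time spent before period [N] on operations below the caps [r], as if pushed to the
   front of the time axis. A counted slot has the same length as its pushed copy but starts no
   earlier, hence weighs no more. *)
move=> pa; have [p0 pS] := pa; pose c N := \sum_k T k (minn (p N k) (r k)).
suff: \sum_(t < N) (p t (a t) < r (a t))%N%:R * slot p t <= ddisc 0 - ddisc (c N).
  move=> /le_trans; apply; rewrite lerB// ddisc_le//.
  by apply: ler_sum => k _; apply: T_le; exact: geq_minr.
elim: N => [|N IH].
  rewrite big_ord0 /c big1 ?subrr// => k _.
  by rewrite p0 min0n.
rewrite big_ord_recr/=; have cle : c N <= clock p N.
  by apply: ler_sum => k _; apply: T_le; exact: geq_minl.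
case: ltnP => hr; last first.
  rewrite mul0r addr0; have -> : c N.+1 = c N; last exact: IH.
  apply: eq_bigr => k _; congr (T k _); rewrite pS.
  have [->|_] := eqVneq k (a N); last by rewrite addn0.
  by rewrite (minn_idPr hr) addn1; apply/minn_idPr; exact: leqW.
rewrite mul1r /slot (clockS _ pa).
set u := T _ _ - T _ _.
have u0 : 0 <= u by rewrite subr_ge0.
have -> : c N.+1 = c N + u.
  rewrite /c (bigD1 (a N))//= [in RHS](bigD1 (a N))//= pS eqxx addn1.
  rewrite (minn_idPl hr) (minn_idPl (ltnW hr)).
  rewrite (eq_bigr (fun k => T k (minn (p N k) (r k)))); first by rewrite /u; ring.
  by move=> k ka; rewrite pS (negbTE ka) addn0.
have key : ddisc (clock p N) - ddisc (clock p N + u) <= ddisc (c N) - ddisc (c N + u).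
  have eD x : expR (- (q * (x + u))) = expR (- (q * x)) * expR (- (q * u)).
    by rewrite -expRD; congr expR; ring.
  rewrite /ddisc !eD -!mulrBl ler_pM2r ?invr_gt0//.
  have eF x : expR (- (q * x)) - expR (- (q * x)) * expR (- (q * u)) =
    expR (- (q * x)) * (1 - expR (- (q * u))) by ring.
  rewrite !eF ler_wpM2r//; last by rewrite ler_expR lerN2 ler_pM2l.
  by rewrite subr_ge0 -expR0 ler_expR oppr_le0 mulr_ge0// ltW.
by lra.
Qed.

Variables (g : 'I_J -> nat -> R).
Hypothesis gS : forall j s, g j s.+1 <= g j s.
Variables (p : nat -> 'I_J -> nat) (a : nat -> 'I_J) (pa : is_path p a).
Variables (p' : nat -> 'I_J -> nat) (a' : nat -> 'I_J) (pa' : is_path p' a').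
Let M t := g (a' t) (p' t (a' t)).
Hypothesis greedy : forall t k, g k (p' t k) <= M t.

Let g_le j m n : (m <= n)%N -> g j n <= g j m.
Proof. by move: m n; apply/nonincreasing_seqP => s. Qed.

Lemma greedy_nonincreasing t : M t.+1 <= M t.
Proof.
apply: le_trans (greedy t (a' t.+1)); rewrite /M; apply: g_le.
by case: pa' => _ ->; exact: leq_addr.
Qed.

(** An operation performed by the greedy path in some period [m < n] has charge [M m], which the
    layers from [m] to [n] add up to exactly. An operation not yet performed is charged at most
    [M n], because its arm is available to the greedy path. *)
Lemma greedy_layers n j s :
  g j s <= M n + \sum_(m < n) (M m - M m.+1) * (s < p' m.+1 j)%N%:R.
Proof.
elim: n => [|n IH].
  rewrite big_ord0 addr0; apply: le_trans (greedy 0 j); apply: g_le.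
  by case: pa' => ->.
have [hs|hs] := ltnP s (p' n.+1 j).
  by apply: le_trans IH _; rewrite big_ord_recr/= hs mulr1; set S := \sum_(i < n) _; lra.
rewrite big1 ?addr0; last first.
  move=> m _; rewrite ltnNge (leq_trans _ hs) ?mulr0//.
  have : {homo (p'^~ j) : x y / (x <= y)%N}.
    apply: homo_leq => [//|x y z|t]; first exact: leq_trans.
    by case: pa' => _ ->; exact: leq_addr.
  by apply.
exact: le_trans (g_le _ hs) (greedy _ _).
Qed.

(** The layer [M m - M m.+1] only concerns operations that the greedy path completes in its first
    [m.+1] periods. By [slot_capacity] no path gives them more discounted time than the greedy one,
    which does nothing else in these periods. The last term accounts for the bottom layer [M n], of
    arbitrary sign, being collected up to different clock times. *)
Lemma greedy_optimal N n :
  \sum_(t < N) g (a t) (p t (a t)) * slot p t <=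
  \sum_(t < n) M t * slot p' t + M n * (ddisc (clock p' n) - ddisc (clock p N)).
Proof.
have abel k : \sum_(m < k) (M m - M m.+1) * (ddisc 0 - ddisc (clock p' m.+1)) =
    \sum_(m < k) M m * slot p' m - M k * (ddisc 0 - ddisc (clock p' k)).
  elim: k => [|k IH]; first by rewrite !big_ord0 (clock0 pa') subrr mulr0 subrr.
  by rewrite !big_ord_recr/= IH /slot; ring.
have -> : \sum_(t < n) M t * slot p' t +
      M n * (ddisc (clock p' n) - ddisc (clock p N)) =
    \sum_(t < N) M n * slot p t +
    \sum_(m < n) (M m - M m.+1) * (ddisc 0 - ddisc (clock p' m.+1)).
  by rewrite abel -mulr_sumr sum_slot (clock0 pa); ring.
apply: (@le_trans _ _ (\sum_(t < N) (M n * slot p t + \sum_(m < n)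
   (M m - M m.+1) * ((p t (a t) < p' m.+1 (a t))%N%:R * slot p t)))).
  apply: ler_sum => t _; apply: le_trans (ler_wpM2r (slot_ge0 _ pa) (greedy_layers n _ _)) _.
  by rewrite mulrDl mulr_suml lerD2l; apply: ler_sum => m _; rewrite mulrA.
rewrite big_split/= lerD2l exchange_big/=; apply: ler_sum => m _.
rewrite -mulr_sumr ler_wpM2l ?subr_ge0 ?greedy_nonincreasing//.
exact: slot_capacity.
Qed.

End rearrangement.

Section series_and_indicators.
Context {R : realType} {d : measure_display} {Omega : measurableType d}.
Variable P : probability Omega R.
Notation L1 := (L1 P).
Notation Ex := (Ex P).

(** Supplies a single integrable function above all partial sums, for use in dominated
    convergence. *)
Lemma Ex_series (f : nat -> Omega -> R) (M : R) :
  (forall n, L1 (f n)) -> (forall n w, 0 <= f n w) ->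
  (forall n, \sum_(k < n) Ex (f k) <= M) ->
  exists h : Omega -> R, [/\ L1 h, forall w, 0 <= h w &
    {ae P, forall w, (fun n => \sum_(k < n) f k w) @ \oo --> h w /\
      forall n, \sum_(k < n) f k w <= h w}].
Proof.
move=> Lf f0 fM.
have [h [_ Lh h0 hcv _]] : exists h : Omega -> R, [/\ Gmeas measurable h, L1 h, forall w, 0 <= h w,
    {ae P, forall w, (fun n => \sum_(k < n) f k w) @ \oo --> h w} &
    forall w, (forall n, \sum_(k < n) f k w = 0) -> h w = 0].
  apply: (@Ex_mct _ _ _ P _ (fun n w => \sum_(k < n) f k w) M sub_sigma_measurable).
  - move=> n; apply: Gm_sum; first by case: (@sub_sigma_measurable _ Omega).
    by move=> k _ B mB; have := L1_meas (Lf k); move=> /(_ measurableT B mB); rewrite setTI.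
  - by move=> n; apply: L1_sum => k _.
  - by move=> n w; apply: sumr_ge0 => k _.
  - by move=> n w; rewrite big_ord_recr lerDl/=.
  - by move=> n; rewrite Ex_sum.
exists h; split=> //; apply: ae_mono hcv _ => w cw; split=> // n.
have nd : nondecreasing_seq (fun n => \sum_(k < n) f k w).
  by apply/nondecreasing_seqP => m; rewrite big_ord_recr lerDl/=.
rewrite -(cvg_lim _ cw)//; apply: nondecreasing_cvgn_le => //.
by apply/cvg_ex; eexists; exact: cw.
Qed.

Lemma indic01 (A : set Omega) w : 0 <= (\1_A w : R) <= 1.
Proof. by rewrite indicE; case: (_ \in _); rewrite ?lexx ?ler01. Qed.

Lemma norm_indic (A : set Omega) w : `|\1_A w : R| <= 1.
Proof. by have /andP[? ?] := indic01 A w; rewrite ger0_norm. Qed.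

Lemma indicP1 (A : set Omega) w : A w -> \1_A w = 1 :> R.
Proof. by move=> Aw; rewrite indicE mem_set. Qed.

Lemma indicP0 (A : set Omega) w : ~ A w -> \1_A w = 0 :> R.
Proof. by move=> Aw; rewrite indicE memNset. Qed.

Lemma indicU (A B : set Omega) w : A `&` B = set0 ->
  \1_(A `|` B) w = \1_A w + \1_B w :> R.
Proof.
move=> AB; have [Aw|Aw] := pselect (A w); have [Bw|Bw] := pselect (B w).
- by have : (A `&` B) w by []; rewrite AB.
- by rewrite (indicP1 Aw) (indicP0 Bw) addr0 indicP1//; left.
- by rewrite (indicP0 Aw) (indicP1 Bw) add0r indicP1//; right.
- by rewrite (indicP0 Aw) (indicP0 Bw) addr0 indicP0// => -[].
Qed.

End series_and_indicators.

(** * Optimal stopping *)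

Section snell.
Context {R : realType} {d : measure_display} {Omega : measurableType d}.
Variables (P : probability Omega R) (F : nat -> set (set Omega)).
Notation L1 := (L1 P).
Notation Ex := (Ex P).
Hypothesis sF : forall u, sub_sigma (F u).
Hypothesis FS : forall u, F u `<=` F u.+1.

(* A stopping time [tau > u] restricted to an event [B u] of [F u], encoded by
   the events [B v = B u /\ {v < tau}]. *)
Definition thread u (B : nat -> set Omega) :=
  [/\ forall v, F v (B v), forall v, (v < u)%N -> B v = set0 &
      forall v, (u <= v)%N -> B v.+1 `<=` B v].

Variables (al : nat -> Omega -> R) (rec : nat -> set Omega) (M : R).
Hypothesis Gal : forall u, Gmeas (F u) (al u).
Hypothesis Lal : forall u, L1 (al u).
Hypothesis alM : forall n, \sum_(v < n) Ex (fun w => `|al v w|) <= M.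
Hypothesis Frec : forall u, F u (rec u).
(** A rule that starts on [rec] and quits no later than the next visit to [rec] cannot gain. This
    and the next hypothesis are all that is retained of the index. *)
Hypothesis excursion_le0 : forall u B n, thread u B -> B u `<=` rec u ->
  (forall v, (u < v)%N -> B v `<=` ~` rec v) ->
  \sum_(v < n) Ex (fun w => \1_(B v) w * al v w) <= 0.
(** Continuing is never worse than stopping: rules that operate at least once have no negative bound
    on their conditional gain. *)
Hypothesis attained : forall u (Q : Omega -> R), Gmeas (F u) Q -> L1 Q ->
  (forall B n, thread u B -> (u < n)%N ->
     \sum_(v < n) Ex (fun w => \1_(B v) w * al v w) <=
                 Ex (fun w => \1_(B u) w * Q w)) ->
  {ae P, forall w, 0 <= Q w}.

Let sFa u : sigma_algebra setT (F u). Proof. by case: (sF u). Qed.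
Let sFm u A : F u A -> measurable A. Proof. by case: (sF u) => _; exact. Qed.
Let mF u (f : Omega -> R) : Gmeas (F u) f -> measurable_fun setT f.
Proof. by apply: Gmeas_mf; case: (sF u). Qed.

Definition condexp (G : set (set Omega)) (Y : Omega -> R) : Omega -> R :=
  if pselect (exists Z, cond_exp P G Y Z) is left h then sval (cid h) else cst 0.

Lemma condexpP u Y : L1 Y -> cond_exp P (F u) Y (condexp (F u) Y).
Proof.
rewrite /condexp => LY; case: pselect => [h|]; first by case: cid.
by case; exact: cond_exp_ex.
Qed.

(* The [n]-step Snell envelope for the rewards [al], reset to [0] on [rec]. *)
Fixpoint envelope n u : Omega -> R := fun w => if n is n'.+1 then
  \1_(~` rec u) w * Num.max (envelope n' u w) (al u w + condexp (F u) (envelope n' u.+1) w)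
  else 0.

Lemma envelope_prop n u : [/\ Gmeas (F u) (envelope n u), L1 (envelope n u) & forall w, 0 <= envelope n u w].
Proof.
elim: n u => [|n IH] u; first by split=> //; [exact: Gm_cst|exact: L1_cst].
have [G1 L1u s0] := IH u; have [G2 L1S sS] := IH u.+1.
have /(cond_expP P (sF u))[_ Gc Lc _] := condexpP u L1S.
have Gx : Gmeas (F u) (fun w => Num.max (envelope n u w) (al u w + condexp (F u) (envelope n u.+1) w)).
  by apply: Gm_max => //; exact: GmD.
split.
- by apply: GmM => //; apply: Gm_ind => //; exact: GsetC.
- apply: L1_ind; first by apply: (@sFm u); exact: GsetC.
  apply: (@L1_le _ _ _ _ _ (fun w => `|envelope n u w| + `|al u w + condexp (F u) (envelope n u.+1) w|)).
  + exact: mF Gx.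
  + by apply: L1D; apply: L1_abs => //; exact: L1D.
  + by move=> w; rewrite /Num.max; case: ifP; rewrite ?lerDl ?lerDr.
- move=> w /=; apply: mulr_ge0; first by case/andP: (@indic01 R _ _ (~` rec u) w).
  by rewrite le_max s0.
Qed.

(** The recursion compares continuing with the shorter envelope instead of with 0, which builds
    monotonicity in the horizon into the definition. *)
Lemma envelope_leS n u w : envelope n u w <= envelope n.+1 u w.
Proof.
have [_ _ s0] := envelope_prop n u.
have [rw|rw] := pselect (rec u w).
  rewrite /= (indicP0 (R := R) (A := ~` rec u)) ?mul0r; last by apply.
  by case: n s0 => [|n] s0 //=; rewrite (indicP0 (R := R) (A := ~` rec u)) ?mul0r//; apply.
by rewrite /= (indicP1 (R := R) (A := ~` rec u))// mul1r le_max lexx.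
Qed.

Lemma envelope_rec n u w : rec u w -> envelope n u w = 0.
Proof.
by case: n => [//|n] rw /=; rewrite (indicP0 (R := R) (A := ~` rec u)) ?mul0r//; apply.
Qed.

Lemma Ex_ce n u C : F u C ->
  Ex (fun w => \1_C w * (al u w + condexp (F u) (envelope n u.+1) w)) =
  Ex (fun w => \1_C w * (al u w + envelope n u.+1 w)).
Proof.
move=> FC; have [_ LS _] := envelope_prop n u.+1.
have /(cond_expP P (sF u))[_ Gc Lc cE] := condexpP u LS.
have mC := sFm FC.
transitivity (Ex (fun w => \1_C w * al u w) + Ex (fun w => \1_C w * condexp (F u) (envelope n u.+1) w)).
  by rewrite -ExD; [by apply: eq_Ex => w; rewrite mulrDr|exact: L1_ind|exact: L1_ind].
rewrite cE// -ExD; [by apply: eq_Ex => w; rewrite mulrDr|exact: L1_ind|exact: L1_ind].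
Qed.

(* At each step the envelope either continues (on [C1]) or is the shorter envelope (on [C2]). *)
Lemma envelope_split n u C : F u C -> exists C1 C2, [/\ F u C1, F u C2,
  C1 `|` C2 = C, C1 `&` C2 = set0 & C1 `<=` ~` rec u /\
  Ex (fun w => \1_C w * envelope n.+1 u w) =
  Ex (fun w => \1_C1 w * (al u w + envelope n u.+1 w)) + Ex (fun w => \1_C2 w * envelope n u w)].
Proof.
move=> FC; have [Gn Ln _] := envelope_prop n u; have [_ LS _] := envelope_prop n u.+1.
have /(cond_expP P (sF u))[_ Gc Lc cE] := condexpP u LS.
pose D := [set w | envelope n u w < al u w + condexp (F u) (envelope n u.+1) w] `&` ~` rec u.
have FD : F u D by apply: GsetI => //; [apply: Gm_lt => //; exact: GmD|exact: GsetC].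
have FI : F u (C `&` D) by exact: (GsetI (sFa u) FC FD).
have FN : F u (C `\` D) by exact: (GsetD (sFa u) FC FD).
have [mI mN] := (sFm FI, sFm FN).
exists (C `&` D), (C `\` D); split => //.
- by rewrite setUIDK.
- by rewrite setDE setIACA setICr setI0.
- split; first by move=> w [_ []].
rewrite -(Ex_ce n FI) -ExD; [|by apply: L1_ind => //; exact: L1D|exact: L1_ind].
apply: eq_Ex => w.
have [Cw|Cw] := pselect (C w); last by rewrite !indicP0 ?mul0r ?addr0// => -[].
have [Dw|Dw] := pselect (D w).
  rewrite (indicP1 Cw) (@indicP1 _ _ _ (C `&` D))// (@indicP0 _ _ _ (C `\` D)); last by case.
  rewrite mul0r addr0 !mul1r /=; case: Dw => /= lt nr.
  by rewrite (@indicP1 _ _ _ (~` rec u))// mul1r; apply/max_idPr/ltW.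
rewrite (indicP1 Cw) (@indicP0 _ _ _ (C `&` D)); last by case.
rewrite (@indicP1 _ _ _ (C `\` D))// mul0r add0r !mul1r.
have [rw|rw] := pselect (rec u w); first by rewrite (envelope_rec n.+1 rw) (envelope_rec n rw).
rewrite /= (@indicP1 _ _ _ (~` rec u))// mul1r; apply/max_idPl.
by rewrite leNgt; apply/negP => h; apply: Dw.
Qed.

Let y (B : set Omega) v := Ex (fun w => \1_B w * al v w).

Let y0 v : y set0 v = 0.
Proof. by rewrite /y (eq_Ex _ (g := cst 0)) ?Ex_cst// => w; rewrite indicP0// mul0r. Qed.

Lemma Ex_indU (f : Omega -> R) A B : L1 f -> measurable A -> measurable B -> A `&` B = set0 ->
  Ex (fun w => \1_(A `|` B) w * f w) = Ex (fun w => \1_A w * f w) + Ex (fun w => \1_B w * f w).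
Proof.
move=> Lf mA mB AB; rewrite -ExD; [|exact: L1_ind|exact: L1_ind].
by apply: eq_Ex => w; rewrite indicU// mulrDl.
Qed.

Lemma thread_sub u B v : thread u B -> B v `<=` B u.
Proof.
move=> [_ B0 BS]; have [uv|vu] := leqP u v; last by rewrite B0//; exact: sub0set.
elim: v uv => [|v IH]; first by rewrite leqn0 => /eqP ->.
rewrite leq_eqVlt => /predU1P[->//|uv].
by apply: subset_trans (IH uv); exact: BS.
Qed.

Lemma thread_cons u C B : F u C -> thread u.+1 B -> B u.+1 `<=` C ->
  thread u (fun v => if v == u then C else B v).
Proof.
move=> FC [FB B0 BS] BC; split.
- by move=> v; case: eqP => [->|].
- by move=> v vu; rewrite ltn_eqF// B0// (ltn_trans vu).
- move=> v uv; rewrite gtn_eqF//; case: eqP => [->//|/eqP vu].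
  by apply: BS; rewrite ltn_neqAle eq_sym vu.
Qed.

Lemma sum_thread_cons u C B N : thread u.+1 B -> (u < N)%N ->
  \sum_(v < N) y (if v == u :> nat then C else B v) v = y C u + \sum_(v < N) y (B v) v.
Proof.
move=> [_ B0 _] uN; rewrite (bigD1 (Ordinal uN))//= [in RHS](bigD1 (Ordinal uN))//= eqxx B0// y0 add0r.
congr (_ + _); apply: eq_bigr => v vu; rewrite ifN//.
Qed.

(** The envelope is realised by an explicit rule: on the continuation event of [envelope_split]
    operate once and then follow the rule from [u.+1], on the other event follow the rule of the
    shorter horizon. Since this rule never operates on [rec], [excursion_le0] will apply after one
    preliminary operation. *)
Lemma envelope_thread n u C : F u C -> exists B, [/\ thread u B, B u `<=` C,
  forall v, B v `<=` ~` rec v &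
  forall N, (u + n <= N)%N -> Ex (fun w => \1_C w * envelope n u w) = \sum_(v < N) y (B v) v].
Proof.
elim: n u C => [|n IH] u C FC.
  exists (fun=> set0); split; [by split=> [v|v _|v _]; [exact: (Gset0 (sFa v))|done|exact: sub0set]|exact: sub0set|by move=> v; exact: sub0set|].
  move=> N _; rewrite big1 => [|v _]; last exact: y0.
  by rewrite (eq_Ex _ (g := cst 0)) ?Ex_cst// => w; rewrite /= mulr0.
have [C1 [C2 [FC1 FC2 C12 D12 [C1r ->]]]] := envelope_split n FC.
have [B1 [tB1 B1C1 B1r E1]] := IH u.+1 C1 (FS FC1).
have [B2 [tB2 B2C2 B2r E2]] := IH u C2 FC2.
pose B1' v := if v == u then C1 else B1 v.
have tB1' : thread u B1' by exact: thread_cons.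
have B1'C v : B1' v `<=` C1.
  by apply: subset_trans (thread_sub (v := v) tB1') _; rewrite /B1' eqxx.
have B2C v : B2 v `<=` C2 by apply: subset_trans (thread_sub (v := v) tB2) _.
have [FB1 z1 s1] := tB1'; have [FB2 z2 s2] := tB2.
exists (fun v => B1' v `|` B2 v); split.
- split=> [v|v vu|v uv]; first exact: GsetU.
    by rewrite z1// z2// setU0.
  by apply: setUSS; [exact: s1|exact: s2].
- by rewrite -C12; apply: setUSS.
- move=> v w [|]; last exact: B2r.
  by rewrite /B1'; case: eqP => [->|_]; [exact: C1r|exact: B1r].
move=> N uN; have -> : \sum_(v < N) y (B1' v `|` B2 v) v =
    \sum_(v < N) y (B1' v) v + \sum_(v < N) y (B2 v) v.
  rewrite -big_split/=; apply: eq_bigr => v _; apply: Ex_indU => //.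
  - exact: sFm (FB1 v).
  - exact: sFm (FB2 v).
  - apply/seteqP; split=> // w [/B1'C c1 /B2C c2].
    by have : (C1 `&` C2) w by []; rewrite D12.
have uN' : (u + n < N)%N by rewrite -addnS.
rewrite /B1' sum_thread_cons//; last exact: (leq_ltn_trans (leq_addr n u) uN').
rewrite -E2 ?(ltnW uN')//; congr (_ + _).
rewrite -E1; last by rewrite addSn.
have [_ LS _] := envelope_prop n u.+1.
rewrite -ExD; [|apply: L1_ind => //; exact: sFm FC1|apply: L1_ind => //; exact: sFm FC1].
by apply: eq_Ex => w; rewrite mulrDr.
Qed.

Let S n := \sum_(v < n) Ex (fun w => `|al v w|).

Let S_nd : nondecreasing_seq S.
Proof. by apply/nondecreasing_seqP => n; rewrite /S big_ord_recr lerDl/= Ex_ge0. Qed.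

(** Along the realising thread the gain is at most the sum of the absolute rewards from [u] to
    [u + n]. This bounds the envelopes uniformly and makes their limits vanish in mean as [u]
    grows. *)
Lemma Ex_envelope n u : Ex (envelope n u) <= S (u + n) - S u.
Proof.
have [B [[FB B0 BS] _ _ E]] := envelope_thread n (GsetT (sFa u)).
have -> : Ex (envelope n u) = Ex (fun w => \1_setT w * envelope n u w).
  by apply: eq_Ex => w; rewrite indicP1// mul1r.
have -> : S (u + n) = S u + \sum_(v < n) Ex (fun w => `|al (u + v)%N w|).
  by rewrite /S big_split_ord.
rewrite (E _ (leqnn _)) addrC addKr big_split_ord/=.
rewrite big1 ?add0r => [|v _]; last by rewrite B0 ?y0.
apply: ler_sum => v _; have mB := sFm (FB (u + v)%N).
apply: Ex_le; [exact: L1_ind|exact: L1_abs|move=> w].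
rewrite (le_trans (ler_norm _))// normrM ler_piMl//.
exact: norm_indic.
Qed.

(** A Snell envelope is in general only a supermartingale. Here [superm] holds off [rec] by
    construction and on [rec] because an excursion cannot gain; the reverse inequality [subm] holds
    because [attained] makes the conditional mean of [al u + U u.+1] nonnegative, so that stopping
    never beats continuing. *)
Lemma snell_ex : exists U : nat -> Omega -> R, [/\ forall u, Gmeas (F u) (U u),
  forall u, L1 (U u) /\ forall w, 0 <= U u w,
  forall u w, rec u w -> U u w = 0,
  forall u C, F u C ->
    Ex (fun w => \1_C w * U u w) = Ex (fun w => \1_C w * (al u w + U u.+1 w)) &
  (fun n => Ex (U n)) @ \oo --> 0].
Proof.
have SM n : S n <= M by exact: alM.
have cS : cvgn S by apply: nondecreasing_is_cvgn => //; exists M => _ [n _ <-].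
have mctU u : exists f : Omega -> R, [/\ Gmeas (F u) f, L1 f, (forall w, 0 <= f w),
    {ae P, forall w, (fun n => envelope n u w) @ \oo --> f w} & (forall w, (forall n, envelope n u w = 0) -> f w = 0)].
  apply: (@Ex_mct _ _ _ P (F u) (fun n => envelope n u) M) => //.
  - by move=> n; have [] := envelope_prop n u.
  - by move=> n; have [] := envelope_prop n u.
  - by move=> n; have [] := envelope_prop n u.
  - by move=> n w; exact: envelope_leS.
  - move=> n; apply: le_trans (Ex_envelope n u) _; apply: le_trans (SM (u + n)%N).
    by rewrite lerBlDr lerDl sumr_ge0// => v _; exact: Ex_ge0.
have [U HU] := choice mctU.
have GU u : Gmeas (F u) (U u) by case: (HU u).
have LU u : L1 (U u) by case: (HU u).
have U0 u w : 0 <= U u w by case: (HU u).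
have Urec u w : rec u w -> U u w = 0.
  by move=> rw; have [_ _ _ _] := HU u; apply => n; exact: envelope_rec.
have Ls n u : L1 (envelope n u) by have [] := envelope_prop n u.
have s0 n u w : 0 <= envelope n u w by have [_ _] := envelope_prop n u; apply.
have sU u : {ae P, forall w, (fun n => envelope n u w) @ \oo --> U u w /\ forall n, envelope n u w <= U u w}.
  have [_ _ _ cv _] := HU u; apply: ae_mono cv _ => w cv; split=> // n.
  rewrite -(cvg_lim _ cv)//; apply: nondecreasing_cvgn_le.
    by apply/nondecreasing_seqP => k; exact: envelope_leS.
  by apply/cvg_ex; eexists; exact: cv.
have ExU u C : measurable C -> (fun n => Ex (fun w => \1_C w * envelope n u w)) @ \oo -->
    Ex (fun w => \1_C w * U u w).
  move=> mC; have [||//] := @Ex_dct _ _ _ P (fun n w => \1_C w * envelope n u w)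
    (fun w => \1_C w * U u w) (U u) (fun n => L1_meas (L1_ind mC (Ls n u)))
    (L1_meas (L1_ind mC (LU u))) (LU u).
  - apply: ae_mono (sU u) _ => w [cv _]; apply: cvgM => //; exact: cvg_cst.
  - apply: ae_mono (sU u) _ => w [_ le] n; rewrite normrM (ger0_norm (s0 _ _ _)).
    by apply: le_trans (le n); rewrite ler_piMl ?norm_indic.
have lim_le (f : nat -> R) l k : f @ \oo --> l -> (forall n, f n <= k) -> l <= k.
  by move=> fl fk; rewrite -(cvg_lim _ fl)//; apply: limr_le;
    [apply/cvg_ex; eexists; exact: fl|exact: nearW].
have split_al (f : Omega -> R) u C : L1 f -> F u C ->
    Ex (fun w => \1_C w * (al u w + f w)) = y C u + Ex (fun w => \1_C w * f w).
  move=> Lf FC; have mC := sFm FC; rewrite -ExD; [|exact: L1_ind|exact: L1_ind].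
  by apply: eq_Ex => w; rewrite mulrDr.
have al_lim u C : F u C -> (fun n => Ex (fun w => \1_C w * (al u w + envelope n u.+1 w))) @ \oo -->
    Ex (fun w => \1_C w * (al u w + U u.+1 w)).
  move=> FC; rewrite split_al//; have -> : (fun n => Ex (fun w => \1_C w * (al u w + envelope n u.+1 w))) =
    (fun n => y C u + Ex (fun w => \1_C w * envelope n u.+1 w)).
    by apply/funext => n; rewrite split_al.
  by apply: cvgD; [exact: cvg_cst|apply: ExU; exact: sFm FC].
(* The realising thread from [u.+1] avoids [rec]; with [C] put in front it is an excursion started
   on [rec]. *)
have rec_le u C : F u C -> C `<=` rec u -> Ex (fun w => \1_C w * (al u w + U u.+1 w)) <= 0.
  move=> FC Cr; apply: lim_le (al_lim u C FC) _ => n.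
  have [B [tB BC Br E]] := envelope_thread n (FS FC).
  have tB' := thread_cons FC tB BC.
  rewrite split_al// (E (u.+1 + n)%N)// -sum_thread_cons// ?addSn ?ltnS ?leq_addr//.
  apply: (excursion_le0 _ tB'); first by rewrite eqxx.
  by move=> v uv; rewrite gtn_eqF.
have nrec_le u C : F u C -> C `<=` ~` rec u ->
    Ex (fun w => \1_C w * (al u w + U u.+1 w)) <= Ex (fun w => \1_C w * U u w).
  move=> FC Cr; apply: lim_le (al_lim u C FC) _ => n; have mC := sFm FC.
  rewrite -Ex_ce//; apply: Ex_le_ae; last first.
  - apply: ae_mono (sU u) _ => w [_ /(_ n.+1)] le.
    have [Cw|Cw] := pselect (C w); last by rewrite !indicP0 ?mul0r.
    rewrite !indicP1// !mul1r; apply: le_trans le.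
    by rewrite /= indicP1 ?mul1r ?le_max ?lexx ?orbT//; exact: Cr.
  - exact: L1_ind.
  - apply: L1_ind => //; apply: L1D => //.
    by have /(cond_expP P (sF u))[] := condexpP u (Ls n u.+1).
have setID C u : F u C -> [/\ F u (C `&` rec u), F u (C `\` rec u) &
    forall f, L1 f -> Ex (fun w => \1_C w * f w) =
      Ex (fun w => \1_(C `&` rec u) w * f w) + Ex (fun w => \1_(C `\` rec u) w * f w)].
  move=> FC; have FI := GsetI (sFa u) FC (Frec u); have FD := GsetD (sFa u) FC (Frec u).
  split=> // f Lf; rewrite -Ex_indU ?setUIDK//; [exact: sFm FI|exact: sFm FD|].
  by rewrite setDE setIACA setICr setI0.
have superm u C : F u C ->
    Ex (fun w => \1_C w * (al u w + U u.+1 w)) <= Ex (fun w => \1_C w * U u w).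
  move=> FC; have [FI FD E] := setID C u FC; rewrite !E//; last exact: L1D.
  apply: lerD; last by apply: nrec_le => // w [].
  apply: le_trans (rec_le _ _ FI _) _; first by move=> w [].
  by apply: Ex_ge0 => w; rewrite mulr_ge0//; case/andP: (@indic01 R _ _ (C `&` rec u) w).
(* [Q], the conditional mean of [al u + U u.+1], dominates the gain of every thread from [u]:
   [superm] is iterated along the thread in [key], and the nonnegative value left at its end is
   dropped. Hence [attained] applies to [Q]. *)
have pos u C : F u C -> 0 <= Ex (fun w => \1_C w * (al u w + U u.+1 w)).
  have /(cond_expP P (sF u))[_ Gc Lc cE] := condexpP u (LU u.+1).
  pose Q w := al u w + condexp (F u) (U u.+1) w.
  have QE C' : F u C' -> Ex (fun w => \1_C' w * Q w) = Ex (fun w => \1_C' w * (al u w + U u.+1 w)).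
    by move=> FC'; rewrite split_al// split_al// cE.
  have LQ : L1 Q by exact: L1D.
  suff Q0 : {ae P, forall w, 0 <= Q w}.
    move=> FC; rewrite -QE// -(Ex_cst P 0); apply: Ex_le_ae; [exact: L1_cst|apply: L1_ind => //; exact: sFm FC|].
    by apply: ae_mono Q0 _ => w Qw; rewrite mulr_ge0//; case/andP: (@indic01 R _ _ C w).
  apply: (attained _ LQ) => [|B n tB un]; first exact: GmD.
  have [FB B0 BS] := tB; have mB v : measurable (B v) := sFm (FB v).
  rewrite QE//.
  have step v : (u <= v)%N -> Ex (fun w => \1_(B v.+1) w * U v.+1 w) <= Ex (fun w => \1_(B v) w * U v.+1 w).
    move=> uv; apply: Ex_le; [exact: L1_ind|exact: L1_ind|move=> w].
    rewrite ler_wpM2r//; have [Bw|Bw] := pselect (B v.+1 w).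
      by rewrite !indicP1//; exact: BS Bw.
    by rewrite (indicP0 Bw); case/andP: (@indic01 R _ _ (B v) w).
  have key k : \sum_(v < u.+1 + k) y (B v) v + Ex (fun w => \1_(B (u.+1 + k)%N) w * U (u.+1 + k)%N w)
     <= Ex (fun w => \1_(B u) w * (al u w + U u.+1 w)).
    elim: k => [|k]; last first.
      apply: le_trans; rewrite addnS big_ord_recr/= -addrA lerD2l.
      apply: le_trans (superm _ _ (FB _)); rewrite split_al// lerD2l.
      by apply: step; rewrite addSn leqW// leq_addr.
    rewrite addn0 big_ord_recr/= big1 ?add0r => [|v _]; last by rewrite B0 ?y0.
    by rewrite split_al// lerD2l; exact: step.
  apply: le_trans (key (n - u.+1)%N); rewrite subnKC// lerDl.
  by apply: Ex_ge0 => w; rewrite mulr_ge0//; case/andP: (@indic01 R _ _ (B n) w).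
(* Induction on the horizon: the continuation part is bounded by monotonicity, the rest is a shorter
   envelope, and the empty horizon is covered by [pos]. *)
have subm u C : F u C ->
    Ex (fun w => \1_C w * U u w) <= Ex (fun w => \1_C w * (al u w + U u.+1 w)).
  move=> FC; apply: lim_le (ExU u C (sFm FC)) _ => n.
  elim: n C FC => [|n IH] C FC.
    by rewrite (eq_Ex _ (g := cst 0)) ?Ex_cst ?pos// => w; rewrite /= mulr0.
  have [C1 [C2 [FC1 FC2 <- D12 [C1r ->]]]] := envelope_split n FC.
  have [m1 m2] := (sFm FC1, sFm FC2).
  rewrite Ex_indU//; last exact: L1D.
  apply: lerD; last exact: IH.
  apply: Ex_le_ae; [by apply: L1_ind => //; exact: L1D|by apply: L1_ind => //; exact: L1D|].
  apply: ae_mono (sU u.+1) _ => w [_ le].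
  by rewrite ler_wpM2l ?lerD2l//; case/andP: (@indic01 R _ _ C1 w).
exists U; split=> //.
- by move=> u C FC; apply/le_anti; rewrite superm// subm.
- have EU u : Ex (U u) <= limn S - S u.
    have := ExU u setT measurableT.
    have TE (f : Omega -> R) : Ex (fun w => \1_setT w * f w) = Ex f.
      by apply: eq_Ex => w; rewrite indicP1// mul1r.
    rewrite TE => cv; apply: lim_le cv _ => n; rewrite TE.
    apply: le_trans (Ex_envelope n u) _; rewrite lerD2r.
    exact: nondecreasing_cvgn_le.
  apply: (@squeeze_cvgr _ _ _ _ (cst 0) (fun u => limn S - S u)).
  + by apply: nearW => u; rewrite EU/= Ex_ge0.
  + exact: cvg_cst.
  + by rewrite -(subrr (limn S)); apply: cvgB => //; exact: cvg_cst.
Qed.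

End snell.

(** * Independence and equality of laws *)

Section independence.
Context {R : realType} {d : measure_display} {Omega : measurableType d}.
Variable P : probability Omega R.
Notation L1 := (L1 P).
Notation Ex := (Ex P).

Lemma Ex_indic C : measurable C -> Ex (\1_C) = fine (P C).
Proof. by move=> mC; rewrite /Ex /Rintegral integral_indic// setIT. Qed.

(** The product rule is extended from events one factor at a time. For fixed [C] in [G1],
    [\1_C - P C] has zero mean on [G2], so [g] can be pulled out; then [g - Ex g] has zero mean on
    [G1], so [f] can be. *)
Lemma Ex_indep (G1 G2 : set (set Omega)) (f g : Omega -> R) (k : R) :
  sub_sigma G1 -> sub_sigma G2 ->
  (forall A B, G1 A -> G2 B -> P (A `&` B) = (P A * P B)%E) ->
  Gmeas G1 f -> L1 f -> Gmeas G2 g -> (forall w, `|g w| <= k) ->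
  Ex (fun w => f w * g w) = Ex f * Ex g.
Proof.
move=> s1 s2 ind Gf Lf Gg gk; have [[s1a m1] [s2a m2]] := (s1, s2).
have mg : measurable_fun setT g by exact: Gmeas_mf Gg.
have Lg : L1 g by apply: (@L1_le _ _ _ _ _ (cst k)) => //; exact: L1_cst.
have L1C C : measurable C -> L1 (\1_C : Omega -> R).
  move=> mC; apply: (@L1_le _ _ _ _ _ (cst 1)); [exact: measurable_indic|exact: L1_cst|].
  by move=> w; exact: norm_indic.
have Lgm (h : Omega -> R) : L1 h -> L1 (fun w => g w * h w).
  by move=> Lh; exact: (@L1_mulb _ _ _ _ _ _ k).
have step C : G1 C -> Ex (fun w => \1_C w * g w) = fine (P C) * Ex g.
  move=> GC; have mC := m1 _ GC.
  apply/eqP; rewrite -subr_eq0 -ExZ// -ExB//; [|exact: L1_ind|exact: L1Z].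
  rewrite (eq_Ex _ (g := fun w => g w * (\1_C w - fine (P C)))); last by move=> w; ring.
  apply/eqP; have LY : L1 (fun w => \1_C w - fine (P C) : R).
    by apply: L1B; [exact: L1C|exact: L1_cst].
  apply: (Ex_pull s2 Gg LY) => [|D GD]; first exact: Lgm.
  have mD := m2 _ GD.
  rewrite (eq_Ex _ (g := fun w => \1_(C `&` D) w - fine (P C) * \1_D w)); last first.
    by move=> w; rewrite indicI/=; ring.
  rewrite ExB ?ExZ ?Ex_indic//; try exact: L1C; last first.
  - exact/L1Z/L1C.
  - by apply: L1C; exact: measurableI.
  - exact: measurableI.
  by rewrite ind// fineM ?subrr// (fin_num_measure P).
have Lfg : L1 (fun w => f w * g w).
  by apply: eq_L1 (Lgm _ Lf) => w /=; rewrite mulrC.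
apply/eqP; rewrite mulrC -subr_eq0 -ExZ// -ExB//; last exact: L1Z.
rewrite (eq_Ex _ (g := fun w => f w * (g w - Ex g))); last by move=> w; ring.
apply/eqP; apply: (Ex_pull s1 Gf) => [||C GC].
- by apply: L1B => //; exact: L1_cst.
- apply: eq_L1 (L1B Lfg (L1Z (Ex g) Lf)) => w; ring.
have mC := m1 _ GC.
rewrite (eq_Ex _ (g := fun w => \1_C w * g w - Ex g * \1_C w)); last by move=> w; ring.
rewrite ExB ?step ?ExZ ?Ex_indic//; try exact: L1C; last 2 first.
- exact: L1_ind.
- exact/L1Z/L1C.
by rewrite mulrC subrr.
Qed.

Lemma sub_sigma_preimage (W : Omega -> R) : measurable_fun setT W ->
  sub_sigma (preimage_set_system setT W measurable).
Proof.
move=> mW; split.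
  by apply: sigma_algebra_preimage; case: (@sub_sigma_measurable _ R).
by move=> _ [B mB <-]; exact: mW.
Qed.

Lemma eq_Ex_law (W W' : Omega -> R) (h : R -> R) :
  measurable_fun setT W -> measurable_fun setT W' -> measurable_fun setT h ->
  (forall x, 0 <= h x) -> (forall B, measurable B -> P (W @^-1` B) = P (W' @^-1` B)) ->
  Ex (fun w => h (W w)) = Ex (fun w => h (W' w)).
Proof.
move=> mW mW' mh h0 WW'; rewrite /Ex /Rintegral; congr fine.
have mhe : measurable_fun setT (EFin \o h) by exact/measurable_EFinP.
have := @ge0_integral_pushforward _ _ _ _ R _ mW P setT (EFin \o h) measurableT mhe
  (fun x _ => h0 x).
rewrite preimage_setT => <-.
have := @ge0_integral_pushforward _ _ _ _ R _ mW' P setT (EFin \o h) measurableT mhe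
  (fun x _ => h0 x).
rewrite preimage_setT => <-.
by apply: eq_measure_integral => A mA _; exact: WW'.
Qed.

End independence.

(** * A single arm *)

Section arm.
Context {R : realType} {d : measure_display} {Omega : measurableType d}.
Variables (P : probability Omega R) (q : R).
Variables (F : nat -> set (set Omega)) (X W : nat -> Omega -> R).
Hypothesis q0 : 0 < q.
Hypothesis arm : arm_model P F X W.
Notation L1 := (L1 P).
Notation Ex := (Ex P).

Lemma arm_sub_sigma u : sub_sigma (F u). Proof. by case: arm => -[]. Qed.
Lemma arm_FS u : F u `<=` F u.+1. Proof. by case: arm => -[_ []]. Qed.
Lemma arm_FX u : Gmeas (F u) (X u). Proof. by case: arm => _ []. Qed.
Lemma arm_W0 u w : 0 < W u w. Proof. by case: arm => _ [_ []]. Qed.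
Lemma arm_FW u : Gmeas (F u.+1) (W u). Proof. by case: arm => _ [_ [_ []]]. Qed.
Lemma arm_indep u : indep_rv_sigma P (F u) (W u). Proof. by case: arm => _ [_ [_ [_ []]]]. Qed.
Lemma arm_mW u : measurable_fun setT (W u).
Proof. by case: arm => _ [_ [_ [_ [_ []]]]]. Qed.
Lemma arm_lawW u B : measurable B -> P (W u @^-1` B) = P (W 0%N @^-1` B).
Proof. by case: arm => _ [_ [_ [_ [_ [_ [_ h]]]]]]; exact: h. Qed.

Let sF := arm_sub_sigma.
Let sFa u : sigma_algebra setT (F u). Proof. by case: (sF u). Qed.
Let sFm u A : F u A -> measurable A. Proof. by case: (sF u) => _; exact. Qed.
Let mF u (f : Omega -> R) : Gmeas (F u) f -> measurable_fun setT f.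
Proof. by apply: Gmeas_mf; case: (sF u). Qed.

Lemma arm_Fle u v : (u <= v)%N -> F u `<=` F v.
Proof.
elim: v => [|v IH]; first by rewrite leqn0 => /eqP ->.
rewrite leq_eqVlt => /predU1P[->//|uv]; apply: subset_trans (IH uv) _.
exact: arm_FS.
Qed.

Notation T u := (optime W u).
(** [edisc] is the discount at the onset of an operation, known in [F u]. [bdisc] is the fraction of
    it lost during the operation and depends on [W u] only, hence is independent of [F u]. Their
    product over [q] is [dsc], and [cdisc] is the mean of [bdisc] at every stage. *)
Definition edisc u w := expR (- (q * T u w)).
Definition bdisc u w := 1 - expR (- (q * W u w)).
Definition dsc u w := disc q (T u w) (T u.+1 w).
Definition cdisc := Ex (bdisc 0).

Lemma optimeS u w : T u.+1 w = T u w + W u w.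
Proof. by rewrite /optime big_ord_recr. Qed.

Lemma arm_FT u : Gmeas (F u) (T u).
Proof.
apply: Gm_sum => // -[i iu] _ /=.
by apply: Gmeas_sub (arm_FW i); exact: arm_Fle.
Qed.

Lemma measurable_expNq : measurable_fun setT (fun x : R => expR (- (q * x))).
Proof.
apply: measurableT_comp => //; apply: measurableT_comp => //.
Qed.

Lemma edisc_F u : Gmeas (F u) (edisc u).
Proof. by apply: (Gm_comp measurable_expNq); exact: arm_FT. Qed.

Lemma bdisc_F u : Gmeas (F u.+1) (bdisc u).
Proof.
apply: GmB => //; first exact: Gm_cst.
by apply: (Gm_comp measurable_expNq); exact: arm_FW.
Qed.

Lemma edisc_gt0 u w : 0 < edisc u w. Proof. exact: expR_gt0. Qed.

Lemma ediscS u w : edisc u.+1 w = edisc u w * (1 - bdisc u w).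
Proof. by rewrite /edisc /bdisc optimeS subKr -expRD; congr expR; ring. Qed.

Lemma bdisc_gt0 u w : 0 < bdisc u w.
Proof. by rewrite subr_gt0 -expR0 ltr_expR oppr_lt0 mulr_gt0// arm_W0. Qed.

Lemma bdisc_le1 u w : bdisc u w <= 1.
Proof. by rewrite lerBlDr lerDl expR_ge0. Qed.

Lemma edisc_leS u w : edisc u.+1 w <= edisc u w.
Proof.
by rewrite ediscS ler_piMr ?(ltW (edisc_gt0 _ _))// lerBlDr lerDl ltW// bdisc_gt0.
Qed.

Lemma edisc_le u v w : (u <= v)%N -> edisc v w <= edisc u w.
Proof. by move: u v; apply/nonincreasing_seqP => u; exact: edisc_leS. Qed.

Lemma edisc0 w : edisc 0 w = 1.
Proof. by rewrite /edisc /optime big_ord0 mulr0 oppr0 expR0. Qed.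

Lemma edisc_le1 u w : edisc u w <= 1.
Proof. by rewrite -(edisc0 w) edisc_le. Qed.

Lemma dscE u w : dsc u w = edisc u w * bdisc u w / q.
Proof.
rewrite /dsc discE//; last by rewrite optimeS ltrDl arm_W0.
by rewrite -/(edisc u w) -/(edisc u.+1 w) ediscS; congr (_ / _); ring.
Qed.

Lemma dsc_ge0 u w : 0 <= dsc u w.
Proof. by rewrite dscE divr_ge0 ?(ltW q0)// mulr_ge0// ltW// ?edisc_gt0// bdisc_gt0. Qed.

Lemma cdisc_law u : Ex (bdisc u) = cdisc.
Proof.
have L v : L1 (fun w => expR (- (q * W v w))).
  apply: (@L1_le _ _ _ _ _ (cst 1)); last 1 first.
  - move=> w; rewrite ger0_norm ?expR_ge0//= -expR0 ler_expR oppr_le0.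
    by rewrite mulr_ge0 ?(ltW q0)// ltW// arm_W0.
  - exact: (measurableT_comp measurable_expNq (arm_mW v)).
  - exact: L1_cst.
rewrite /cdisc /bdisc !ExB//; try exact: L1_cst; congr (_ - _).
apply: (@eq_Ex_law _ _ _ _ _ _ (fun x => expR (- (q * x)))).
- exact: arm_mW.
- exact: arm_mW.
- exact: measurable_expNq.
- by move=> x; exact: expR_ge0.
- by move=> B mB; exact: arm_lawW.
Qed.

Lemma mbdisc u : measurable_fun setT (bdisc u).
Proof. exact: mF (bdisc_F u). Qed.

Lemma L1_bdisc u : L1 (bdisc u).
Proof.
apply: (@L1_le _ _ _ _ _ (cst 1)); [exact: mbdisc|exact: L1_cst|move=> w].
by rewrite ger0_norm ?(ltW (bdisc_gt0 u w))// bdisc_le1.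
Qed.

Lemma cdisc_gt0 : 0 < cdisc.
Proof.
rewrite ltNge; apply/negP => c0.
have H := Ex_eq0 (L1_bdisc 0) (fun w => ltW (bdisc_gt0 0 w)) c0.
have {}H : {ae P, forall w : Omega, False}.
  by apply: ae_mono H _ => w bw; have := bdisc_gt0 0 w; rewrite bw ltxx.
have [N [mN N0 sN]] := H.
have NT : N = setT by apply/seteqP; split=> // w _; apply: sN => /=; apply.
by move: N0; rewrite NT probability_setT => /eqP; rewrite onee_eq0.
Qed.

(** [bdisc u] is a bounded function of [W u], which is independent of [F u]. This is the passage
    between calendar weights and the weights of the Gittins ratio. *)
Lemma Ex_swap u (f : Omega -> R) : Gmeas (F u) f -> L1 f ->
  Ex (fun w => f w * bdisc u w) = cdisc * Ex f.
Proof.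
move=> Gf Lf; rewrite -(cdisc_law u) mulrC.
apply: (@Ex_indep _ _ _ _ (F u) (preimage_set_system setT (W u) measurable) _ _ 1) => //.
- exact/sub_sigma_preimage/arm_mW.
- by move=> A _ FA [B mB <-]; rewrite setTI arm_indep.
- apply: (@Gm_comp _ _ _ _ _ _ _ (fun x => 1 - expR (- (q * x))) (W u)).
    by apply: measurable_funB => //; exact: measurable_expNq.
  by move=> B mB; exists B => //; rewrite setTI.
- by move=> w; rewrite ger0_norm ?(ltW (bdisc_gt0 u w))// bdisc_le1.
Qed.

(** By [Ex_swap] the truncations of [f] have means at most [cdisc^-1] times the mean of [f * bdisc];
    monotone convergence concludes. *)
Lemma L1_swap u (f : Omega -> R) : Gmeas (F u) f -> (forall w, 0 <= f w) ->
  L1 (fun w => f w * bdisc u w) -> L1 f.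
Proof.
move=> Gf f0 Lfb; have c0 := cdisc_gt0.
pose fn n w := Num.min (f w) n%:R.
have Gfn n : Gmeas (F u) (fn n) by apply: Gm_min => //; exact: Gm_cst.
have fn0 n w : 0 <= fn n w by rewrite le_min f0/=.
have Lfn n : L1 (fn n).
  apply: (@L1_le _ _ _ _ _ (cst n%:R)); [exact: mF (Gfn n)|exact: L1_cst|].
  by move=> w; rewrite ger0_norm// ge_min lexx orbT.
have mf := mF Gf.
have [g [_ Lg _ cv _]] : exists g : Omega -> R, [/\ Gmeas (F u) g, L1 g, (forall w, 0 <= g w),
    {ae P, forall w, fn ^~ w @ \oo --> g w} & (forall w, (forall n, fn n w = 0) -> g w = 0)].
  apply: (@Ex_mct _ _ _ P (F u) fn (cdisc^-1 * Ex (fun w => f w * bdisc u w)) (sF u) Gfn Lfn fn0).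
  - by move=> n w; rewrite /fn le_min ge_min lexx/= ge_min ler_nat leqnSn orbT.
  - move=> n; rewrite ler_pdivlMl// -(Ex_swap (Gfn n))//; apply: Ex_le => //.
      apply: (@L1_le _ _ _ _ _ (fun w => f w * bdisc u w)) => //.
        by apply: measurable_funM; [exact: mF (Gfn n)|exact: mbdisc].
      move=> w; rewrite ger0_norm; last by rewrite mulr_ge0// ltW// bdisc_gt0.
      by rewrite ler_wpM2r ?ge_min ?lexx// ltW// bdisc_gt0.
    by move=> w; rewrite ler_wpM2r ?ge_min ?lexx// ltW// bdisc_gt0.
apply: (L1_le_ae mf Lg); apply: ae_mono cv _ => w cv.
suff -> : f w = g w by [].
apply/esym; rewrite -(cvg_lim _ cv)//; apply: (@lim_near_cst R) => //; near=> n.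
apply/min_idPl; near: n; exists (Num.truncn (f w)).+1 => // n /= hn.
by apply: ltW; apply: lt_le_trans (truncnS_gt _) _; rewrite ler_nat.
Unshelve. all: by end_near. Qed.

Section integrable_arm.
Hypothesis Hint : arm_integrable P q X W.

Lemma L1_dscX : (forall u, L1 (fun w => `|X u w| * dsc u w)) /\
  exists M, forall n, \sum_(u < n) Ex (fun w => `|X u w| * dsc u w) <= M.
Proof.
pose f u w := `|X u w| * dsc u w.
have f0 u w : 0 <= f u w by rewrite mulr_ge0// dsc_ge0.
have mf u : measurable_fun setT (f u).
  apply: (mF (u := u.+1)); apply: GmM => //.
    apply: (Gm_comp (h := fun x : R => `|x|)); first exact: normr_measurable.
    by apply: Gmeas_sub (arm_FX u); exact: arm_FS.
  have -> : dsc u = fun w => edisc u w * bdisc u w * q^-1.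
    by apply/funext => w; rewrite dscE.
  apply: GmM => //; last exact: Gm_cst.
  apply: GmM => //; last exact: bdisc_F.
  by apply: Gmeas_sub (edisc_F u); exact: arm_FS.
have mfe u : measurable_fun setT (fun w => (f u w)%:E) by exact/measurable_EFinP.
have fe0 u w : (0 <= (f u w)%:E)%E by rewrite lee_fin.
have part n : (\sum_(u < n) \int[P]_w (f u w)%:E < +oo)%E /\
    (\sum_(u < n) \int[P]_w (f u w)%:E <= \int[P]_w \sum_(s <oo) (f s w)%:E)%E.
  suff h : (\sum_(u < n) \int[P]_w (f u w)%:E <= \int[P]_w \sum_(s <oo) (f s w)%:E)%E.
    by split=> //; apply: le_lt_trans h _; exact: Hint.
  rewrite -(@ge0_integral_sum _ _ _ P setT measurableT _ (fun (u : 'I_n) w => (f u w)%:E))//.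
  apply: ge0_le_integral => //.
  - by move=> w _; rewrite sume_ge0.
  - by apply: emeasurable_sum => i.
  - by apply: ge0_emeasurable_sum.
  - by move=> w _; rewrite -(big_mkord xpredT (fun i => (f i w)%:E)); exact: nneseries_lim_ge.
have Lf u : L1 (f u).
  apply/integrableP; split; first exact: mfe.
  have -> : (\int[P]_x `|(EFin \o f u) x| = \int[P]_w (f u w)%:E)%E.
    by apply: eq_integral => w _ /=; rewrite ger0_norm.
  have [+ _] := part u.+1; apply: le_lt_trans; rewrite big_ord_recr/=.
  by rewrite leeDr// sume_ge0// => i _; exact: integral_ge0.
split=> //; exists (fine (\int[P]_w \sum_(s <oo) (f s w)%:E)%E) => n.
have -> : \sum_(u < n) Ex (f u) = fine (\sum_(u < n) \int[P]_w (f u w)%:E)%E.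
  rewrite -sum_fine// => u _; exact: (integrable_fin_num measurableT (Lf u)).
have [h1 h2] := part n; apply: fine_le => //.
- by rewrite ge0_fin_numE// sume_ge0// => i _; exact: integral_ge0.
- by rewrite ge0_fin_numE ?(le_lt_trans _ Hint)// integral_ge0// => w _; exact: nneseries_ge0.
Qed.

(** The integrability assumption concerns [dsc], the Gittins ratio needs it for [edisc]; [L1_swap]
    and [Ex_swap] convert one into the other. *)
Lemma L1_edX : (forall u, L1 (fun w => edisc u w * X u w)) /\
  exists M, forall n, \sum_(u < n) Ex (fun w => `|edisc u w * X u w|) <= M.
Proof.
have [LX [M HM]] := L1_dscX; have c0 := cdisc_gt0.
have eX u w : `|edisc u w * X u w| = edisc u w * `|X u w|.
  by rewrite normrM ger0_norm// ltW// edisc_gt0.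
have G u : Gmeas (F u) (fun w => edisc u w * X u w).
  by apply: GmM => //; [exact: edisc_F|exact: arm_FX].
have Ga u : Gmeas (F u) (fun w => `|edisc u w * X u w|).
  by apply: (Gm_comp (h := fun x : R => `|x|)) => //; exact: normr_measurable.
have E u w : `|edisc u w * X u w| * bdisc u w = q * (`|X u w| * dsc u w).
  by rewrite eX dscE; field; rewrite gt_eqF.
have La u : L1 (fun w => `|edisc u w * X u w|).
  apply: (L1_swap (Ga u)) => //.
  by apply: (eq_L1 (fun w => esym (E u w))); exact: L1Z.
split=> [u|].
  by apply: (@L1_le _ _ _ _ _ _ _ (La u)) => //; exact: mF (G u).
exists (cdisc^-1 * (q * M)) => n.
have -> : \sum_(u < n) Ex (fun w => `|edisc u w * X u w|) =
    cdisc^-1 * (q * \sum_(u < n) Ex (fun w => `|X u w| * dsc u w)).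
  rewrite !mulr_sumr; apply: eq_bigr => u _.
  rewrite -(ExZ _ (LX u)) -(eq_Ex _ (E u)) (Ex_swap (Ga u))// mulKf//.
  by rewrite gt_eqF.
by rewrite ler_pM2l ?invr_gt0// ler_pM2l.
Qed.

End integrable_arm.

(* [(1 - E exp (- q W)) * sum_(v >= u) edisc v] has the same conditional mean as
   the telescoping sum of [edisc v - edisc v.+1]. *)
Lemma Ex_tail_edisc u (f : Omega -> R) n : Gmeas (F u) f -> (forall w, 0 <= f w) ->
  L1 (fun w => f w * edisc u w) ->
  (forall v, (u <= v)%N -> L1 (fun w => f w * edisc v w)) /\
  \sum_(v < n | (u <= v)%N) Ex (fun w => f w * edisc v w)
    <= cdisc^-1 * Ex (fun w => f w * edisc u w).
Proof.
move=> Gf f0 Lf; have c0 := cdisc_gt0.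
have G v : (u <= v)%N -> Gmeas (F v) (fun w => f w * edisc v w).
  by move=> uv; apply: GmM => //; [apply: Gmeas_sub Gf; exact: arm_Fle|exact: edisc_F].
have L v : (u <= v)%N -> L1 (fun w => f w * edisc v w).
  move=> uv; apply: (@L1_le _ _ _ _ _ _ _ Lf) => [|w]; first exact: mF (G v uv).
  rewrite ger0_norm; last by rewrite mulr_ge0// ltW// edisc_gt0.
  by rewrite ler_wpM2l// edisc_le.
split=> //.
have Lb v : (u <= v)%N -> L1 (fun w => f w * edisc v w * bdisc v w).
  move=> uv; apply: (@L1_le _ _ _ _ _ _ _ (L v uv)) => [|w].
    by apply: measurable_funM; [exact: mF (G v uv)|exact: mbdisc].
  have fe : 0 <= f w * edisc v w by rewrite mulr_ge0// ltW// edisc_gt0.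
  rewrite ger0_norm; last by rewrite mulr_ge0// ltW// bdisc_gt0.
  by rewrite ler_piMr// bdisc_le1.
have -> : \sum_(v < n | (u <= v)%N) Ex (fun w => f w * edisc v w) =
  cdisc^-1 * Ex (fun w => \sum_(v < n | (u <= v)%N) f w * edisc v w * bdisc v w).
  rewrite (@Ex_sum _ _ _ P _ (index_enum 'I_n) (fun v : 'I_n => (u <= v)%N)
    (fun v w => f w * edisc v w * bdisc v w)); last by move=> v; exact: Lb.
  rewrite big_distrr/=; apply: eq_bigr => v uv.
  by rewrite (Ex_swap (G v uv) (L v uv)) mulKf// gt_eqF.
rewrite ler_pM2l ?invr_gt0//; apply: Ex_le => //; first by apply: L1_sum => v; exact: Lb.
move=> w.
have -> : \sum_(v < n | (u <= v)%N) f w * edisc v w * bdisc v w =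
  f w * \sum_(v < n | (u <= v)%N) (edisc v w - edisc v.+1 w).
  by rewrite mulr_sumr; apply: eq_bigr => v _; rewrite ediscS; ring.
rewrite ler_wpM2l// -(big_geq_mkord u n xpredT (fun v => edisc v w - edisc v.+1 w)).
have [un|nu] := leqP u n; last by rewrite big_geq ?(ltW (edisc_gt0 _ _))// ltnW.
have -> : \sum_(u <= v < n) (edisc v w - edisc v.+1 w) =
    - \sum_(u <= v < n) (edisc v.+1 w - edisc v w).
  by rewrite -sumrN; apply: eq_bigr => v _; rewrite opprB.
by rewrite (@telescope_sumr _ u n (fun v => edisc v w))// opprB lerBlDr lerDl ltW// edisc_gt0.
Qed.

(** The discounts have a finite expected sum by [Ex_tail_edisc], so their series converges almost
    surely and its terms vanish. *)
Lemma edisc_cvg0 : {ae P, forall w, (fun n => edisc n w) @ \oo --> 0}.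
Proof.
have L u : L1 (edisc u).
  apply: (@L1_le _ _ _ _ _ (cst 1)); [exact: mF (edisc_F u)|exact: L1_cst|move=> w].
  by rewrite ger0_norm ?edisc_le1// ltW// edisc_gt0.
have H n : \sum_(v < n) Ex (edisc v) <= cdisc^-1 * Ex (edisc 0).
  have E v : Ex (fun w => 1 * edisc v w) = Ex (edisc v).
    by apply: eq_Ex => w; rewrite mul1r.
  have [|||_] := @Ex_tail_edisc 0 (cst 1) n.
  - exact: Gm_cst.
  - by move=> w.
  - by apply: eq_L1 (L 0%N) => w; rewrite mul1r.
  by rewrite /= E; under eq_bigr do rewrite E.
have [h [_ _ hcv]] := Ex_series L (fun n w => ltW (edisc_gt0 n w)) H.
apply: ae_mono hcv _ => w [cv _].
have -> : (fun n => edisc n w) = (fun n => \sum_(k < n.+1) edisc k w - \sum_(k < n) edisc k w).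
  by apply/funext => n; rewrite big_ord_recr/=; set S := \sum_(_ < _) _; ring.
rewrite -[X in _ --> X](subrr (h w)); apply: cvgB => //.
by rewrite (cvg_shiftS (fun n => \sum_(k < n) edisc k w)).
Qed.

End arm.

(** * Stopping times and threads *)

Section stopped_sums.
Context {R : realType} {d : measure_display} {Omega : measurableType d}.
Variables (F : nat -> set (set Omega)).
Hypothesis sF : forall u, sub_sigma (F u).
Hypothesis Fle : forall u v, (u <= v)%N -> F u `<=` F v.

Definition alive (tau : Omega -> option nat) v := [set w | lt_opt v (tau w)].

Lemma alive_F tau v : stopping_time F tau -> F v (alive tau v).
Proof.
move=> st; have [sa _] := sF v; have := GsetC sa (st v); congr (F v _).
apply/seteqP; split=> w /=; rewrite /alive/= /lt_opt; case: (tau w) => [k|]//.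
- by move=> h; rewrite ltnNge; apply/negP => kv; apply: h; exists k.
- by move=> vk [k' kv [kk]]; move: vk; rewrite kk ltnNge kv.
- by move=> _ [k' _].
Qed.

Lemma alive_S tau v : alive tau v.+1 `<=` alive tau v.
Proof. by move=> w; rewrite /alive/= /lt_opt; case: (tau w) => // k; exact: ltnW. Qed.

Lemma partial_stop_sum u n tau (f : nat -> Omega -> R) w :
  \sum_(u <= v < n | lt_opt v (tau w)) f v w =
  \sum_(v < n | (u <= v)%N) \1_(alive tau v) w * f v w.
Proof.
rewrite big_geq_mkord big_mkcondl/=; apply: eq_bigr => v _.
case: ifPn => h; first by rewrite indicP1 ?mul1r.
by rewrite indicP0 ?mul0r//; exact/negP.
Qed.

(** The passage from stopping times to threads; [thread_time] goes the other way, at the price of a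
    cap. *)
Lemma thread_alive u C tau : F u C -> stopping_time F tau ->
  (forall w, lt_opt u (tau w)) ->
  let B v := if (u <= v)%N then C `&` alive tau v else set0 in thread F u B /\ B u = C.
Proof.
move=> FC st tu B; split; last first.
  by rewrite /B leqnn; apply/seteqP; split=> [w []//|w Cw]; split => //; exact: tu.
split=> [v|v vu|v uv].
- rewrite /B; case: leqP => uv; have [sa _] := sF v; last exact: Gset0.
  by apply: (GsetI sa); [exact: Fle FC|exact: alive_F].
- by rewrite /B leqNgt vu.
- rewrite /B uv leqW//; apply: setIS; exact: alive_S.
Qed.

(* The stopping time which leaves a thread, capped at [n]. *)
Definition thread_time u n (B : nat -> set Omega) (w : Omega) : option nat :=
  Some (u.+1 + find (fun v => w \notin B v) (iota u.+1 (n - u.+1)))%N.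

Lemma thread_time_gt u n B w : lt_opt u (thread_time u n B w).
Proof. by rewrite /thread_time/= addSn ltnS leq_addr. Qed.

Lemma thread_time_le u n B w v : (u < n)%N -> (n <= v)%N ->
  ~~ lt_opt v (thread_time u n B w).
Proof.
move=> un nv; rewrite /thread_time/= -leqNgt; apply: leq_trans nv.
rewrite -[leqRHS](subnKC un) leq_add2l.
by apply: leq_trans (find_size _ _) _; rewrite size_iota.
Qed.

(** To have left by stage [v] is to be outside some [B m] with [u < m <= v], hence outside [B v] by
    nesting. The stage [v = u] is excluded: the time exceeds [u] even outside [B u]. *)
Lemma thread_time_lt u n B w v : thread F u B -> (u < v < n)%N ->
  lt_opt v (thread_time u n B w) = (w \in B v).
Proof.
move=> [_ _ BS] /andP[uv vn]; rewrite /thread_time/=.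
set s := iota _ _; set a := fun v => _.
have vs : (v - u.+1 < size s)%N by rewrite size_iota ltn_sub2r// (leq_ltn_trans uv).
have nthE k : (k < size s)%N -> nth 0%N s k = (u.+1 + k)%N.
  by rewrite size_iota => ks; rewrite nth_iota.
apply/idP/idP => h.
  have : (v - u.+1 < find a s)%N by rewrite ltn_subLR.
  by move=> /(before_find 0%N); rewrite nthE// subnKC// /a => /negbFE.
rewrite -ltn_subLR// ltnNge; apply/negP => fv.
have fs : (find a s < size s)%N by apply: leq_ltn_trans vs.
have := nth_find 0%N (s := s) (a := a); rewrite has_find => /(_ fs).
rewrite nthE// /a => /negP; apply; apply/mem_set.
have le : (u.+1 + find a s <= v)%N by rewrite -(subnKC uv) leq_add2l.
move: h => /set_mem; move: le.
have : (u <= u.+1 + find a s)%N by rewrite addSn leqW// leq_addr.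
move: (u.+1 + find a s)%N => m um; elim: v {uv vn vs fv} => [|k IH].
  by rewrite leqn0 => /eqP ->.
rewrite leq_eqVlt => /predU1P[->//|]; rewrite ltnS => mk Bk; apply: IH => //.
by apply: BS Bk; exact: leq_trans mk.
Qed.

Lemma thread_time_stop u n B : (u < n)%N -> thread F u B -> stopping_time F (thread_time u n B).
Proof.
move=> un tB m; have [sa _] := sF m; have [FB _ _] := tB.
have -> : [set w | exists2 k, (k <= m)%N & thread_time u n B w = Some k] =
    [set w | ~~ lt_opt m (thread_time u n B w)].
  apply/seteqP; split=> w /=.
    by move=> [k km]; rewrite /thread_time => -[->]/=; rewrite -leqNgt.
  rewrite /thread_time/= -leqNgt => h.
  by exists (u.+1 + find (fun v : nat => w \notin B v) (iota u.+1 (n - u.+1)))%N.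
have [nm|mn] := leqP n m.
  have -> : [set w | ~~ lt_opt m (thread_time u n B w)] = setT.
    by apply/seteqP; split=> // w _; exact: thread_time_le.
  exact: GsetT.
have [mu|um] := leqP m u.
  have -> : [set w | ~~ lt_opt m (thread_time u n B w)] = set0.
    apply/seteqP; split=> // w /= /negP; apply.
    by have := thread_time_gt u n B w; rewrite /thread_time/=; exact: leq_ltn_trans.
  exact: Gset0.
have -> : [set w | ~~ lt_opt m (thread_time u n B w)] = ~` B m.
  have E w : lt_opt m (thread_time u n B w) = (w \in B m) by rewrite thread_time_lt ?um.
  apply/seteqP; split=> w /=; have := E w => /= ->.
    by move/negP => h /mem_set.
  by move=> h; apply/negP => /set_mem.
exact: GsetC.
Qed.

Lemma stop_sum_thread u n B (f : nat -> Omega -> R) w : (u < n)%N ->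
  stop_sum u (thread_time u n B) f w =
  \sum_(v < n | (u <= v)%N) \1_(alive (thread_time u n B) v) w * f v w.
Proof.
move=> un; rewrite /stop_sum -partial_stop_sum; apply: (@lim_near_cst R) => //.
near=> m; have nm : (n <= m)%N by near: m; exists n.
rewrite (big_cat_nat (n := n))//=; last exact: ltnW.
rewrite [X in _ + X]big_nat_cond [X in _ + X]big1 ?addr0// => v.
move=> /andP[/andP[nv _]] h; exfalso; move: h; apply/negP.
exact: thread_time_le.
Unshelve. all: by end_near. Qed.

End stopped_sums.

Section absolute_convergence.
Context {R : realType}.

Lemma cvgn_sum_norm (g : nat -> R) (h : R) : (forall n, \sum_(v < n) `|g v| <= h) ->
  cvgn (fun n => \sum_(v < n) g v).
Proof.
move=> gh; rewrite -[X in cvgn X](seriesEord g); apply: normed_cvg.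
rewrite (_ : [normed series g] = fun n => \sum_(v < n) `|g v|); last first.
  by apply/funext => n; rewrite -(big_mkord xpredT (fun v => `|g v|)).
apply: nondecreasing_is_cvgn; last by exists h => _ [n _ <-].
by apply/nondecreasing_seqP => n; rewrite big_ord_recr/= lerDl.
Qed.

Lemma cvgn_lim_eq (f : nat -> R) : cvgn f -> f @ \oo --> limn f.
Proof. by []. Qed.

Lemma le_cvgn (f : nat -> R) l k : f @ \oo --> l -> (\forall n \near \oo, f n <= k) -> l <= k.
Proof.
move=> fl fk; rewrite -(cvg_lim _ fl)//; apply: limr_le => //.
by apply/cvg_ex; eexists; exact: fl.
Qed.

Lemma ge_cvgn (f : nat -> R) l k : f @ \oo --> l -> (\forall n \near \oo, k <= f n) -> k <= l.
Proof.
move=> fl fk; rewrite -(cvg_lim _ fl)//; apply: limr_ge => //.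
by apply/cvg_ex; eexists; exact: fl.
Qed.

End absolute_convergence.

(** * The Gittins index *)

Section index.
Context {R : realType} {d : measure_display} {Omega : measurableType d}.
Variables (P : probability Omega R) (q : R).
Variables (F : nat -> set (set Omega)) (X W : nat -> Omega -> R).
Hypothesis q0 : 0 < q.
Hypothesis arm : arm_model P F X W.
Hypothesis Hint : arm_integrable P q X W.
Notation L1 := (L1 P).
Notation Ex := (Ex P).
Notation e := (edisc q W).
Notation K := ((cdisc P q W)^-1).

Let sF := arm_sub_sigma arm.
Let sFa u : sigma_algebra setT (F u). Proof. by case: (sF u). Qed.
Let sFm u A : F u A -> measurable A. Proof. by case: (sF u) => _; exact. Qed.
Let mF u (f : Omega -> R) : Gmeas (F u) f -> measurable_fun setT f.
Proof. by apply: Gmeas_mf; case: (sF u). Qed.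
Let Fle := arm_Fle arm.
Let e_gt0 u w : 0 < e u w. Proof. exact: edisc_gt0. Qed.
Let e_ge0 u w : 0 <= e u w. Proof. exact: ltW. Qed.
Let Ge u : Gmeas (F u) (e u). Proof. exact: edisc_F arm u. Qed.
Let GX u : Gmeas (F u) (X u). Proof. exact: arm_FX arm u. Qed.
Let K0 : 0 < K. Proof. by rewrite invr_gt0 (cdisc_gt0 q0 arm). Qed.

Lemma L1_edisc u : L1 (e u).
Proof.
apply: (@L1_le _ _ _ _ _ (cst 1)); [exact: mF (Ge u)|exact: L1_cst|move=> w].
by rewrite ger0_norm// (edisc_le1 q0 arm).
Qed.

Section ratio.
Variables (u : nat) (tau : Omega -> option nat) (la N D : Omega -> R).
Hypothesis tau_stop : stopping_time F tau.
Hypothesis tau_gt : forall w, lt_opt u (tau w).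
Hypothesis Gla : Gmeas (F u) la.
Hypothesis Lla : L1 (fun w => la w * e u w).
Let num := stop_sum u tau (fun v w => e v w * X v w).
Let den := stop_sum u tau (fun v w => e v w).
Hypothesis HN : cond_exp P (F u) num N.
Hypothesis HD : cond_exp P (F u) den D.
Notation A := (alive tau).

Let pX n w := \sum_(v < n | (u <= v)%N) \1_(A v) w * (e v w * X v w).
Let pE n w := \sum_(v < n | (u <= v)%N) \1_(A v) w * e v w.

Let FA v : F v (A v). Proof. exact: alive_F. Qed.
Let mA v : measurable (A v). Proof. exact: sFm (FA v). Qed.

Let partial_le (f : nat -> Omega -> R) n w :
  \sum_(v < n) `|if (u <= v)%N then \1_(A v) w * f v w else 0| <= \sum_(v < n) `|f v w|.
Proof.
apply: ler_sum => v _; case: ifP => _; last by rewrite normr0.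
by rewrite normrM ler_piMl ?norm_indic.
Qed.

Let partial_cvg (f : nat -> Omega -> R) w h : (forall n, \sum_(v < n) `|f v w| <= h) ->
  (fun n => \sum_(v < n | (u <= v)%N) \1_(A v) w * f v w) @ \oo --> stop_sum u tau f w /\
  forall n, `|\sum_(v < n | (u <= v)%N) \1_(A v) w * f v w| <= h.
Proof.
move=> fh; split=> [|n].
  rewrite /stop_sum; under [in X in _ --> limn X]eq_fun do rewrite partial_stop_sum.
  apply: cvgn_lim_eq; under eq_fun do rewrite big_mkcond/=.
  apply: (@cvgn_sum_norm _ (fun v => if (u <= v)%N then \1_(A v) w * f v w else 0) h) => n.
  exact: le_trans (partial_le f n w) (fh n).
rewrite big_mkcond/=; apply: le_trans (ler_norm_sum _ _ _) _.
exact: le_trans (partial_le f n w) (fh n).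
Qed.

(** Translates the ratio into finite sums: [N - la * D] is the conditional mean of the excess over
    the charge [la] until [tau], and its integrals are limits of partial sums. The lower bound on
    [D] comes from [tau > u], the upper one from [Ex_tail_edisc]; they give [D > 0] and make
    [la * D] integrable as soon as [la * e u] is. *)
Lemma ratio_props : [/\
  {ae P, forall w, e u w <= D w /\ D w <= K * e u w},
  L1 (fun w => la w * D w), L1 N &
  forall C, F u C ->
    (fun n => \sum_(v < n | (u <= v)%N)
       Ex (fun w => \1_(C `&` A v) w * (e v w * (X v w - la w)))) @ \oo -->
    Ex (fun w => \1_C w * (N w - la w * D w))].
Proof.
have /(cond_expP P (sF u))[Lnum GN LN EN] := HN.
have /(cond_expP P (sF u))[Lden GD LD ED] := HD.
have [LeX [M HM]] := L1_edX q0 arm Hint.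
have [hX [LhX hX0 aeX]] := Ex_series (fun n => L1_abs (LeX n)) (fun n w => normr_ge0 _) HM.
have HE n : \sum_(v < n) Ex (e v) <= K * Ex (e 0).
  have E v : Ex (fun w => 1 * e v w) = Ex (e v).
    by apply: eq_Ex => w; rewrite mul1r.
  have [|||_] := @Ex_tail_edisc _ _ _ _ _ _ _ _ q0 arm 0 (cst 1) n.
  - exact: Gm_cst.
  - by move=> w.
  - by apply: eq_L1 (L1_edisc 0) => w; rewrite mul1r.
  by rewrite /= E; under eq_bigr do rewrite E.
have [hE [LhE hE0 aeE]] := Ex_series L1_edisc e_ge0 HE.
have aL w : `|la w * e u w| = `|la w| * e u w by rewrite normrM (ger0_norm (e_ge0 _ _)).
have Gabs : Gmeas (F u) (fun w => `|la w|).
  by apply: (Gm_comp (h := fun x : R => `|x|)) => //; exact: normr_measurable.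
have Lae : L1 (fun w => `|la w| * e u w) by apply: (eq_L1 aL); exact: L1_abs.
have tail n := @Ex_tail_edisc _ _ _ _ _ _ _ _ q0 arm u (fun w => `|la w|) n Gabs
  (fun w => normr_ge0 _) Lae.
have Llav v : (u <= v)%N -> L1 (fun w => `|la w| * e v w).
  by have [h _] := tail 0%N; exact: h.
(* The sum of these terms dominates the charges paid from stage [u] on, whatever [tau] is. *)
pose fl v w := if (u <= v)%N then `|la w| * e v w else 0.
have Lfl v : L1 (fl v).
  by rewrite /fl; case uv: (u <= v)%N; [exact: Llav|exact: L1_cst].
have fl0 v w : 0 <= fl v w by rewrite /fl; case: ifP => // _; rewrite mulr_ge0.
have Hl n : \sum_(v < n) Ex (fl v) <= K * Ex (fun w => `|la w| * e u w).
  have [_] := tail n; apply: le_trans; rewrite [leRHS]big_mkcond/=; apply: ler_sum => v _.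
  by rewrite /fl; case: (u <= v)%N; rewrite ?Ex_cst.
have [hl [Lhl hl0 ael]] := Ex_series Lfl fl0 Hl.
have mpX n : measurable_fun setT (pX n).
  apply/L1_meas/(@L1_sum _ _ _ P) => v _; exact: L1_ind.
have LpE n : L1 (pE n).
  by apply: (@L1_sum _ _ _ P) => v _; apply: L1_ind => //; exact: L1_edisc.
have cX : {ae P, forall w, (fun n => pX n w) @ \oo --> num w /\ forall n, `|pX n w| <= hX w}.
  apply: ae_mono aeX _ => w [_ le].
  by have := @partial_cvg (fun v w => e v w * X v w) w (hX w) le.
have cE : {ae P, forall w, (fun n => pE n w) @ \oo --> den w /\ forall n, `|pE n w| <= hE w}.
  apply: ae_mono aeE _ => w [_ le]; apply: (@partial_cvg e) => n.
  by apply: le_trans (le n); apply: ler_sum => v _; rewrite ger0_norm.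
have pE_ge n w : (u < n)%N -> e u w <= pE n w.
  move=> un; have Auw : A u w by exact: tau_gt.
  rewrite /pE (bigD1 (Ordinal un))//= (indicP1 Auw) mul1r lerDl.
  apply: sumr_ge0 => v _; apply: mulr_ge0; last exact: e_ge0.
  by case/andP: (@indic01 R _ _ (A v) w).
have cEC C : F u C -> (fun n => Ex (fun w => \1_C w * pE n w)) @ \oo -->
    Ex (fun w => \1_C w * D w).
  move=> FC; have mC := sFm FC; rewrite ED//.
  have [||//] := @Ex_dct _ _ _ P (fun n w => \1_C w * pE n w) (fun w => \1_C w * den w) hE
    (fun n => L1_meas (L1_ind mC (LpE n))) (L1_meas (L1_ind mC Lden)) LhE.
  - by apply: ae_mono cE _ => w [cv _]; apply: cvgM => //; exact: cvg_cst.
  - apply: ae_mono cE _ => w [_ le] n; rewrite normrM; apply: le_trans (le n).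
    by rewrite ler_piMl ?norm_indic.
have Dge : {ae P, forall w, e u w <= D w}.
  apply: (@Ex_test _ _ _ P (F u)) => // [|C FC]; first exact: L1_edisc.
  have mC := sFm FC; apply: ge_cvgn (cEC C FC) _; exists u.+1 => // n /= un.
  apply: Ex_le; [by apply: L1_ind => //; exact: L1_edisc|exact: L1_ind|move=> w].
  by rewrite ler_wpM2l ?pE_ge//; case/andP: (@indic01 R _ _ C w).
have Dle : {ae P, forall w, D w <= K * e u w}.
  apply: (@Ex_test _ _ _ P (F u)) => // [||C FC].
  - by apply: GmM => //; exact: Gm_cst.
  - by apply: L1Z; exact: L1_edisc.
  have mC := sFm FC; apply: le_cvgn (cEC C FC) _; apply: nearW => n.
  have LCe : L1 (fun w => \1_C w * e u w) by apply: L1_ind => //; exact: L1_edisc.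
  have GC : Gmeas (F u) (\1_C : Omega -> R) by exact: Gm_ind.
  have C0 w : 0 <= \1_C w :> R by case/andP: (@indic01 R _ _ C w).
  have [_ h] := @Ex_tail_edisc _ _ _ _ _ _ _ _ q0 arm u (\1_C) n GC C0 LCe.
  rewrite [leRHS](_ : _ = K * Ex (fun w => \1_C w * e u w)); last first.
    by rewrite -ExZ//; apply: eq_Ex => w; ring.
  apply: le_trans h; rewrite -Ex_sum; last first.
    by move=> v _; apply: L1_ind => //; exact: L1_edisc.
  apply: Ex_le.
  - exact: L1_ind.
  - by apply: L1_sum => v _; apply: L1_ind => //; exact: L1_edisc.
  move=> w; rewrite /pE mulr_sumr; apply: ler_sum => v _.
  by rewrite ler_wpM2l// ler_piMl//; case/andP: (@indic01 R _ _ (A v) w).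
have mla := mF Gla.
have LlD : L1 (fun w => la w * D w).
  apply: (@L1_le_ae _ _ _ P _ (fun w => K * (la w * e u w))).
  - by apply: measurable_funM => //; exact: (L1_meas LD).
  - exact: L1Z.
  - apply: ae_mono2 Dge Dle _ => w h1 h2; have D0 : 0 <= D w by exact: le_trans h1.
    rewrite !normrM (ger0_norm D0) (gtr0_norm K0) (ger0_norm (e_ge0 _ _)) mulrCA.
    by rewrite ler_wpM2l.
have laE : {ae P, forall w, forall n, `|la w * pE n w| <= hl w}.
  apply: ae_mono ael _ => w [_ le] n; apply: le_trans (le n).
  rewrite /pE mulr_sumr (le_trans (ler_norm_sum _ _ _))// big_mkcond/=.
  apply: ler_sum => v _; rewrite /fl; case: ifP => // _.
  rewrite !normrM (ger0_norm (e_ge0 _ _)) ler_wpM2l// ler_piMl ?norm_indic//.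
have Llden : L1 (fun w => la w * den w).
  apply: (@L1_le_ae _ _ _ P _ hl) => //.
    by apply: measurable_funM => //; exact: (L1_meas Lden).
  apply: ae_mono2 cE laE _ => w [cv _] le; rewrite (ger0_norm (hl0 w)).
  have cv' : (fun n => `|la w * pE n w|) @ \oo --> `|la w * den w|.
    by apply: cvg_norm; apply: cvgM => //; exact: cvg_cst.
  by apply: le_cvgn cv' _; exact: nearW.
split=> //; first by apply: ae_mono2 Dge Dle _.
move=> C FC; have mC := sFm FC.
(* [D - den] has zero mean on [F u], and the [F u]-measurable factor [la] can be pulled out. *)
have EDla : Ex (fun w => \1_C w * (la w * D w)) = Ex (fun w => \1_C w * (la w * den w)).
  have LY : L1 (fun w => D w - den w) by exact: L1B.
  apply/eqP; rewrite -subr_eq0 -ExB; [|exact: L1_ind|exact: L1_ind].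
  rewrite (eq_Ex _ (g := fun w => (\1_C w * la w) * (D w - den w))); last by move=> w; ring.
  apply/eqP; apply: (Ex_pull (sF u)) => //.
  - by apply: GmM => //; exact: Gm_ind.
  - have := L1_ind mC (L1B LlD Llden); apply: eq_L1 => w; ring.
  - move=> C' FC'; have mC' := sFm FC'.
    rewrite (eq_Ex _ (g := fun w => \1_C' w * D w - \1_C' w * den w)); last by move=> w; ring.
    by rewrite ExB ?ED ?subrr//; exact: L1_ind.
have -> : Ex (fun w => \1_C w * (N w - la w * D w)) = Ex (fun w => \1_C w * (num w - la w * den w)).
  rewrite (eq_Ex _ (g := fun w => \1_C w * N w - \1_C w * (la w * D w))); last by move=> w; ring.
  rewrite ExB ?EN ?EDla -?ExB//; try exact: L1_ind.
  by apply: eq_Ex => w; ring.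
have -> : (fun n => \sum_(v < n | (u <= v)%N)
       Ex (fun w => \1_(C `&` A v) w * (e v w * (X v w - la w)))) =
    (fun n => Ex (fun w => \1_C w * (pX n w - la w * pE n w))).
  apply/funext => n; rewrite -Ex_sum; last first.
    move=> v uv; have mCA : measurable (C `&` A v) by exact: measurableI.
    apply: L1_ind => //; have LL : L1 (fun w => la w * e v w).
      apply: (@L1_le _ _ _ P _ _ _ (Llav v uv)).
        by apply: measurable_funM => //; exact: L1_meas (L1_edisc v).
      by move=> w; rewrite normrM (ger0_norm (e_ge0 _ _)).
    by apply: eq_L1 (L1B (LeX v) LL) => w; ring.
  apply: eq_Ex => w; rewrite /pX /pE mulr_sumr -sumrB mulr_sumr; apply: eq_bigr => v _.
  by rewrite indicI/=; ring.
apply: (fun h1 h2 h3 h4 h5 => proj2 (@Ex_dct _ _ _ P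
  (fun n w => \1_C w * (pX n w - la w * pE n w))
  (fun w => \1_C w * (num w - la w * den w)) (fun w => hX w + hl w) h1 h2 h3 h4 h5)).
- move=> n; apply: measurable_funM; first exact: measurable_indic.
  by apply: measurable_funB => //; apply: measurable_funM => //; exact: (L1_meas (LpE n)).
- exact: (L1_meas (L1_ind mC (L1B Lnum Llden))).
- exact: L1D.
- apply: ae_mono2 cX cE _ => w [cx _] [ce _]; apply: cvgM; first exact: cvg_cst.
  by apply: cvgB => //; apply: cvgM => //; exact: cvg_cst.
- apply: ae_mono2 cX laE _ => w [_ lx] ll n; rewrite normrM.
  apply: (@le_trans _ _ `|pX n w - la w * pE n w|); first by rewrite ler_piMl ?norm_indic.
  by apply: le_trans (ler_normB _ _) _; exact: lerD.
Qed.

End ratio.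
End index.

Section gittins.
Context {R : realType} {d : measure_display} {Omega : measurableType d}.
Variables (P : probability Omega R) (q : R).
Variables (F : nat -> set (set Omega)) (X W : nat -> Omega -> R).
Variable Gam : nat -> Omega -> \bar R.
Hypothesis q0 : 0 < q.
Hypothesis arm : arm_model P F X W.
Hypothesis Hint : arm_integrable P q X W.
Hypothesis HG : forall s, gittins_index P q F X W s (Gam s).
Notation L1 := (L1 P).
Notation Ex := (Ex P).
Notation e := (edisc q W).
Notation K := ((cdisc P q W)^-1).

Let sF := arm_sub_sigma arm.
Let sFa u : sigma_algebra setT (F u). Proof. by case: (sF u). Qed.
Let sFm u A : F u A -> measurable A. Proof. by case: (sF u) => _; exact. Qed.
Let mF u (f : Omega -> R) : Gmeas (F u) f -> measurable_fun setT f.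
Proof. by apply: Gmeas_mf; case: (sF u). Qed.
Let Fle := arm_Fle arm.
Let e_gt0 u w : 0 < e u w. Proof. exact: edisc_gt0. Qed.
Let e_ge0 u w : 0 <= e u w. Proof. exact: ltW. Qed.
Let Ge u : Gmeas (F u) (e u). Proof. exact: edisc_F arm u. Qed.
Let GX u : Gmeas (F u) (X u). Proof. exact: arm_FX arm u. Qed.
Let K0 : 0 < K. Proof. by rewrite invr_gt0 (cdisc_gt0 q0 arm). Qed.
Let LeX u : L1 (fun w => e u w * X u w).
Proof. by have [h _] := L1_edX q0 arm Hint; exact: h. Qed.
Let eS u v w : (u <= v)%N -> e v w <= e u w. Proof. exact: (edisc_le q0 arm). Qed.
Let Le u : L1 (e u). Proof. exact: L1_edisc q0 arm u. Qed.

Let Gei u : Gmeas (F u) (fun w => (e u w)^-1).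
Proof.
have -> : (fun w => (e u w)^-1) = (fun w => expR (q * optime W u w)).
  by apply/funext => w; rewrite /edisc expRN invrK.
apply: (@Gm_comp _ _ _ _ _ _ _ (fun x : R => expR (q * x))); last exact: arm_FT arm u.
by apply: measurableT_comp => //; exact: measurable_funM.
Qed.

Lemma L1_later u v (f : Omega -> R) : (u <= v)%N -> Gmeas (F u) f ->
  L1 (fun w => f w * e u w) -> L1 (fun w => f w * e v w).
Proof.
move=> uv Gf Lf; apply: (@L1_le _ _ _ P _ (fun w => `|f w * e u w|)).
- by apply: measurable_funM; [exact: mF Gf|exact: mF (Ge v)].
- exact: L1_abs.
- by move=> w; rewrite !normrM ler_wpM2l// !ger0_norm// eS.
Qed.

Lemma thread_cond_exp u n B : (u < n)%N -> thread F u B -> exists N D,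
  cond_exp P (F u) (stop_sum u (thread_time u n B) (fun v w => e v w * X v w)) N /\
  cond_exp P (F u) (stop_sum u (thread_time u n B) (fun v w => e v w)) D.
Proof.
move=> un tB; have st := thread_time_stop sF un tB.
have mA v : measurable (alive (thread_time u n B) v) by exact: sFm (alive_F sF v st).
have key (f : nat -> Omega -> R) : (forall v, L1 (f v)) ->
    exists Z, cond_exp P (F u) (stop_sum u (thread_time u n B) f) Z.
  move=> Lf; apply: (cond_exp_ex (sF u)); have : L1 (fun w => \sum_(v < n | (u <= v)%N)
      \1_(alive (thread_time u n B) v) w * f v w).
    by apply: L1_sum => v _; exact: L1_ind.
  by apply: eq_L1 => w; rewrite stop_sum_thread.
have [N HN] := key _ LeX; have [D HD] := key _ Le.
by exists N, D.
Qed.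

(** The time that leaves [B], capped at [n], competes in the supremum, so [N / D <= Gam u <= la] on
    [B u]. As [D > 0], the conditional excess [N - la * D] is nonpositive there. *)
Lemma index_upper u n B (la : Omega -> R) : (u < n)%N -> thread F u B ->
  Gmeas (F u) la -> L1 (fun w => la w * e u w) ->
  {ae P, forall w, B u w -> (Gam u w <= (la w)%:E)%E} ->
  \sum_(v < n) Ex (fun w => \1_(B v) w * (e v w * (X v w - la w))) <= 0.
Proof.
move=> un tB Gla Lla BG; have [N [D [HN HD]]] := thread_cond_exp un tB.
have st := thread_time_stop sF un tB; have gt := thread_time_gt u n B.
have [FB B0 BS] := tB; have mBu : measurable (B u) := sFm (FB u).
have [Dge LlD LN cv] := @ratio_props _ _ _ P q F X W q0 arm Hint u _ la N D st gt Gla Lla HN HD.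
have ND := (HG u).2.1 _ st gt N D HN HD.
have {}cv := cv _ (FB u).
have le0 : Ex (fun w => \1_(B u) w * (N w - la w * D w)) <= 0.
  rewrite -(Ex_cst P 0); apply: Ex_le_ae; [|exact: L1_cst|].
    by apply: L1_ind => //; exact: L1B.
  apply: ae_mono2 (ae_mono2 Dge ND (fun w a b => conj a b)) BG _ => w [[h _] h1] h2.
  have [Bw|Bw] := pselect (B u w); last by rewrite indicP0// mul0r.
  rewrite indicP1// mul1r subr_le0.
  have D0 : 0 < D w by exact: lt_le_trans h.
  by have := le_trans h1 (h2 Bw); rewrite lee_fin ler_pdivrMr.
(* The stopping time is at most [n], so the partial sums no longer change after [n]. *)
apply: le_trans le0; apply: ge_cvgn cv _; exists n => // m /= nm.
rewrite -(subnKC nm) [leRHS]big_mkcond/= big_split_ord/=.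
rewrite [X in _ <= _ + X]big1 ?addr0 => [|v _]; last first.
  rewrite (leq_trans (ltnW un)) ?leq_addr//.
  rewrite (eq_Ex _ (g := cst 0)) ?Ex_cst// => w; rewrite indicP0 ?mul0r// => -[_].
  by rewrite /alive => h; have := @thread_time_le _ _ u n B w (n + v) un (leq_addr _ _); rewrite h.
apply: ler_sum => v _; case: leqP => uv; last first.
  by rewrite B0// (eq_Ex _ (g := cst 0)) ?Ex_cst// => w; rewrite indicP0// mul0r.
rewrite le_eqVlt; apply/orP; left; apply/eqP; apply: eq_Ex => w; congr (\1_ _ w * _).
have [vu|vu] := eqVneq (v : nat) u.
  rewrite vu; apply/seteqP; split=> [z Bz|z []//].
  by split=> //; exact: gt.
have vun : (u < v < n)%N by rewrite ltn_neqAle eq_sym vu uv/=.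
apply/seteqP; split=> z; last first.
  by move=> [_]; rewrite /alive/mkset (thread_time_lt z tB vun) => /set_mem.
move=> Bz; split; first exact: (thread_sub tB Bz).
by rewrite /alive/mkset (thread_time_lt z tB vun); exact/mem_set.
Qed.

(** For every stopping time [N - la * D <= Q], and where [Q < 0] the bound [D <= K * e u] turns this
    into [N / D <= la + Q / (K * e u)]. So [Z] dominates all ratios, and the index, being the least
    such bound, lies below [Z]. *)
Lemma index_attained u (la Q : Omega -> R) :
  Gmeas (F u) la -> L1 (fun w => la w * e u w) -> Gmeas (F u) Q -> L1 Q ->
  (forall B n, thread F u B -> (u < n)%N ->
     \sum_(v < n) Ex (fun w => \1_(B v) w * (e v w * (X v w - la w))) <=
       Ex (fun w => \1_(B u) w * Q w)) ->
  {ae P, forall w, Q w < 0 -> (Gam u w <= (la w + Q w / (K * e u w))%:E)%E}.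
Proof.
move=> Gla Lla GQ LQ H.
pose Z w : \bar R := if Q w < 0 then (la w + Q w / (K * e u w))%:E else Gam u w.
have GGam : Gmeas (F u) (Gam u) by case: (HG u).
suff HZ : {ae P, forall w, (Gam u w <= Z w)%E}.
  by apply: ae_mono HZ _ => w; rewrite /Z => + Qw; rewrite Qw.
apply: (HG u).2.2.
  apply: measurable_fun_ifT.
  - by apply: measurable_fun_ltr => //; exact: mF GQ.
  - apply/measurable_EFinP; apply: measurable_funD; first exact: mF Gla.
    apply: measurable_funM; first exact: mF GQ.
    have -> : (fun w => (K * e u w)^-1) = (fun w => K^-1 * (e u w)^-1).
      by apply/funext => w; rewrite invfM.
    by apply: measurable_funM => //; exact: mF (Gei u).
  - by move=> _ A mA; rewrite setTI; apply: (@sFm u); exact: GGam.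
move=> tau st gt N D HN HD.
have [Dge LlD LN cv] := @ratio_props _ _ _ P q F X W q0 arm Hint u _ la N D st gt Gla Lla HN HD.
have ND := (HG u).2.1 _ st gt N D HN HD.
have /(cond_expP P (sF u))[_ GN _ _] := HN.
have /(cond_expP P (sF u))[_ GD _ _] := HD.
have NQ : {ae P, forall w, N w - la w * D w <= Q w}.
  apply: (@Ex_test _ _ _ P (F u)) => // [||C FC].
  - by apply: GmB => //; exact: GmM.
  - exact: L1B.
  apply: le_cvgn (cv C FC) _; exists u.+1 => // n /= un.
  have [tB Bu] := thread_alive sF Fle FC st gt.
  have := H _ n tB un; rewrite Bu; apply: le_trans.
  rewrite [leLHS]big_mkcond/=; apply: ler_sum => v _; case: leqP => uv//.
  by rewrite (eq_Ex _ (g := cst 0)) ?Ex_cst// => w; rewrite indicP0// mul0r.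
apply: ae_mono2 (ae_mono2 Dge ND (fun w a b => conj a b)) NQ _ => w [[h1 h2] h3] h4.
rewrite /Z; case: ifPn => // Qw; rewrite lee_fin.
have D0 : 0 < D w by exact: lt_le_trans h1.
rewrite ler_pdivrMr// mulrDl.
have : Q w <= Q w / (K * e u w) * D w.
  rewrite -mulrA -[leLHS]mulr1 ler_nM2l// mulrC ler_pdivrMr ?mul1r//.
  by rewrite mulr_gt0.
lra.
Qed.

(** Operating exactly once is admissible: for [tau = u.+1] the ratio is [X u]. *)
Lemma index_ge u : {ae P, forall w, ((X u w)%:E <= Gam u w)%E}.
Proof.
pose B v : set Omega := if v == u then setT else set0.
have tB : thread F u B.
  split=> v; rewrite /B; first by case: ifP => _; [exact: GsetT|exact: Gset0].
    by move=> vu; rewrite ltn_eqF.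
  by move=> uv; rewrite gtn_eqF.
have st := thread_time_stop sF (ltnSn u) tB; have gt := thread_time_gt u u.+1 B.
have E (f : nat -> Omega -> R) : stop_sum u (thread_time u u.+1 B) f = f u.
  apply/funext => w; rewrite stop_sum_thread// big_mkcond big_ord_recr/= leqnn.
  rewrite big1 ?add0r => [|v _]; last by rewrite leqNgt ltn_ord.
  by rewrite indicP1 ?mul1r//; exact: gt.
have self (f : nat -> Omega -> R) : Gmeas (F u) (f u) -> L1 (f u) ->
    cond_exp P (F u) (stop_sum u (thread_time u u.+1 B) f) (f u).
  by move=> Gf Lf; rewrite E; apply/(cond_expP P (sF u)); split.
have HN := self (fun v w => e v w * X v w) (GmM (sFa u) (Ge u) (GX u)) (LeX u).
have HD := self e (Ge u) (Le u).
apply: ae_mono ((HG u).2.1 _ st gt _ _ HN HD) _ => w.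
by rewrite mulrAC divff ?mul1r// gt_eqF.
Qed.

(** Let [hX] be the total of the absolute discounted rewards and let [Y] exceed its conditional mean
    by at least 1. At the charge [Y / e u] the first operation alone costs [Y], so every rule loses
    at least 1, and [index_attained] with [Q = -1] puts the index below this charge. *)
Lemma index_le u : exists Y : Omega -> R, [/\ Gmeas (F u) Y, L1 Y, forall w, 0 <= Y w &
  {ae P, forall w, (Gam u w <= (Y w / e u w)%:E)%E}].
Proof.
have [_ [M HM]] := L1_edX q0 arm Hint.
have [hX [LhX hX0 aeX]] := Ex_series (fun n => L1_abs (LeX n)) (fun n w => normr_ge0 _) HM.
have [Z HZ] := cond_exp_ex (sF u) LhX.
have /(cond_expP P (sF u))[_ GZ LZ EZ] := HZ.
pose Y w := `|Z w| + 1.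
have GY : Gmeas (F u) Y.
  apply: GmD => //; last exact: Gm_cst.
  by apply: (Gm_comp (h := fun x : R => `|x|)) => //; exact: normr_measurable.
have LY : L1 Y by apply: L1D; [exact: L1_abs|exact: L1_cst].
have Y0 w : 0 <= Y w by rewrite addr_ge0.
exists Y; split=> //.
pose la w := Y w / e u w.
have Gla : Gmeas (F u) la.
  exact: GmM.
have laE w : la w * e u w = Y w by rewrite /la divfK// gt_eqF.
have Lla : L1 (fun w => la w * e u w) by apply: (eq_L1 (fun w => esym (laE w))).
have la0 w : 0 <= la w by rewrite divr_ge0.
have H B n : thread F u B -> (u < n)%N ->
    \sum_(v < n) Ex (fun w => \1_(B v) w * (e v w * (X v w - la w))) <=
       Ex (fun w => \1_(B u) w * cst (-1) w).
  move=> [FB B0 BS] un; have mB v : measurable (B v) := sFm (FB v).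
  have Lv v : (u <= v)%N -> L1 (fun w => e v w * (X v w - la w)).
    move=> uv; have := L1B (LeX v) (L1_later uv Gla Lla).
    by apply: eq_L1 => w; ring.
  have LB v : L1 (fun w => \1_(B v) w * (e v w * (X v w - la w))).
    have [uv|vu] := leqP u v; first exact: (L1_ind (mB v) (Lv v uv)).
    by rewrite B0//; apply: eq_L1 (L1_cst P 0) => w; rewrite indicP0// mul0r.
  have mBu := mB u.
  have hY : Ex (fun w => \1_(B u) w * (hX w - Y w)) <= Ex (fun w => \1_(B u) w * cst (-1) w).
    have -> : Ex (fun w => \1_(B u) w * (hX w - Y w)) = Ex (fun w => \1_(B u) w * (Z w - Y w)).
      have L f : L1 f -> Ex (fun w => \1_(B u) w * (f w - Y w)) =
          Ex (fun w => \1_(B u) w * f w) - Ex (fun w => \1_(B u) w * Y w).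
        move=> Lf; rewrite -(ExB (L1_ind mBu Lf) (L1_ind mBu LY)).
        by apply: eq_Ex => w; ring.
      by rewrite !L// EZ.
    apply: Ex_le.
    - exact: (L1_ind mBu (L1B LZ LY)).
    - exact: (L1_ind mBu (L1_cst P (-1))).
    move=> w; apply: ler_wpM2l; first by case/andP: (@indic01 R _ _ (B u) w).
    by rewrite /Y /=; have := ler_norm (Z w); lra.
  apply: le_trans hY; rewrite -Ex_sum//; apply: Ex_le_ae.
  - exact: L1_sum.
  - exact: (L1_ind mBu (L1B LhX LY)).
  apply: ae_mono aeX _ => w [_ /(_ n) le].
  have Bsub v : B v `<=` B u by exact: (thread_sub (And3 FB B0 BS)).
  have [Bw|Bw] := pselect (B u w); last first.
    by rewrite indicP0// mul0r big1// => v _; rewrite indicP0 ?mul0r// => /Bsub.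
  rewrite (indicP1 Bw) mul1r.
  have -> : \sum_(v < n) \1_(B v) w * (e v w * (X v w - la w)) =
      \sum_(v < n) \1_(B v) w * (e v w * X v w) - \sum_(v < n) \1_(B v) w * (e v w * la w).
    by rewrite -sumrB; apply: eq_bigr => v _; ring.
  apply: lerB.
    apply: le_trans le; apply: ler_sum => v _; rewrite (le_trans (ler_norm _))//.
    by rewrite normrM ler_piMl ?norm_indic.
  rewrite -laE (bigD1 (Ordinal un))//= (indicP1 Bw) mul1r mulrC lerDl.
  apply: sumr_ge0 => v _; apply: mulr_ge0; last exact: mulr_ge0.
  by case/andP: (@indic01 R _ _ (B v) w).
have := index_attained Gla Lla (Gm_cst (sFa u) (-1 : R)) (L1_cst P (-1)) H.
move=> ae1; apply: ae_mono ae1 _ => w h.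
have N1 : cst (-1 : R) w < 0 by rewrite /= oppr_lt0.
apply: le_trans (h N1) _; rewrite lee_fin gerDl /= mulN1r oppr_le0 invr_ge0.
by rewrite mulr_ge0// ltW.
Qed.

End gittins.

(** * The prevailing charge *)

Section prevailing_charge.
Context {R : realType} {d : measure_display} {Omega : measurableType d}.
Variable Gam : nat -> Omega -> \bar R.

(** The index is almost surely finite ([gam_fin]), so the default value of [fine] matters only on a
    null set. *)
Definition charge_gam u w : R := fine (Gam u w).
Local Notation gam := charge_gam.

Fixpoint charge_min u w : R :=
  if u is u'.+1 then Num.min (charge_min u' w) (gam u w) else gam 0 w.

Lemma charge_min_leS u w : charge_min u.+1 w <= charge_min u w.
Proof. by rewrite /= ge_min lexx. Qed.

Lemma charge_min_le u v w : (u <= v)%N -> charge_min v w <= charge_min u w.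
Proof. by move: u v; apply/nonincreasing_seqP => u; exact: charge_min_leS. Qed.

Lemma charge_min_gam u w : charge_min u w <= gam u w.
Proof. by case: u => [//|u] /=; rewrite ge_min lexx orbT. Qed.

End prevailing_charge.

Section arm_martingale.
Context {R : realType} {d : measure_display} {Omega : measurableType d}.
Variables (P : probability Omega R) (q : R).
Variables (F : nat -> set (set Omega)) (X W : nat -> Omega -> R).
Variable Gam : nat -> Omega -> \bar R.
Hypothesis q0 : 0 < q.
Hypothesis arm : arm_model P F X W.
Hypothesis Hint : arm_integrable P q X W.
Hypothesis HG : forall s, gittins_index P q F X W s (Gam s).
Notation L1 := (L1 P).
Notation Ex := (Ex P).
Notation e := (edisc q W).
Notation K := ((cdisc P q W)^-1).
Notation g := (charge_min Gam).
Notation gam := (charge_gam Gam).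

Let sF := arm_sub_sigma arm.
Let sFa u : sigma_algebra setT (F u). Proof. by case: (sF u). Qed.
Let sFm u A : F u A -> measurable A. Proof. by case: (sF u) => _; exact. Qed.
Let mF u (f : Omega -> R) : Gmeas (F u) f -> measurable_fun setT f.
Proof. by apply: Gmeas_mf; case: (sF u). Qed.
Let Fle := arm_Fle arm.
Let e_gt0 u w : 0 < e u w. Proof. exact: edisc_gt0. Qed.
Let e_ge0 u w : 0 <= e u w. Proof. exact: ltW. Qed.
Let Ge u : Gmeas (F u) (e u). Proof. exact: edisc_F arm u. Qed.
Let GX u : Gmeas (F u) (X u). Proof. exact: arm_FX arm u. Qed.
Let K0 : 0 < K. Proof. by rewrite invr_gt0 (cdisc_gt0 q0 arm). Qed.
Let LeX u : L1 (fun w => e u w * X u w).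
Proof. by have [h _] := L1_edX q0 arm Hint; exact: h. Qed.
Let eS u v w : (u <= v)%N -> e v w <= e u w. Proof. exact: (edisc_le q0 arm). Qed.

Lemma gam_fin : {ae P, forall w, forall u, Gam u w = (gam u w)%:E}.
Proof.
apply: ae_all => u; have [Y [_ _ _ h]] := index_le q0 arm Hint HG u.
apply: ae_mono2 h (index_ge q0 arm Hint HG u) _ => w.
rewrite /charge_gam; case: (Gam u w) => //=.
Qed.

Lemma gam_F u : Gmeas (F u) (gam u).
Proof.
apply: (@Gm_comp _ _ _ _ _ _ _ (fine : \bar R -> R)) => //.
by case: (HG u).
Qed.

Lemma charge_min_F u : Gmeas (F u) (g u).
Proof.
elim: u => [|u IH]; first exact: gam_F.
apply: (Gm_min (sFa _)); last exact: gam_F.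
by apply: Gmeas_sub IH; exact: arm_FS arm u.
Qed.

(** The charge is at most the initial index, hence at most [Y], and at least the smallest reward met
    so far, because an index dominates its current reward. So [g u] is bounded by [Y] plus the sum
    of [|X v|] over [v <= u]. *)
Lemma L1_charge : (forall u, L1 (fun w => g u w * e u w)) /\
  exists M, forall n, \sum_(u < n) Ex (fun w => `|g u w * e u w|) <= M.
Proof.
have [_ [MX HMX]] := L1_edX q0 arm Hint.
have [Y [GY LY Y0 hY]] := index_le q0 arm Hint HG 0%N.
pose b u w := Y w + \sum_(v < u.+1) `|X v w|.
have gb : {ae P, forall w, forall u, `|g u w| <= b u w}.
  have hX : {ae P, forall w, forall u, X u w <= gam u w}.
    apply: ae_all => u.
    apply: ae_mono2 gam_fin (index_ge q0 arm Hint HG u) _ => w gf h.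
    by move: h; rewrite gf lee_fin.
  apply: ae_mono2 (ae_mono2 hX hY (fun w a b => conj a b)) gam_fin _ => w [h1 h2] h3 u.
  rewrite h3 lee_fin edisc0 divr1 in h2.
  rewrite ler_norml; apply/andP; split.
    rewrite lerNl /b; apply: (@le_trans _ _ (\sum_(v < u.+1) `|X v w|)); last by rewrite lerDr.
    elim: u => [|u IH].
      rewrite big_ord_recr big_ord0/= add0r lerNl.
      by apply: le_trans (h1 0%N); rewrite lerNl; rewrite -normrN ler_norm.
    rewrite big_ord_recr/= lerNl le_min; apply/andP; split.
      by rewrite lerNl; apply: le_trans IH _; rewrite lerDl.
    apply: le_trans (h1 u.+1); rewrite lerNl (le_trans (ler_norm _))// normrN.
    by rewrite lerDr sumr_ge0.
  rewrite /b; apply: (@le_trans _ _ (g 0 w)); first exact: charge_min_le.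
  by apply: le_trans h2 _; rewrite lerDl sumr_ge0.
have Gabs u : Gmeas (F u) (fun w => `|X u w|).
  by apply: (Gm_comp (h := fun x : R => `|x|)) => //; exact: normr_measurable.
have LaX u : L1 (fun w => `|X u w| * e u w).
  by apply: eq_L1 (L1_abs (LeX u)) => w; rewrite normrM ger0_norm// mulrC.
have LYe : L1 (fun w => Y w * e 0 w) by apply: eq_L1 LY => w; rewrite edisc0 mulr1.
have Lbe u : L1 (fun w => b u w * e u w).
  have : L1 (fun w => Y w * e u w + \sum_(v < u.+1) `|X v w| * e u w).
    apply: L1D; first exact: (L1_later q0 arm (leq0n u) GY LYe).
    apply: L1_sum => v _; apply: (L1_later q0 arm _ (Gabs v) (LaX v)).
    by rewrite -ltnS.
  by apply: eq_L1 => w; rewrite /b mulrDl mulr_suml.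
have mge u : measurable_fun setT (fun w => g u w * e u w).
  by apply: measurable_funM; [exact: mF (charge_min_F u)|exact: mF (Ge u)].
have gbe : {ae P, forall w, forall u, `|g u w * e u w| <= b u w * e u w}.
  by apply: ae_mono gb _ => w h u; rewrite normrM (ger0_norm (e_ge0 _ _)) ler_wpM2r.
have Lge u : L1 (fun w => g u w * e u w).
  apply: (L1_le_ae (mge u) (Lbe u)); apply: ae_mono gbe _ => w h.
  by apply: le_trans (h u) _; exact: ler_norm.
split=> //.
exists (K * Ex (fun w => Y w * e 0 w) + K * MX) => n.
apply: (@le_trans _ _ (\sum_(u < n) Ex (fun w => b u w * e u w))).
  apply: ler_sum => u _; apply: Ex_le_ae => //; first exact: L1_abs.
  by apply: ae_mono gbe _ => w h; exact: h.
(* After exchanging the sums, [|X v|] is weighted by all discounts from stage [v] on, whose mean is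
   controlled by [K] times that of [e v]. *)
have -> : \sum_(u < n) Ex (fun w => b u w * e u w) =
   \sum_(u < n) Ex (fun w => Y w * e u w) +
   \sum_(v < n) \sum_(u < n | (v <= u)%N) Ex (fun w => `|X v w| * e u w).
  rewrite (exchange_big_dep xpredT)//= -big_split/=; apply: eq_bigr => u _.
  have -> : \sum_(v < n | (v <= u)%N) Ex (fun w => `|X v w| * e u w) =
      \sum_(v < u.+1) Ex (fun w => `|X v w| * e u w).
    rewrite (big_ord_widen_cond n xpredT (fun v => Ex (fun w => `|X v w| * e u w)))//=.
  rewrite -Ex_sum; last first.
    move=> v _; apply: (L1_later q0 arm _ (Gabs v) (LaX v)).
    by rewrite -ltnS.
  rewrite -ExD.
  - by apply: eq_Ex => w; rewrite /b mulrDl mulr_suml.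
  - exact: (L1_later q0 arm (leq0n u) GY LYe).
  - apply: L1_sum => v _; apply: (L1_later q0 arm _ (Gabs v) (LaX v)).
    by rewrite -ltnS.
apply: lerD.
  have [_ h] := @Ex_tail_edisc _ _ _ _ _ _ _ _ q0 arm 0 Y n GY Y0 LYe.
  exact: h.
apply: (@le_trans _ _ (\sum_(v < n) K * Ex (fun w => `|X v w| * e v w))).
  apply: ler_sum => v _.
  by have [_ h] := @Ex_tail_edisc _ _ _ _ _ _ _ _ q0 arm v (fun w => `|X v w|) n
    (Gabs v) (fun w => normr_ge0 _) (LaX v).
rewrite -mulr_sumr ler_pM2l//; apply: le_trans (HMX n).
apply: ler_sum => v _; rewrite le_eqVlt; apply/orP; left; apply/eqP.
by apply: eq_Ex => w; rewrite normrM ger0_norm// mulrC.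
Qed.

Let al u w := e u w * (X u w - g u w).
Let rec u := [set w | g u w = gam u w].

Let Lal u : L1 (al u).
Proof.
have [h _] := L1_charge; apply: eq_L1 (L1B (LeX u) (h u)) => w.
by rewrite /al; ring.
Qed.

Let Gal u : Gmeas (F u) (al u).
Proof. by apply: GmM => //; apply: GmB => //; exact: charge_min_F. Qed.

Let alM : exists M, forall n, \sum_(v < n) Ex (fun w => `|al v w|) <= M.
Proof.
have [Lg [M1 H1]] := L1_charge; have [_ [M2 H2]] := L1_edX q0 arm Hint.
exists (M2 + M1) => n.
apply: (@le_trans _ _ (\sum_(u < n) (Ex (fun w => `|e u w * X u w|) + Ex (fun w => `|g u w * e u w|)))).
  apply: ler_sum => u _; rewrite -ExD; [|exact: L1_abs|exact: L1_abs].
  apply: Ex_le; first exact: (L1_abs (Lal u)).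
    exact: (L1D (L1_abs (LeX u)) (L1_abs (Lg u))).
  move=> w; apply: le_trans (ler_normB _ _); rewrite le_eqVlt; apply/orP; left.
  by apply/eqP; congr `|_|; rewrite /al; ring.
by rewrite big_split/=; exact: (lerD (H2 n) (H1 n)).
Qed.

Let Frec u : F u (rec u).
Proof. by apply: Gm_eq => //; [exact: charge_min_F|exact: gam_F]. Qed.

(** Before the next visit to [rec] the running minimum does not move, so the charge stays at [g u],
    the index at [u], and [index_upper] applies. *)
Let rec_le0 u B n : thread F u B -> B u `<=` rec u ->
  (forall v, (u < v)%N -> B v `<=` ~` rec v) ->
  \sum_(v < n) Ex (fun w => \1_(B v) w * al v w) <= 0.
Proof.
move=> tB Br Bnr; have [FB B0 BS] := tB.
have [nu|un] := leqP n u.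
  rewrite big1// => v _; rewrite B0; last exact: leq_trans nu.
  by rewrite (eq_Ex _ (g := cst 0)) ?Ex_cst// => w; rewrite indicP0// mul0r.
have gE v w : (u <= v)%N -> B v w -> g v w = g u w.
  elim: v => [|v IH]; first by rewrite leqn0 => /eqP ->.
  rewrite leq_eqVlt => /predU1P[->//|]; rewrite ltnS => uv Bw.
  rewrite -IH//; last exact: BS Bw.
  have := Bnr v.+1 uv w Bw; rewrite /rec /= => nr.
  apply/min_idPl; rewrite leNgt; apply/negP => h; apply: nr.
  by apply/min_idPr/ltW.
have [Lg _] := L1_charge.
have := @index_upper _ _ _ P q F X W Gam q0 arm Hint HG u n B (g u) un tB
  (charge_min_F u) (Lg u) _.
rewrite (eq_bigr (fun v : 'I_n => Ex (fun w => \1_(B v) w * al v w))).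
  apply; apply: ae_mono gam_fin _ => w gf Bw.
  by rewrite gf lee_fin (Br w Bw).
move=> v _; apply: eq_Ex => w.
have [Bw|Bw] := pselect (B v w); last by rewrite !indicP0// !mul0r.
have [uv|vu] := leqP u v; first by rewrite /al (gE v w uv Bw).
by move: Bw; rewrite B0.
Qed.

(** Charging [g u] throughout, instead of the nonincreasing [g v], only lowers the excess, so [Q]
    still bounds it. By [index_attained], [Q < 0] would put the index strictly below its running
    minimum. *)
Let rec_attained u (Q : Omega -> R) : Gmeas (F u) Q -> L1 Q ->
  (forall B n, thread F u B -> (u < n)%N ->
     \sum_(v < n) Ex (fun w => \1_(B v) w * al v w) <= Ex (fun w => \1_(B u) w * Q w)) ->
  {ae P, forall w, 0 <= Q w}.
Proof.
move=> GQ LQ H; have [Lg _] := L1_charge.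
have := @index_attained _ _ _ P q F X W Gam q0 arm Hint HG u (g u) Q
  (charge_min_F u) (Lg u) GQ LQ _.
move=> h; apply: ae_mono2 (h _) gam_fin _ => [B n tB un|w hw gf].
  apply: le_trans (H B n tB un); apply: ler_sum => v _.
  have [FB B0 BS] := tB; have mB : measurable (B v) := sFm (FB v).
  have [uv|vu] := leqP u v; last first.
    rewrite B0// (eq_Ex _ (g := cst 0)) => [|w]; last by rewrite indicP0// mul0r.
    by rewrite Ex_cst Ex_ge0// => w; rewrite indicP0// mul0r.
  apply: Ex_le.
  - apply: L1_ind => //; have LL := L1_later q0 arm uv (charge_min_F u) (Lg u).
    by apply: eq_L1 (L1B (LeX v) LL) => w; ring.
  - exact: L1_ind.
  - move=> w; apply: ler_wpM2l; first by case/andP: (@indic01 R _ _ (B v) w).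
    by rewrite /al ler_wpM2l// lerB// charge_min_le.
rewrite leNgt; apply/negP => Q0; have := hw Q0; rewrite gf lee_fin.
have := charge_min_gam Gam u w.
have : Q w / (K * e u w) < 0 by rewrite pmulr_llt0// invr_gt0 mulr_gt0.
lra.
Qed.

(* [S u] is the expected future excess of reward over prevailing charge; it
   vanishes whenever the index is at its running minimum. *)
Lemma arm_martingale : exists S : nat -> Omega -> R, [/\ forall u, Gmeas (F u) (S u),
  forall u, L1 (S u) /\ forall w, 0 <= S u w,
  forall u w, g u w = gam u w -> S u w = 0,
  forall u C, F u C -> Ex (fun w => \1_C w * S u w) =
    Ex (fun w => \1_C w * (dsc q W u w * (X u w - g u w) + S u.+1 w)) &
  (fun n => Ex (S n)) @ \oo --> 0].
Proof.
have [M HM] := alM.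
have [U [GU LU Urec Umart Ucvg]] := @snell_ex _ _ _ P F sF (arm_FS arm) al rec M Gal Lal HM
  Frec rec_le0 rec_attained.
set c := cdisc P q W; have c0 : 0 < c by exact: cdisc_gt0 q0 arm.
have k0 : 0 <= c / q by rewrite divr_ge0// ltW.
(* [U] is the envelope for the weights [edisc]. By [Ex_swap] the excess weighted by [dsc] has, on
   events of [F u], [c / q] times the mean of [al u]. *)
exists (fun u w => c / q * U u w); split.
- by move=> u; apply: GmM => //; exact: Gm_cst.
- by move=> u; have [L U0] := LU u; split=> [|w]; [exact: L1Z|exact: mulr_ge0].
- by move=> u w h; rewrite Urec// mulr0.
- move=> u C FC; have mC := sFm FC; have [LUu _] := LU u; have [LUS _] := LU u.+1.
  have dE w : dsc q W u w * (X u w - g u w) = q^-1 * (al u w * bdisc q W u w).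
    by rewrite (dscE q0 arm) /al; ring.
  have Lab : L1 (fun w => al u w * bdisc q W u w).
    apply: (@L1_le _ _ _ P _ (fun w => `|al u w|)); last 2 first.
    - exact: L1_abs.
    - move=> w; rewrite normrM ler_piMr// ger0_norm ?(bdisc_le1 q W)//.
      exact/ltW/(bdisc_gt0 q0 arm).
    apply: measurable_funM; first exact: mF (Gal u).
    exact: mbdisc arm u.
  have LC : L1 (fun w => \1_C w * al u w) by exact: L1_ind.
  have sw : Ex (fun w => \1_C w * (al u w * bdisc q W u w)) = c * Ex (fun w => \1_C w * al u w).
    rewrite -(Ex_swap q0 arm (u := u)) => [|//|//]; first by apply: eq_Ex => w; ring.
    by apply: GmM => //; exact: Gm_ind.
  transitivity (c / q * Ex (fun w => \1_C w * U u w)).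
    by rewrite -ExZ; [apply: eq_Ex => w; ring|exact: L1_ind].
  rewrite Umart//.
  transitivity (q^-1 * Ex (fun w => \1_C w * (al u w * bdisc q W u w)) +
      c / q * Ex (fun w => \1_C w * U u.+1 w)).
    rewrite sw; have -> : Ex (fun w => \1_C w * (al u w + U u.+1 w)) =
        Ex (fun w => \1_C w * al u w) + Ex (fun w => \1_C w * U u.+1 w).
      by rewrite -ExD; [apply: eq_Ex => w; ring|exact: L1_ind|exact: L1_ind].
    ring.
  rewrite -!ExZ; [|exact: L1_ind|exact: L1_ind].
  rewrite -ExD; [|by apply: L1Z; exact: L1_ind|by apply: L1Z; exact: L1_ind].
  by apply: eq_Ex => w; rewrite dE; ring.
- have -> : (fun n => Ex (fun w => c / q * U n w)) = (fun n => c / q * Ex (U n)).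
    by apply/funext => n; rewrite ExZ//; case: (LU n).
  by rewrite -[X in _ --> X](mulr0 (c / q)); apply: cvgM => //; exact: cvg_cst.
Qed.

Lemma L1_dsc (z : nat -> Omega -> R) : (forall u, L1 (fun w => z u w * e u w)) ->
  (exists M, forall n, \sum_(u < n) Ex (fun w => `|z u w * e u w|) <= M) ->
  (forall u, measurable_fun setT (z u)) ->
  (forall u, L1 (fun w => `|z u w| * dsc q W u w)) /\
  exists M, forall n, \sum_(u < n) Ex (fun w => `|z u w| * dsc q W u w) <= M.
Proof.
move=> Lz [M HM] mz.
have le u w : `|z u w| * dsc q W u w <= q^-1 * `|z u w * e u w|.
  rewrite (dscE q0 arm) normrM (ger0_norm (e_ge0 _ _)) mulrA [leRHS]mulrC ler_pM2r ?invr_gt0//.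
  by rewrite mulrA ler_piMr ?(bdisc_le1 q W)// mulr_ge0.
have md u : measurable_fun setT (dsc q W u).
  have -> : dsc q W u = fun w => e u w * bdisc q W u w * q^-1.
    by apply/funext => w; rewrite (dscE q0 arm).
  apply: measurable_funM => //; apply: measurable_funM; first exact: mF (Ge u).
  exact: mbdisc arm u.
have Lzd u : L1 (fun w => `|z u w| * dsc q W u w).
  apply: (@L1_le _ _ _ P _ _ _ (L1Z q^-1 (L1_abs (Lz u)))) => [|w].
    by apply: measurable_funM => //; exact: measurableT_comp.
  by rewrite ger0_norm// mulr_ge0// (dsc_ge0 q0 arm).
split=> //; exists (q^-1 * M) => n.
apply: (@le_trans _ _ (\sum_(u < n) q^-1 * Ex (fun w => `|z u w * e u w|))).
  apply: ler_sum => u _; rewrite -ExZ; last exact: L1_abs.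
  by apply: Ex_le => //; apply: L1Z; exact: L1_abs.
by rewrite -mulr_sumr ler_pM2l ?invr_gt0.
Qed.

End arm_martingale.

Section finite_operations.
Context {d : measure_display} {Omega : measurableType d} (G : set (set Omega)) (J : nat).
Hypothesis sG : sigma_algebra setT G.

Lemma Gbigcap_ord (B : 'I_J -> set Omega) : (forall k, G (B k)) -> G (\bigcap_k B k).
Proof.
move=> GB; pose B' n := if insub n is Some k then B k else setT.
have -> : \bigcap_k B k = \bigcap_n B' n.
  apply/seteqP; split=> w h.
    by move=> n _; rewrite /B'; case: insubP => [k _ _|_] //; exact: h.
  by move=> k _; have := h k I; rewrite /B' valK.
by apply: Gbigcap => // n; rewrite /B'; case: insubP => [k _ _|_] //; exact: GsetT.
Qed.

Lemma Gbigcup_ord (D : pred 'I_J) (B : 'I_J -> set Omega) : (forall k, D k -> G (B k)) ->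
  G [set w | exists2 k, D k & B k w].
Proof.
move=> GB; have := @Gbigcap_ord (fun k => if D k then ~` B k else setT).
have -> : [set w | exists2 k, D k & B k w] = ~` \bigcap_k (if D k then ~` B k else setT).
  apply/seteqP; split=> w /=.
    by move=> [k Dk Bk] /(_ k I); rewrite Dk; apply.
  rewrite -existsNP => -[k /not_implyP[_]]; case: ifP => [Dk /contrapT Bk|_]; last by move/(_ I).
  by exists k.
move=> h; apply: GsetC => //; apply: h => k.
by case: ifPn => [Dk|_]; [apply: GsetC => //; exact: GB|exact: GsetT].
Qed.

End finite_operations.

(** * Strategies and information *)

Section other_arms.
Context {R : realType} {d : measure_display} {Omega : measurableType d}.
Variables (P : probability Omega R) (J : nat) (F : 'I_J -> nat -> set (set Omega)).
Notation L1 := (L1 P).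
Notation Ex := (Ex P).
Hypothesis sF : forall j s, sub_sigma (F j s).
Hypothesis Fle : forall j u v, (u <= v)%N -> F j u `<=` F j v.
Hypothesis Hindep : indep_sigmas P (fun j => Finf (F j)).

Lemma sub_Finf j s : F j s `<=` Finf (F j).
Proof. by move=> A FA; apply: sub_sigma_algebra; exists s. Qed.

Lemma sub_sigma_Finf j : sub_sigma (Finf (F j)).
Proof.
split; first exact: smallest_sigma_algebra.
apply: smallest_sub; first by case: (@sub_sigma_measurable _ Omega).
by move=> A [s _ FA]; case: (sF j s) => _; exact.
Qed.

(* The information from arm [j] after [s] operations and from the whole history
   of all the other arms. *)
Definition slice j s k := if k == j then F j s else Finf (F k).
Definition joint j s := <<s \bigcup_k slice j s k >>.

Lemma slice_sub j s k : slice j s k `<=` Finf (F k).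
Proof. by rewrite /slice; case: eqP => [->|_] //; exact: sub_Finf. Qed.

Lemma sub_sigma_slice j s k : sub_sigma (slice j s k).
Proof. by rewrite /slice; case: eqP => [_|_]; [exact: sF|exact: sub_sigma_Finf]. Qed.

Lemma sub_sigma_joint j s : sub_sigma (joint j s).
Proof.
split; first exact: smallest_sigma_algebra.
apply: smallest_sub; first by case: (@sub_sigma_measurable _ Omega).
by move=> A [k _ GA]; case: (sub_sigma_slice j s k) => _; exact.
Qed.

Lemma joinF_sub_joint j s (r : 'I_J -> nat) : (r j <= s)%N -> joinF F r `<=` joint j s.
Proof.
move=> rs; apply: smallest_sub; first exact: smallest_sigma_algebra.
move=> A [k _ FA]; apply: sub_sigma_algebra; exists k => //.
rewrite /slice; case: eqP => [kj|_]; last exact: sub_Finf FA.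
by apply: Fle rs _ _; rewrite -kj.
Qed.

Lemma joint_le j u v : (u <= v)%N -> joint j u `<=` joint j v.
Proof.
move=> uv; apply: smallest_sub; first exact: smallest_sigma_algebra.
move=> A [k _ FA]; apply: sub_sigma_algebra; exists k => //.
by move: FA; rewrite /slice; case: eqP => // _; exact: Fle.
Qed.

(** A family closed under intersection that generates [joint j s]. *)
Definition boxes j s : set (set Omega) :=
  [set C | exists2 B : 'I_J -> set Omega, (forall k, slice j s k (B k)) & C = \bigcap_k B k].

Lemma bigcap_bool (B : 'I_J -> set Omega) j :
  \bigcap_k B k = B j `&` \bigcap_k (if k == j then setT else B k).
Proof.
apply/seteqP; split=> w.
  move=> h; split; first exact: h.
  by move=> k _; case: eqP => // _; exact: h.
by move=> [Bj h] k _; have := h k I; case: eqP => [->|].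
Qed.

Lemma indep_box j (B : 'I_J -> set Omega) A : (forall k, Finf (F k) (B k)) ->
  Finf (F j) A ->
  let C := \bigcap_k (if k == j then setT else B k) in
  P (A `&` C) = (P A * P C)%E.
Proof.
move=> FB FA C; have FT k : Finf (F k) setT by apply: GsetT; case: (sub_sigma_Finf k).
have -> : A `&` C = \bigcap_k (if k == j then A else B k).
  rewrite [RHS](bigcap_bool _ j) eqxx; congr (_ `&` _).
  by apply: eq_bigcapr => k _; case: eqP.
rewrite Hindep; last by move=> k; case: eqP => [->|].
rewrite /C Hindep; last by move=> k; case: eqP.
rewrite (bigD1 j)//= eqxx [in RHS](bigD1 j)//= eqxx probability_setT mul1e; congr (_ * _)%E.
by apply: eq_bigr => k kj; rewrite (negbTE kj).
Qed.

(** Conditioning on the other arms does not affect a zero mean given [F j s]. On a box, the factor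
    from the other arms is independent of the whole history of arm [j] and can be replaced by its
    probability; the events with the property form a lambda-system, so it passes from boxes to
    [joint j s]. *)
Lemma Ex_joint j s (Y : Omega -> R) : Gmeas (Finf (F j)) Y -> L1 Y ->
  (forall C, F j s C -> Ex (fun w => \1_C w * Y w) = 0) ->
  forall C, joint j s C -> Ex (fun w => \1_C w * Y w) = 0.
Proof.
move=> GY LY H; have mFinf k A : Finf (F k) A -> measurable A.
  by case: (sub_sigma_Finf k) => _; exact.
pose L : set (set Omega) := [set C | measurable C /\ Ex (fun w => \1_C w * Y w) = 0].
have boxL : boxes j s `<=` L.
  move=> _ [B sB ->]; have FB k : Finf (F k) (B k) by exact: slice_sub (sB k).
  have mB : measurable (\bigcap_k B k).
    apply: Gbigcap_ord; first by case: (@sub_sigma_measurable _ Omega).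
    by move=> k; exact: mFinf (FB k).
  split=> //; pose C := \bigcap_k (if k == j then setT else B k).
  have mC : measurable C.
    apply: Gbigcap_ord; first by case: (@sub_sigma_measurable _ Omega).
    by move=> k; case: eqP => _ //; exact: mFinf (FB k).
  have Bj : F j s (B j) by have := sB j; rewrite /slice eqxx.
  have mBj : measurable (B j) := mFinf _ _ (FB j).
  have LBY : L1 (fun w => \1_(B j) w * Y w) by exact: L1_ind.
  have L1C (A : set Omega) : measurable A -> L1 (\1_A : Omega -> R).
    move=> mA; apply: (@L1_le _ _ _ _ _ (cst 1)); [exact: measurable_indic|exact: L1_cst|].
    by move=> w; exact: norm_indic.
  have LY' : L1 (fun w => \1_C w - fine (P C)) by apply: L1B; [exact: L1C|exact: L1_cst].
  (* The indicator of the other arms' event [C] is split into its centred part, killed by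
     independence, and the constant [P C], which leaves an integral over [B j] that vanishes by
     [H]. *)
  rewrite (eq_Ex _ (g := fun w => (\1_(B j) w * Y w) * (\1_C w - fine (P C)) +
    fine (P C) * (\1_(B j) w * Y w))); last first.
    by move=> w; rewrite (bigcap_bool B j) indicI/=; ring.
  have LL : L1 (fun w => (\1_(B j) w * Y w) * (\1_C w - fine (P C))).
    apply: eq_L1 (L1B (L1_ind mC LBY) (L1Z (fine (P C)) LBY)) => w; ring.
  rewrite ExD//; last exact: L1Z.
  rewrite ExZ// H// mulr0 addr0.
  apply: (Ex_pull (sub_sigma_Finf j)) => //.
    have [sa _] := sub_sigma_Finf j; apply: GmM => //; exact: Gm_ind.
  move=> A FA; have mA := mFinf _ _ FA.
  rewrite (eq_Ex _ (g := fun w => \1_(A `&` C) w - fine (P C) * \1_A w)); last first.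
    by move=> w; rewrite indicI/=; ring.
  have mAC : measurable (A `&` C) by exact: measurableI.
  rewrite ExB; [|exact: L1C|exact/L1Z/L1C].
  rewrite ExZ; last exact: L1C.
  rewrite !Ex_indic// /C (indep_box FB FA) fineM ?(fin_num_measure P)//.
  by rewrite mulrC subrr.
have boxI : setI_closed (boxes j s).
  move=> _ _ [B sB ->] [B' sB' ->]; exists (fun k => B k `&` B' k).
    by move=> k; have [sa _] := sub_sigma_slice j s k; exact: GsetI.
  by rewrite bigcapI.
have lamL : lambda_system setT L.
  split=> //.
  - apply: (boxL setT); exists (fun=> setT); last by rewrite bigcapT.
    by move=> k; apply: GsetT; case: (sub_sigma_slice j s k).
  - move=> A B BA [mA EA] [mB EB]; split; first exact: measurableD.
    rewrite (eq_Ex _ (g := fun w => \1_A w * Y w - \1_B w * Y w)).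
      by rewrite ExB ?EA ?EB ?subrr//; exact: L1_ind.
    move=> w; rewrite -mulrBl; congr (_ * _).
    have [Bw|Bw] := pselect (B w).
      by rewrite (indicP1 Bw) (indicP1 (BA _ Bw)) subrr indicP0// => -[].
    have [Aw|Aw] := pselect (A w).
      by rewrite (indicP1 Aw) (indicP0 Bw) subr0 indicP1.
    by rewrite (indicP0 Aw) (indicP0 Bw) subr0 indicP0// => -[].
  - move=> A ndA LA; have mU : measurable (\bigcup_n A n).
      by apply: bigcupT_measurable => n; case: (LA n).
    split=> //.
    have cv : Ex (fun w => \1_(A n) w * Y w) @[n --> \oo] --> Ex (fun w => \1_(\bigcup_n A n) w * Y w).
      apply: (fun h1 h2 h3 h4 h5 => proj2 (@Ex_dct _ _ _ P
        (fun n w => \1_(A n) w * Y w) _ (fun w => `|Y w|) h1 h2 h3 h4 h5)).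
      + by move=> n; exact: (L1_meas (L1_ind (LA n).1 LY)).
      + exact: (L1_meas (L1_ind mU LY)).
      + exact: L1_abs.
      + apply: aeW => w; apply: cvgM; last exact: cvg_cst.
        have [[n _ Anw]|nU] := pselect ((\bigcup_n A n) w).
          apply: cvg_near_cst; exists n => // m /= nm.
          rewrite !indicP1//; first by exists n.
          by have /subsetPset := ndA _ _ nm; exact.
        apply: cvg_near_cst; apply: nearW => m.
        by rewrite !indicP0// => Am; apply: nU; exists m.
      + by apply: aeW => w n; rewrite normrM ler_piMl ?norm_indic.
    rewrite -(cvg_lim _ cv)//; under eq_fun do rewrite (LA _).2.
    exact: lim_cst.
have sub : <<s boxes j s >> `<=` L by exact: lambda_system_subset.
move=> C JC; apply: (sub C _).2; move: C JC.
apply: smallest_sub; first exact: smallest_sigma_algebra.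
move=> A [k _ sA]; apply: sub_sigma_algebra.
exists (fun i => if i == k then A else setT).
  move=> i; case: eqP => [->//|_]; apply: GsetT; by case: (sub_sigma_slice j s i).
by apply/seteqP; split=> [w Aw i _|w /(_ k I)]; [case: eqP|rewrite eqxx].
Qed.

End other_arms.

Section strategy.
Context {R : realType} {d : measure_display} {Omega : measurableType d}.
Variables (P : probability Omega R) (J : nat) (q : R).
Variables (F : 'I_J -> nat -> set (set Omega)) (X W : 'I_J -> nat -> Omega -> R).
Hypothesis q0 : 0 < q.
Hypothesis Harm : forall j, arm_model P (F j) (X j) (W j).
Notation L1 := (L1 P).
Notation Ex := (Ex P).

Let sF j s : sub_sigma (F j s). Proof. exact: (arm_sub_sigma (Harm j)). Qed.
Let Fle j u v : (u <= v)%N -> F j u `<=` F j v. Proof. exact: (arm_Fle (Harm j)). Qed.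
Notation joint := (joint F).
Let sJ j s : sub_sigma (joint j s). Proof. exact: sub_sigma_joint. Qed.
Let sJa j s : sigma_algebra setT (joint j s). Proof. by case: (sJ j s). Qed.

Variables (pi : nat -> Omega -> 'I_J -> nat) (a : nat -> Omega -> 'I_J).
Hypothesis Hpi : is_strategy F pi.
Hypothesis Ha : forall t w k, pi t.+1 w k = (pi t w k + (k == a t w))%N.

Notation T w := (fun k s => optime (W k) s w).
Notation path w := (fun t => pi t w).

Lemma strategy_path w : is_path (path w) (fun t => a t w).
Proof. by split; [case: Hpi => h _; exact: h|move=> t k; exact: Ha]. Qed.

Lemma sel_arm t w j : sel pi t w j = (j == a t w).
Proof.
by rewrite /sel Ha -[X in _ == X]addn1 eqn_add2l; case: (j == a t w).
Qed.

Lemma sum_sel t w (y : 'I_J -> R) : \sum_(j < J) (sel pi t w j)%:R * y j = y (a t w).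
Proof.
rewrite (bigD1 (a t w))//= sel_arm eqxx mul1r big1 ?addr0// => j ja.
by rewrite sel_arm (negbTE ja) mul0r.
Qed.

Lemma strategy_le t w k : (pi t w k <= t)%N.
Proof. by have [_ [h _]] := Hpi; rewrite -[X in (_ <= X)%N](h t w) (bigD1 k)//= leq_addr. Qed.

Lemma optime0 k w : T w k 0%N = 0.
Proof. by rewrite /optime big_ord0. Qed.

Lemma optime_leS k s w : T w k s <= T w k s.+1.
Proof. by rewrite /= optimeS lerDl ltW// (arm_W0 (Harm k)). Qed.

Lemma caltimeE t w : caltime W pi t w = clock (T w) (path w) t.
Proof.
elim: t => [|t IH].
  by rewrite (@clock0 R J (T w) (fun k => optime0 k w) (path w) (fun t => a t w) (strategy_path w)) /caltime big_ord0.
rewrite (clockS (T w) t (strategy_path w)) /caltime big_ord_recr/= -/(caltime W pi t w) IH.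
by rewrite sum_sel optimeS; ring.
Qed.

Lemma disc_slot t w : disc q (caltime W pi t w) (caltime W pi t.+1 w) =
  slot q (T w) (path w) t.
Proof.
rewrite !caltimeE discE//; first by rewrite /slot /ddisc mulrBl.
rewrite (clockS (T w) t (strategy_path w)) ltrDl subr_gt0 optimeS ltrDl.
exact: arm_W0 (Harm _) _ _.
Qed.

Definition lag t j w := expR (- (q * \sum_(k < J | k != j) T w k (pi t w k))).

Lemma lag_ge0 t j w : 0 <= lag t j w. Proof. exact: expR_ge0. Qed.

Let T0 k s w : 0 <= T w k s.
Proof.
rewrite -(optime0 k w).
exact: (@T_le R J (T w) (fun k s => optime_leS k s w) k 0 s (leq0n s)).
Qed.

Lemma lag_le1 t j w : lag t j w <= 1.
Proof.
by rewrite -expR0 ler_expR oppr_le0 mulr_ge0 ?(ltW q0)// sumr_ge0.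
Qed.

Lemma lag_clock t j w : lag t j w * edisc q (W j) (pi t w j) w =
  expR (- (q * clock (T w) (path w) t)).
Proof.
by rewrite /lag /edisc -expRD /clock [in RHS](bigD1 j)//=; congr expR; ring.
Qed.

Lemma lag_self t w : lag t.+1 (a t w) w = lag t (a t w) w.
Proof.
rewrite /lag; congr (expR (- (q * _))); apply: eq_bigr => k ka.
by rewrite Ha (negbTE ka) addn0.
Qed.

Lemma lag_leS t j w : lag t.+1 j w <= lag t j w.
Proof.
rewrite ler_expR lerN2 ler_pM2l//; apply: ler_sum => k _.
apply: (@T_le R J (T w) (fun k s => optime_leS k s w)).
by rewrite Ha leq_addr.
Qed.

Lemma lag_slot t w : lag t (a t w) w * dsc q (W (a t w)) (pi t w (a t w)) w =
  slot q (T w) (path w) t.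
Proof.
have E : edisc q (W (a t w)) (pi t w (a t w)) w * bdisc q (W (a t w)) (pi t w (a t w)) w =
    edisc q (W (a t w)) (pi t w (a t w)) w - edisc q (W (a t w)) (pi t.+1 w (a t w)) w.
  by rewrite Ha eqxx addn1 ediscS; ring.
rewrite (dscE q0 (Harm _)) E /slot /ddisc -!(lag_clock _ (a t w)) lag_self; ring.
Qed.

(** By time [t] the strategy can be in finitely many states [r] only. On each of them with
    [r j = s], [lag] is a function of the histories of the other arms, all of which [joint j s]
    contains. *)
Lemma weight_F D t j s :
  (forall r, r j = s -> joint j s ([set w | pi t w = r] `&` D)) ->
  Gmeas (joint j s) (fun w => \1_(D `&` [set w | pi t w j = s]) w * lag t j w).
Proof.
move=> HD; pose f (r : {ffun 'I_J -> 'I_t.+1}) w :=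
  \1_([set w | pi t w = (fun k => nat_of_ord (r k))] `&` D) w *
  expR (- (q * \sum_(k < J | k != j) T w k (r k))).
have -> : (fun w => \1_(D `&` [set w | pi t w j = s]) w * lag t j w) =
    fun w => \sum_(r : {ffun 'I_J -> 'I_t.+1} | r j == s :> nat) f r w.
  apply/funext => w; have [js|js] := eqVneq (pi t w j) s; last first.
    rewrite indicP0 ?mul0r; last by move=> [_ /= /eqP]; apply/negP.
    rewrite big1// => r /eqP rj; rewrite /f indicP0 ?mul0r// => -[/= pr _].
    by move: js; rewrite pr rj eqxx.
  pose r0 : {ffun 'I_J -> 'I_t.+1} := [ffun k => inord (pi t w k)].
  have r0E k : r0 k = pi t w k :> nat by rewrite ffunE inordK// ltnS strategy_le.
  have pr0 : pi t w = (fun k => nat_of_ord (r0 k)) by apply/funext => k; rewrite r0E.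
  rewrite (bigD1 r0)/=; last by rewrite r0E js.
  rewrite big1 ?addr0 => [|r /andP[_ rr0]]; last first.
    rewrite /f indicP0 ?mul0r// => -[/= pr _]; move/eqP: rr0; apply.
    by apply/ffunP => k; apply/val_inj; rewrite /= r0E pr.
  rewrite /f /lag; have -> : \sum_(k < J | k != j) T w k (r0 k) =
      \sum_(k < J | k != j) T w k (pi t w k) by apply: eq_bigr => k _; rewrite r0E.
  congr (_ * _); have [Dw|Dw] := pselect (D w); last by rewrite !indicP0// => -[].
  by rewrite !indicP1.
apply: Gm_sum => // r /eqP rj; apply: (GmM (sJa j s)).
  by apply: Gm_ind => //; exact: HD.
apply: (@Gm_comp _ _ _ _ _ _ _ (fun x : R => expR (- (q * x)))); first exact: measurable_expNq.
apply: (Gm_sum (sJa j s)) => k kj; apply: Gmeas_sub (arm_FT (Harm k) (r k)).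
move=> A FA; apply: sub_sigma_algebra; exists k => //.
by rewrite /slice (negbTE kj); exact: sub_Finf FA.
Qed.

Lemma state_F t j s r : r j = s -> joint j s [set w | pi t w = r].
Proof.
move=> rj; apply: (joinF_sub_joint Fle (r := r)); first by rewrite rj.
by case: Hpi => _ [_ [_ h]]; exact: h.
Qed.

(* A strategy is only required to have [{pi (t+1) = r}] in [F_r], so the choice
   of arm [j] might a priori depend on its next reward.  Choosing another arm [k]
   is an event of [F_(r + e_k)], contained in [joint j (r j)]; choosing [j] is the
   complement of these events. *)
Lemma choice_F t j s r : r j = s ->
  joint j s ([set w | pi t w = r] `&` [set w | a t w = j]).
Proof.
move=> rj; have Fr := state_F t rj.
have -> : [set w | pi t w = r] `&` [set w | a t w = j] = [set w | pi t w = r] `\`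
    [set w | exists2 k, k != j & ([set w | pi t w = r] `&` [set w | a t w = k]) w].
  apply/seteqP; split=> w /=.
    by move=> [h1 h2]; split=> // -[k kj [_ h3]]; rewrite -h2 h3 eqxx in kj.
  move=> [h1 h2]; split=> //; apply: contrapT => h3; apply: h2.
  by exists (a t w) => //; exact/eqP.
apply: (GsetD (sJa j s)) => //; apply: (Gbigcup_ord (sJa j s)) => k kj.
have -> : [set w | pi t w = r] `&` [set w | a t w = k] =
   [set w | pi t w = r] `&` [set w | pi t.+1 w = (fun i => (r i + (i == k))%N)].
  apply/seteqP; split=> w /= [h1 h2]; split=> //.
    by apply/funext => i; rewrite Ha h1 h2.
  have := congr1 (fun f => f (a t w)) h2; rewrite Ha h1 eqxx => /addnI.
  by case: eqP.
apply: (GsetI (sJa j s)) => //; apply: state_F.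
by rewrite eq_sym (negbTE kj) addn0.
Qed.

End strategy.

(** * The potential *)

Section potential.
Context {R : realType} {d : measure_display} {Omega : measurableType d}.
Variables (P : probability Omega R) (J : nat) (q : R).
Variables (F : 'I_J -> nat -> set (set Omega)) (X W : 'I_J -> nat -> Omega -> R).
Hypothesis q0 : 0 < q.
Hypothesis Harm : forall j, arm_model P (F j) (X j) (W j).
Hypothesis Hindep : indep_sigmas P (fun j => Finf (F j)).
Notation L1 := (L1 P).
Notation Ex := (Ex P).

Let sF j s : sub_sigma (F j s). Proof. exact: (arm_sub_sigma (Harm j)). Qed.
Let Fle j u v : (u <= v)%N -> F j u `<=` F j v. Proof. exact: (arm_Fle (Harm j)). Qed.
Notation joint := (joint F).
Let sJ j s : sub_sigma (joint j s). Proof. exact: sub_sigma_joint. Qed.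
Let sJa j s : sigma_algebra setT (joint j s). Proof. by case: (sJ j s). Qed.
Let mJ j s (f : Omega -> R) : Gmeas (joint j s) f -> measurable_fun setT f.
Proof. by apply: Gmeas_mf; case: (sJ j s). Qed.

Variables (pi : nat -> Omega -> 'I_J -> nat) (a : nat -> Omega -> 'I_J).
Hypothesis Hpi : is_strategy F pi.
Hypothesis Ha : forall t w k, pi t.+1 w k = (pi t w k + (k == a t w))%N.
Notation lag := (lag q W pi).

Variables (S al : 'I_J -> nat -> Omega -> R).
Hypothesis GS : forall j s, Gmeas (F j s) (S j s).
Hypothesis LS : forall j s, L1 (S j s).
Hypothesis S0 : forall j s w, 0 <= S j s w.
Hypothesis Gal : forall j s, Gmeas (F j s.+1) (al j s).
Hypothesis Lal : forall j s, L1 (al j s).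
Hypothesis mart : forall j s C, F j s C ->
  Ex (fun w => \1_C w * S j s w) = Ex (fun w => \1_C w * (al j s w + S j s.+1 w)).

(** [Ex_joint] lifts the martingale identity to [joint j s], after which the bounded factor [f] is
    pulled out. *)
Lemma joint_mart j s (f : Omega -> R) : Gmeas (joint j s) f -> (forall w, 0 <= f w <= 1) ->
  Ex (fun w => f w * S j s w) = Ex (fun w => f w * al j s w) + Ex (fun w => f w * S j s.+1 w).
Proof.
move=> Gf f01; have mf := mJ Gf.
have nf w : `|f w| <= 1 by case/andP: (f01 w) => h1 h2; rewrite ger0_norm.
have Lf (g : Omega -> R) : L1 g -> L1 (fun w => f w * g w) by exact: (@L1_mulb _ _ _ _ _ _ 1).
have GFinf k (g : Omega -> R) : Gmeas (F j k) g -> Gmeas (Finf (F j)) g.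
  exact: Gmeas_sub (sub_Finf (j := j) (s := k)).
have [sa _] := sub_sigma_Finf sF j.
have LY : L1 (fun w => S j s w - (al j s w + S j s.+1 w)) by apply: L1B => //; exact: L1D.
have := @Ex_pull _ _ _ P _ (sJ j s) f (fun w => S j s w - (al j s w + S j s.+1 w)) Gf LY (Lf _ LY).
rewrite (eq_Ex _ (g := fun w => f w * S j s w - (f w * al j s w + f w * S j s.+1 w))); last first.
  by move=> w; ring.
rewrite ExB ?ExD; last 4 first.
- exact: Lf.
- exact: Lf.
- exact: Lf.
- by apply: L1D; exact: Lf.
move=> h; apply/eqP; rewrite -subr_eq0; apply/eqP; apply: h.
apply: (Ex_joint sF Hindep) => //.
  apply: (GmB sa); first exact: GFinf (GS j s).
  by apply: (GmD sa); [exact: GFinf (Gal j s)|exact: GFinf (GS j s.+1)].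
move=> C FC; have mC : measurable C by case: (sF j s) => _; exact.
rewrite (eq_Ex _ (g := fun w => \1_C w * S j s w - \1_C w * (al j s w + S j s.+1 w))); last first.
  by move=> w; ring.
rewrite ExB ?mart ?subrr//; first exact: L1_ind.
by apply: L1_ind => //; exact: L1D.
Qed.

Variable A : set Omega.
Hypothesis FA : joinF F (fun=> 0%N) A.

Let AJ j s : joint j s A. Proof. exact: (joinF_sub_joint Fle _ FA). Qed.

(** The coefficient of [S j s] at time [t]. Splitting by the number [s] of operations replaces the
    random stage [pi t w j] by deterministic ones, for which the martingale identity is
    available. *)
Definition weight D t j s w := \1_(D `&` [set w | pi t w j = s]) w * lag t j w.

Let E t j : set Omega := A `&` [set w | a t w = j].

Lemma weight01 D t j s w : 0 <= weight D t j s w <= 1.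
Proof.
rewrite /weight; have /andP[i0 i1] := @indic01 R _ _ (D `&` [set w | pi t w j = s]) w.
have l0 := lag_ge0 q W pi t j w; have l1 := lag_le1 q0 Harm pi t j w.
by rewrite mulr_ge0//= mulr_ile1.
Qed.

Lemma weightA_F t j s : Gmeas (joint j s) (weight A t j s).
Proof.
apply: (weight_F q Harm Hpi) => r rj; apply: (GsetI (sJa j s)) => //.
exact: (state_F Harm Hpi t rj).
Qed.

Lemma weightE_F t j s : Gmeas (joint j s) (weight (E t j) t j s).
Proof.
apply: (weight_F q Harm Hpi) => r rj; rewrite /E setICA; apply: (GsetI (sJa j s)) => //.
exact: (choice_F Harm Hpi Ha t rj).
Qed.

Lemma sum_weight D t j w (y : nat -> R) :
  \sum_(s < t.+1) weight D t j s w * y s = \1_D w * (lag t j w * y (pi t w j)).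
Proof.
have le : (pi t w j < t.+1)%N by rewrite ltnS (strategy_le Hpi).
rewrite (bigD1 (Ordinal le))//= big1 ?addr0 => [|s sj]; last first.
  rewrite /weight indicP0 ?mul0r// => -[_ /= h]; move/eqP: sj; apply.
  by apply/val_inj; rewrite /= h.
rewrite /weight -mulrA; congr (_ * _).
have [Dw|Dw] := pselect (D w); first by rewrite !indicP1.
by rewrite !indicP0// => -[].
Qed.

Lemma sum_weightE t w (y : 'I_J -> nat -> R) :
  \sum_j \sum_(s < t.+1) weight (E t j) t j s w * y j s =
  \1_A w * (lag t (a t w) w * y (a t w) (pi t w (a t w))).
Proof.
under eq_bigr do rewrite sum_weight.
rewrite (bigD1 (a t w))//= big1 ?addr0 => [|j ja]; last first.
  by rewrite indicP0 ?mul0r// => -[_ /= h]; move: ja; rewrite h eqxx.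
congr (_ * _); have [Aw|Aw] := pselect (A w); first by rewrite !indicP1.
by rewrite !indicP0// => -[].
Qed.

Definition potential t w := \sum_j lag t j w * S j (pi t w j) w.

Let potE t w : \1_A w * potential t w = \sum_j \sum_(s < t.+1) weight A t j s w * S j s w.
Proof. by rewrite mulr_sumr; apply: eq_bigr => j _; rewrite (sum_weight _ _ _ _ (fun s => S j s w)). Qed.

Let Lw (D : 'I_J -> set Omega) t j s (g : Omega -> R) : (forall j s, Gmeas (joint j s) (weight (D j) t j s)) -> L1 g ->
  L1 (fun w => weight (D j) t j s w * g w).
Proof.
move=> GD Lg; apply: (@L1_mulb _ _ _ _ _ _ 1) => //; first exact: mJ (GD j s).
by move=> w; have /andP[h1 h2] := weight01 (D j) t j s w; rewrite ger0_norm.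
Qed.

Let Lpot t : L1 (fun w => \1_A w * potential t w).
Proof.
apply: (eq_L1 (fun w => esym (potE t w))); apply: L1_sum => j _; apply: L1_sum => s _.
exact: (@Lw (fun=> A) t j s (S j s) (weightA_F t)).
Qed.

Let LwE t (y : 'I_J -> nat -> Omega -> R) : (forall j s, L1 (y j s)) ->
  L1 (fun w => \sum_j \sum_(s < t.+1) weight (E t j) t j s w * y j s w).
Proof.
move=> Ly; apply: L1_sum => j _; apply: L1_sum => s _.
exact: (@Lw (E t) t j s (y j s) (weightE_F t)).
Qed.

Let ExwE t (y : 'I_J -> nat -> Omega -> R) : (forall j s, L1 (y j s)) ->
  Ex (fun w => \sum_j \sum_(s < t.+1) weight (E t j) t j s w * y j s w) =
  \sum_j \sum_(s < t.+1) Ex (fun w => weight (E t j) t j s w * y j s w).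
Proof.
move=> Ly; rewrite Ex_sum => [|j _]; last first.
  by apply: L1_sum => s _; exact: (@Lw (E t) t j s (y j s) (weightE_F t)).
apply: eq_bigr => j _; rewrite Ex_sum// => s _.
exact: (@Lw (E t) t j s (y j s) (weightE_F t)).
Qed.

Let excess t w := lag t (a t w) w * al (a t w) (pi t w (a t w)) w.

Let L_excess t : L1 (fun w => \1_A w * excess t w).
Proof.
apply: eq_L1 (LwE t Lal) => w.
by rewrite (sum_weightE t w (fun j s => al j s w)).
Qed.

(** Both the state and the choice of arm [j] are known in [joint j s], so [joint_mart] applies to
    the weight on the event that [j] is operated. *)
Let potential_move t : Ex (fun w => \sum_j \sum_(s < t.+1) weight (E t j) t j s w *
   (S j s.+1 w - S j s w)) = - Ex (fun w => \1_A w * excess t w).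
Proof.
rewrite (eq_Ex _ (f := fun w => \1_A w * excess t w)
   (g := fun w => \sum_j \sum_(s < t.+1) weight (E t j) t j s w * al j s w)); last first.
  by move=> w; rewrite (sum_weightE t w (fun j s => al j s w)).
rewrite (@ExwE t (fun j s w => S j s.+1 w - S j s w)); last by move=> j s; exact: L1B.
rewrite ExwE// -sumrN; apply: eq_bigr => j _; rewrite -sumrN; apply: eq_bigr => s _.
rewrite (eq_Ex _ (g := fun w => weight (E t j) t j s w * S j s.+1 w -
  weight (E t j) t j s w * S j s w)); last by move=> w; ring.
rewrite ExB; [|exact: (@Lw (E t) t j s _ (weightE_F t))|exact: (@Lw (E t) t j s _ (weightE_F t))].
rewrite (joint_mart (@weightE_F t j s) (weight01 (E t j) t j s)).
ring.
Qed.

(** The operated arm advances under an unchanged [lag]; the arms at rest keep their stage while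
    their [lag] shrinks. *)
Let potentialS t w : potential t.+1 w = potential t w +
  lag t (a t w) w * (S (a t w) (pi t w (a t w)).+1 w - S (a t w) (pi t w (a t w)) w) +
  \sum_(j | j != a t w) (lag t.+1 j w - lag t j w) * S j (pi t w j) w.
Proof.
rewrite /potential (bigD1 (a t w))//= [in RHS](bigD1 (a t w))//= (lag_self q W Ha) Ha eqxx addn1.
rewrite (eq_bigr (fun j => lag t.+1 j w * S j (pi t w j) w)); last first.
  by move=> j ja; rewrite Ha (negbTE ja) addn0.
rewrite (eq_bigr (fun j => lag t j w * S j (pi t w j) w +
  (lag t.+1 j w - lag t j w) * S j (pi t w j) w)); last by move=> j _; ring.
by rewrite big_split/=; ring.
Qed.

Let moveE t w : \1_A w * (potential t w +
    lag t (a t w) w * (S (a t w) (pi t w (a t w)).+1 w - S (a t w) (pi t w (a t w)) w)) =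
  \1_A w * potential t w + \sum_j \sum_(s < t.+1) weight (E t j) t j s w *
   (S j s.+1 w - S j s w).
Proof. by rewrite (sum_weightE t w (fun j s => S j s.+1 w - S j s w)) mulrDr. Qed.

Let Lmove t : L1 (fun w => \sum_j \sum_(s < t.+1) weight (E t j) t j s w *
   (S j s.+1 w - S j s w)).
Proof.
exact: (@LwE t (fun j s w => S j s.+1 w - S j s w) (fun j s => L1B (LS j s.+1) (LS j s))).
Qed.

Let A0 w : 0 <= \1_A w :> R. Proof. by case/andP: (@indic01 R _ _ A w). Qed.

(** The shrinking of [lag] on the arms at rest lowers the potential because [S] is nonnegative; it
    costs nothing when their [S] vanishes, which is the case of equality below. *)
Lemma potential_le t : Ex (fun w => \1_A w * potential t.+1 w) <=
  Ex (fun w => \1_A w * potential t w) - Ex (fun w => \1_A w * excess t w).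
Proof.
rewrite -potential_move -ExD//; apply: Ex_le => //; first exact: L1D.
move=> w; rewrite -moveE ler_wpM2l// potentialS gerDl; apply: sumr_le0 => j _.
by rewrite mulr_le0_ge0// subr_le0 (lag_leS q0 Harm Ha).
Qed.

Lemma potential_eq t :
  {ae P, forall w, forall j, j != a t w -> S j (pi t w j) w = 0} ->
  Ex (fun w => \1_A w * potential t.+1 w) =
  Ex (fun w => \1_A w * potential t w) - Ex (fun w => \1_A w * excess t w).
Proof.
move=> h; rewrite -potential_move -ExD//; apply: eq_Ex_ae.
- exact: (L1_meas (Lpot t.+1)).
- exact: (L1_meas (L1D (Lpot t) (Lmove t))).
apply: ae_mono h _ => w h; rewrite -moveE potentialS big1 ?addr0// => j ja.
by rewrite h// mulr0.
Qed.

Lemma potential_sum_le n : \sum_(t < n) Ex (fun w => \1_A w * excess t w) <=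
  Ex (fun w => \1_A w * potential 0 w).
Proof.
suff : \sum_(t < n) Ex (fun w => \1_A w * excess t w) <=
  Ex (fun w => \1_A w * potential 0 w) - Ex (fun w => \1_A w * potential n w).
  move=> /le_trans; apply; rewrite gerBl; apply: Ex_ge0 => w; rewrite mulr_ge0//.
  by apply: sumr_ge0 => j _; rewrite mulr_ge0// lag_ge0.
elim: n => [|n IH]; first by rewrite big_ord0 subrr.
by rewrite big_ord_recr/=; have := potential_le n; lra.
Qed.

Lemma potential_sum_eq n :
  (forall t, {ae P, forall w, forall j, j != a t w -> S j (pi t w j) w = 0}) ->
  \sum_(t < n) Ex (fun w => \1_A w * excess t w) =
  Ex (fun w => \1_A w * potential 0 w) - Ex (fun w => \1_A w * potential n w).
Proof.
move=> h; elim: n => [|n IH]; first by rewrite big_ord0 subrr.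
by rewrite big_ord_recr/= IH (potential_eq (h n)); ring.
Qed.

End potential.

Lemma cvgn_sum0 {R : realType} (I : Type) (r : seq I) (f : I -> nat -> R) :
  (forall i, f i @ \oo --> 0) -> (\sum_(i <- r) f i n) @[n --> \oo] --> 0.
Proof.
move=> f0; elim: r => [|i r IH].
  by under eq_fun do rewrite big_nil; exact: cvg_cst.
under eq_fun do rewrite big_cons.
have cv : (f i n + \sum_(j <- r) f j n) @[n --> \oo] --> (0 : R) + 0.
  by apply: cvgD; [exact: f0|exact: IH].
by move: cv; rewrite (addr0 (0 : R)).
Qed.

(** * The index strategy *)

Section greedy_paths.
Context {R : realType} (J : nat).
Implicit Types (p : nat -> 'I_J -> nat) (a : nat -> 'I_J).

Lemma path_sum p a (y : 'I_J -> nat -> R) n : is_path p a ->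
  \sum_(t < n) y (a t) (p t (a t)) = \sum_j \sum_(s < p n j) y j s.
Proof.
move=> [p0 pS]; elim: n => [|n IH].
  by rewrite big_ord0 big1// => j _; rewrite p0 big_ord0.
rewrite big_ord_recr/= IH (bigD1 (a n))//= [in RHS](bigD1 (a n))//= pS eqxx addn1 big_ord_recr/=.
rewrite (eq_bigr (fun j => \sum_(s < p n.+1 j) y j s)); first by ring.
by move=> j ja; rewrite pS (negbTE ja) addn0.
Qed.

(* An arm whose index exceeds its running minimum is the last one operated and
   has the largest prevailing charge; it is therefore operated again. *)
Lemma greedy_charge p a (ga g : 'I_J -> nat -> R) : is_path p a ->
  (forall j, g j 0%N = ga j 0%N) -> (forall j s, g j s.+1 = Num.min (g j s) (ga j s.+1)) ->
  (forall t k, ga k (p t k) <= ga (a t) (p t (a t))) ->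
  forall t, (forall k, k != a t -> g k (p t k) = ga k (p t k)) /\
    forall k, g k (p t k) <= g (a t) (p t (a t)).
Proof.
move=> [p0 pS] g0 gS sel.
have gga j s : g j s <= ga j s by case: s => [|s]; rewrite ?g0// gS ge_min lexx orbT.
(* The invariant: an arm off its running minimum is the only one and carries the largest charge. Its
   index then strictly exceeds every other, so the greedy rule must select it. *)
pose I t := forall k, g k (p t k) = ga k (p t k) \/
  forall l, l != k -> g l (p t l) = ga l (p t l) /\ g l (p t l) <= g k (p t k).
have step t : I t -> (forall k, k != a t -> g k (p t k) = ga k (p t k)) /\
    forall k, g k (p t k) <= g (a t) (p t (a t)).
  move=> It; split=> [k ka|k].
    have [//|h] := It k; have [e1 e2] := h (a t) (contra_neq (@esym _ _ _) ka).
    apply/le_anti; rewrite gga/=; apply: le_trans e2; rewrite e1.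
    exact: sel.
  have [->//|ka] := eqVneq k (a t).
  have [e|h] := It (a t); last by have [] := h k ka.
  by rewrite e; apply: le_trans (sel t k).
have It t : I t.
  elim: t => [|t IH]; first by move=> k; left; rewrite p0.
  have [s1 s2] := step t IH => k.
  have unch l : l != a t -> p t.+1 l = p t l by move=> la; rewrite pS (negbTE la) addn0.
  have [->|ka] := eqVneq k (a t); last by left; rewrite unch// s1.
  rewrite pS eqxx addn1 gS.
  have [h|h] := leP (ga (a t) (p t (a t)).+1) (g (a t) (p t (a t))).
    by left.
  right=> l la; rewrite unch// s1//; split=> //.
  by rewrite -s1// s2.
by move=> t; exact: step.
Qed.

End greedy_paths.

(** * The potential vanishes in the long run *)

Section long_run.
Context {R : realType} {d : measure_display} {Omega : measurableType d}.
Variables (P : probability Omega R) (J : nat) (q : R).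
Variables (F : 'I_J -> nat -> set (set Omega)) (X W : 'I_J -> nat -> Omega -> R).
Hypothesis J0 : (0 < J)%N.
Hypothesis q0 : 0 < q.
Hypothesis Harm : forall j, arm_model P (F j) (X j) (W j).
Hypothesis Hindep : indep_sigmas P (fun j => Finf (F j)).
Notation L1 := (L1 P).
Notation Ex := (Ex P).

Let sF j s : sub_sigma (F j s). Proof. exact: (arm_sub_sigma (Harm j)). Qed.
Let Fle j u v : (u <= v)%N -> F j u `<=` F j v. Proof. exact: (arm_Fle (Harm j)). Qed.
Notation joint := (joint F).
Let sJ j s : sub_sigma (joint j s). Proof. exact: sub_sigma_joint. Qed.
Let mJ j s (f : Omega -> R) : Gmeas (joint j s) f -> measurable_fun setT f.
Proof. by apply: Gmeas_mf; case: (sJ j s). Qed.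

Variables (pi : nat -> Omega -> 'I_J -> nat) (a : nat -> Omega -> 'I_J).
Hypothesis Hpi : is_strategy F pi.
Hypothesis Ha : forall t w k, pi t.+1 w k = (pi t w k + (k == a t w))%N.
Notation lag := (lag q W pi).
Notation T w := (fun k s => optime (W k) s w).
Notation path w := (fun t => pi t w).
Notation clk n w := (expR (- (q * clock (T w) (path w) n))).

Lemma ae_ord (Q : 'I_J -> Omega -> Prop) : (forall j, {ae P, forall w, Q j w}) ->
  {ae P, forall w, forall j, Q j w}.
Proof.
move=> h; have := @ae_all _ _ _ P (fun n w => if insub n is Some j then Q j w else True).
move=> H; apply: ae_mono (H _) _ => [n|w hw j].
  by case: insubP => [j _ _|_]; [exact: h|exact: aeW].
by have := hw j; rewrite valK.
Qed.

Lemma clk_le_edisc n j w : clk n w <= edisc q (W j) (pi n w j) w.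
Proof.
rewrite -(lag_clock q W pi n j w) ler_piMl ?(lag_le1 q0 Harm)//.
exact/ltW/edisc_gt0.
Qed.

Lemma some_arm_often n N w : (N * J <= n)%N -> exists j, (N <= pi n w j)%N.
Proof.
case: N => [|N] h; first by exists (Ordinal J0).
apply: contrapT => no; have : (\sum_(j < J) pi n w j <= \sum_(j < J) N)%N.
  apply: leq_sum => j _; rewrite -ltnS ltnNge; apply/negP => lt; apply: no.
  by exists j.
have [_ [-> _]] := Hpi; rewrite sum_nat_const card_ord mulnC => /(leq_trans h).
by rewrite leq_pmul2r// ltnn.
Qed.

Lemma clk_cvg0 : {ae P, forall w, clk n w @[n --> \oo] --> 0}.
Proof.
have h : {ae P, forall w, forall j, edisc q (W j) n w @[n --> \oo] --> 0}.
  by apply: ae_ord => j; exact: (edisc_cvg0 q0 (Harm j)).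
apply: ae_mono h _ => w h.
(* Which arm is operated [N] times depends on the path; the sum over the arms dominates the discount
   of any of them. *)
have cs : (\sum_j edisc q (W j) n w) @[n --> \oo] --> 0.
  by apply: cvgn_sum0 => j; exact: h.
apply/cvgrPdist_le => eps eps0; move/cvgrPdist_le : cs => /(_ eps eps0)[N _ /(_ N (leqnn _))/=].
rewrite sub0r normrN ger0_norm; last by apply: sumr_ge0 => j _; exact/ltW/edisc_gt0.
move=> le; exists (N * J)%N => // n /= Nn; rewrite sub0r normrN ger0_norm ?expR_ge0//.
have [j Nj] := some_arm_often w Nn.
apply: le_trans le; apply: le_trans (clk_le_edisc n j w) _.
apply: (@le_trans _ _ (edisc q (W j) N w)); first exact: (edisc_le q0 (Harm j)).
by rewrite (bigD1 j)//= lerDl; apply: sumr_ge0 => k _; exact/ltW/edisc_gt0.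
Qed.

Variables (S al : 'I_J -> nat -> Omega -> R).
Hypothesis GS : forall j s, Gmeas (F j s) (S j s).
Hypothesis LS : forall j s, L1 (S j s).
Hypothesis S0 : forall j s w, 0 <= S j s w.
Hypothesis Gal : forall j s, Gmeas (F j s.+1) (al j s).
Hypothesis Lal : forall j s, L1 (al j s).
Hypothesis mart : forall j s C, F j s C ->
  Ex (fun w => \1_C w * S j s w) = Ex (fun w => \1_C w * (al j s w + S j s.+1 w)).
Hypothesis Scvg : forall j, (fun n => Ex (S j n)) @ \oo --> 0.
Hypothesis alM : forall j, exists M, forall n, \sum_(u < n) Ex (fun w => `|al j u w|) <= M.
Variable A : set Omega.
Hypothesis FA : joinF F (fun=> 0%N) A.

Let A0 w : 0 <= \1_A w :> R. Proof. by case/andP: (@indic01 R _ _ A w). Qed.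
Notation wt := (weight q W pi A).
Let GwA := (@weightA_F _ _ _ P J q F X W Harm pi Hpi A FA).
Let w01 := (@weight01 _ _ _ P J q F X W q0 Harm pi A).
Let w0 t j s w : 0 <= wt t j s w. Proof. by case/andP: (w01 t j s w). Qed.

Let Lw t j s (g : Omega -> R) : L1 g -> L1 (fun w => wt t j s w * g w).
Proof.
move=> Lg; apply: (@L1_mulb _ _ _ _ _ _ 1) => //; first exact: mJ (@GwA t j s).
by move=> w; have /andP[h1 h2] := w01 t j s w; rewrite ger0_norm.
Qed.

(** The martingale identity is iterated with the weight fixed at time [t], which stays measurable as
    the stage of arm [j] grows. *)
Let unroll t j s k : Ex (fun w => wt t j s w * S j s w) <=
  \sum_(v < s + k | (s <= v)%N) Ex (fun w => wt t j s w * `|al j v w|) +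
  Ex (fun w => wt t j s w * S j (s + k)%N w).
Proof.
elim: k => [|k IH].
  rewrite addn0 lerDr sumr_ge0// => v _; apply: Ex_ge0 => w.
  by rewrite mulr_ge0.
apply: (le_trans IH); rewrite addnS [X in _ <= X + _]big_mkcond [X in _ <= X + _]big_ord_recr.
rewrite -big_mkcond/= leq_addr -addrA lerD2l.
rewrite (@joint_mart _ _ _ P J F X W Harm Hindep S al GS LS Gal Lal mart j (s + k) (wt t j s)).
- rewrite lerD2r; apply: Ex_le; [exact: Lw|exact/Lw/L1_abs|move=> w].
  by rewrite ler_wpM2l// ler_norm.
- by apply: Gmeas_sub (@GwA t j s); apply: joint_le => //; exact: leq_addr.
- exact: w01.
Qed.

(** An arm that is abandoned keeps a fixed stage, so [Ex (S j n)] tending to 0 is not enough.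
    Unrolling bounds [S j s] in mean by the remaining absolute excess [tl j s]. Along a path
    [lag * tl] tends to 0: either the arm has been operated often and [tl] is small, or the time has
    gone to the other arms and [lag] is small. *)
Lemma potential_cvg0 : Ex (fun w => \1_A w * potential q W pi S n w) @[n --> \oo] --> 0.
Proof.
have hex j : exists h : Omega -> R, [/\ L1 h, forall w, 0 <= h w &
    {ae P, forall w, (fun n => \sum_(k < n) `|al j k w|) @ \oo --> h w /\
      forall n, \sum_(k < n) `|al j k w| <= h w}].
  have [M HM] := alM j.
  exact: (Ex_series (fun n => L1_abs (Lal j n)) (fun n w => normr_ge0 _) HM).
have [h Hh] := choice hex.
have Lh j : L1 (h j) by case: (Hh j).
have h0 j w : 0 <= h j w by case: (Hh j).
have Hhae : {ae P, forall w, forall j,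
    (fun n => \sum_(k < n) `|al j k w|) @ \oo --> h j w /\
    forall n, \sum_(k < n) `|al j k w| <= h j w}.
  by apply: ae_ord => j; case: (Hh j).
pose tl j s w := h j w - \sum_(v < s) `|al j v w|.
have Ltl j s : L1 (tl j s) by apply: L1B => //; apply: L1_sum => v _; exact: L1_abs.
pose B n j w := \1_A w * (lag n j w * tl j (pi n w j) w).
have BE n j w : B n j w = \sum_(s < n.+1) wt n j s w * tl j s w.
  by rewrite (sum_weight q W Hpi A n j w (fun s => tl j s w)).
have LB n j : L1 (B n j).
  by apply: (eq_L1 (fun w => esym (BE n j w))); apply: L1_sum => s _; exact: Lw.
have bound n : Ex (fun w => \1_A w * potential q W pi S n w) <= \sum_j Ex (B n j).
  (* With [n] fixed, the horizon [M] of the unrolling goes to infinity and the remainders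
     [Ex (S j M)] disappear. *)
  have key M : (n < M)%N -> Ex (fun w => \1_A w * potential q W pi S n w) <=
      \sum_j Ex (B n j) + \sum_j \sum_(s < n.+1) Ex (S j M).
    move=> nM; rewrite -big_split/=.
    rewrite (eq_Ex _ (g := fun w => \sum_j \sum_(s < n.+1) wt n j s w * S j s w)); last first.
      move=> w; rewrite /potential mulr_sumr; apply: eq_bigr => j _.
      by rewrite (sum_weight q W Hpi A n j w (fun s => S j s w)).
    rewrite Ex_sum => [|j _]; last by apply: L1_sum => s _; exact: Lw.
    apply: ler_sum => j _; rewrite (eq_Ex _ (BE n j)) !Ex_sum => [|s _|s _]; [|exact: Lw|exact: Lw].
    rewrite -big_split/=; apply: ler_sum => s _.
    have sM : (s <= M)%N by rewrite ltnW// (leq_ltn_trans _ nM)// -ltnS.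
    have := unroll n j s (M - s); rewrite subnKC// => /le_trans; apply; apply: lerD.
      rewrite -Ex_sum; last by move=> v _; exact/Lw/L1_abs.
      apply: Ex_le_ae; [by apply: L1_sum => v _; exact/Lw/L1_abs|exact: Lw|].
      apply: ae_mono Hhae _ => w /(_ j)[_ /(_ M)] le.
      rewrite -mulr_sumr ler_wpM2l// /tl lerBrDr; apply: le_trans le.
      have e1 : \sum_(v < M) `|al j v w| = \sum_(v < s) `|al j v w| +
          \sum_(v < M - s) `|al j (s + v)%N w|.
        by rewrite -[in LHS](subnKC sM) big_split_ord.
      have e2 : \sum_(v < M | (s <= v)%N) `|al j v w| = \sum_(v < M - s) `|al j (s + v)%N w|.
        rewrite -[in LHS](subnKC sM) big_mkcond big_split_ord/= big1 ?add0r => [|v _].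
          by apply: eq_bigr => v _; rewrite leq_addr.
        by rewrite leqNgt ltn_ord.
      by rewrite e1 e2 addrC.
    apply: Ex_le; [exact: Lw|exact: LS|move=> w].
    by rewrite ler_piMl//; case/andP: (w01 n j s w).
  have cv : (\sum_j Ex (B n j) + \sum_j \sum_(s < n.+1) Ex (S j M)) @[M --> \oo] --> \sum_j Ex (B n j).
    rewrite -[X in _ --> X]addr0; apply: cvgD; first exact: cvg_cst.
    by apply: cvgn_sum0 => j; apply: cvgn_sum0 => s; exact: Scvg.
  by apply: ge_cvgn cv _; exists n.+1 => // M /= nM; exact: key.
have Bcvg j : Ex (B n j) @[n --> \oo] --> 0.
  rewrite -[X in _ --> X](Ex_cst P 0).
  apply: (fun h1 h2 h3 h4 h5 => proj2 (@Ex_dct _ _ _ P (fun n => B n j) (cst 0) (h j) h1 h2 h3 h4 h5)).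
  - by move=> n; exact: (L1_meas (LB n j)).
  - by [].
  - exact: Lh.
  - apply: ae_mono2 Hhae clk_cvg0 _ => w /(_ j)[cv le] ck.
    have tl0 s : 0 <= tl j s w by rewrite subr_ge0.
    have tlle m n : (m <= n)%N -> tl j n w <= tl j m w.
      move=> mn; rewrite lerB// -(subnKC mn) big_split_ord/= lerDl sumr_ge0//.
    have ctl : (fun s => tl j s w) @ \oo --> 0.
      by rewrite -(subrr (h j w)); apply: cvgB => //; exact: cvg_cst.
    apply/cvgrPdist_le => eps eps0; have e2 : 0 < eps / 2 by rewrite divr_gt0.
    move/cvgrPdist_le : ctl => /(_ _ e2)[N _ /(_ N (leqnn _))/=].
    rewrite sub0r normrN ger0_norm// => tlN.
    have eN := edisc_gt0 q (W j) N w.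
    have ck' : (fun n => (edisc q (W j) N w)^-1 * h j w * clk n w) @ \oo --> 0.
      by rewrite -[X in _ --> X](mulr0 ((edisc q (W j) N w)^-1 * h j w)); apply: cvgM => //; exact: cvg_cst.
    move/cvgrPdist_le : ck' => /(_ _ e2)[N' _ hN'].
    exists N' => // n /= /hN' /=; rewrite !sub0r !normrN.
    have c0 : 0 <= (edisc q (W j) N w)^-1 * h j w * clk n w.
      by rewrite mulr_ge0 ?expR_ge0// mulr_ge0 ?h0// invr_ge0 ltW.
    have l0 := lag_ge0 q W pi n j w; have l1 := lag_le1 q0 Harm pi n j w.
    rewrite ger0_norm// ger0_norm; last by rewrite /B mulr_ge0// mulr_ge0.
    move=> small; rewrite /B.
    apply: (@le_trans _ _ (lag n j w * tl j (pi n w j) w)).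
      by rewrite ler_piMl ?mulr_ge0//; case/andP: (@indic01 R _ _ A w).
    have [le1|le1] := leqP N (pi n w j).
      apply: (@le_trans _ _ (tl j (pi n w j) w)); first by rewrite ler_piMl.
      by apply: le_trans (tlle _ _ le1) _; apply: le_trans tlN _; lra.
    (* Fewer than [N] operations: the discount of arm [j] is at least its value at stage [N], so
       [lag] is at most the total discount divided by that value. *)
    apply: (@le_trans _ _ (eps / 2)); last by lra.
    apply: le_trans small; rewrite -(lag_clock q W pi n j w).
    set en := edisc q (W j) (pi n w j) w; set eN' := edisc q (W j) N w.
    have -> : eN'^-1 * h j w * (lag n j w * en) = lag n j w * (h j w * (eN'^-1 * en)) by ring.
    rewrite ler_wpM2l//; apply: (@le_trans _ _ (h j w)); first by rewrite /tl gerBl sumr_ge0.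
    rewrite ler_peMr// mulrC ler_pdivlMr// mul1r.
    by apply: (edisc_le q0 (Harm j)); exact: ltnW.
  - apply: ae_mono Hhae _ => w /(_ j)[_ le] n.
    have l0 := lag_ge0 q W pi n j w; have l1 := lag_le1 q0 Harm pi n j w.
    have t0 : 0 <= tl j (pi n w j) w by rewrite subr_ge0.
    rewrite /B ger0_norm; last by rewrite mulr_ge0// mulr_ge0.
    apply: (@le_trans _ _ (tl j (pi n w j) w)); last by rewrite /tl gerBl sumr_ge0.
    rewrite mulrA ler_piMl// mulr_ile1//; by case/andP: (@indic01 R _ _ A w).
have csum : (\sum_j Ex (B n j)) @[n --> \oo] --> 0.
  by apply: cvgn_sum0 => j; exact: Bcvg.
apply: (@squeeze_cvgr _ _ _ _ (cst 0) (fun n => \sum_j Ex (B n j))) => //.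
- apply: nearW => n; rewrite bound andbT; apply: Ex_ge0 => w; rewrite mulr_ge0//.
  by apply: sumr_ge0 => j _; rewrite mulr_ge0// lag_ge0.
- exact: cvg_cst.
Qed.

End long_run.

(** * Rewards and charges collected by a strategy *)

Section discounted_sums.
Context {R : realType} {d : measure_display} {Omega : measurableType d}.
Variables (P : probability Omega R) (J : nat) (q : R).
Variables (F : 'I_J -> nat -> set (set Omega)) (X W : 'I_J -> nat -> Omega -> R).
Hypothesis q0 : 0 < q.
Hypothesis Harm : forall j, arm_model P (F j) (X j) (W j).
Hypothesis Hindep : indep_sigmas P (fun j => Finf (F j)).
Notation L1 := (L1 P).
Notation Ex := (Ex P).

Let sF j s : sub_sigma (F j s). Proof. exact: (arm_sub_sigma (Harm j)). Qed.
Let Fle j u v : (u <= v)%N -> F j u `<=` F j v. Proof. exact: (arm_Fle (Harm j)). Qed.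
Notation joint := (joint F).
Let sJ j s : sub_sigma (joint j s). Proof. exact: sub_sigma_joint. Qed.
Let mJ j s (f : Omega -> R) : Gmeas (joint j s) f -> measurable_fun setT f.
Proof. by apply: Gmeas_mf; case: (sJ j s). Qed.

Variables (pi : nat -> Omega -> 'I_J -> nat) (a : nat -> Omega -> 'I_J).
Hypothesis Hpi : is_strategy F pi.
Hypothesis Ha : forall t w k, pi t.+1 w k = (pi t w k + (k == a t w))%N.
Notation lag := (lag q W pi).
Notation T w := (fun k s => optime (W k) s w).
Notation path w := (fun t => pi t w).

Definition earned (z : 'I_J -> nat -> Omega -> R) n w :=
  \sum_(t < n) z (a t w) (pi t w (a t w)) w * slot q (T w) (path w) t.

Lemma mdsc j s : measurable_fun setT (dsc q (W j) s).
Proof.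
have -> : dsc q (W j) s = fun w => edisc q (W j) s w * bdisc q (W j) s w * q^-1.
  by apply/funext => w; rewrite (dscE q0 (Harm j)).
apply: measurable_funM => //; apply: measurable_funM.
  by apply: Gmeas_mf (edisc_F q (Harm j) s); case: (sF j s).
exact: mbdisc (Harm j) s.
Qed.

Variable z : 'I_J -> nat -> Omega -> R.
Hypothesis mz : forall j s, measurable_fun setT (z j s).
Hypothesis Lz : forall j s, L1 (fun w => `|z j s w| * dsc q (W j) s w).
Hypothesis zM : forall j, exists M, forall n,
  \sum_(u < n) Ex (fun w => `|z j u w| * dsc q (W j) u w) <= M.

Lemma measurable_earned n : measurable_fun setT (earned z n).
Proof.
have FT : joinF F (fun=> 0%N) setT by apply: GsetT; exact: smallest_sigma_algebra.
have GE := @weightE_F _ _ _ P J q F X W Harm pi a Hpi Ha setT FT.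
rewrite (_ : earned z n = fun w => \sum_(t < n) \sum_j \sum_(s < t.+1)
   weight q W pi (setT `&` [set w | a t w = j]) t j s w * (dsc q (W j) s w * z j s w)).
  apply: measurable_sum => t; apply: measurable_sum => j; apply: measurable_sum => s.
  apply: measurable_funM; first exact: mJ (@GE t j s).
  by apply: measurable_funM => //; exact: mdsc.
apply/funext => w; apply: eq_bigr => t _.
have := @sum_weightE _ _ _ J q F W pi a Hpi setT t w (fun j s => dsc q (W j) s w * z j s w).
by rewrite /= => ->; rewrite indicP1// mul1r mulrA (lag_slot q0 Harm Ha) mulrC.
Qed.

(** A slot weighs [lag * dsc], at most the [dsc] of its operation in an arm played alone, and a path
    performs each operation at most once. So the absolute series of the separate arms dominate the
    sum along every strategy. *)
Lemma earned_dom : exists h : Omega -> R, L1 h /\ {ae P, forall w,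
  cvgn (fun n => earned z n w) /\ forall n, `|earned z n w| <= h w}.
Proof.
have hex j : exists h : Omega -> R, [/\ L1 h, forall w, 0 <= h w &
    {ae P, forall w, (fun n => \sum_(k < n) `|z j k w| * dsc q (W j) k w) @ \oo --> h w /\
      forall n, \sum_(k < n) `|z j k w| * dsc q (W j) k w <= h w}].
  have [M HM] := zM j.
  apply: (Ex_series (Lz j) _ HM) => n w.
  by rewrite mulr_ge0// (dsc_ge0 q0 (Harm j)).
have [h Hh] := choice hex.
exists (fun w => \sum_j h j w); split.
  by apply: L1_sum => j _; case: (Hh j).
have Hhae : {ae P, forall w, forall j, forall n,
    \sum_(k < n) `|z j k w| * dsc q (W j) k w <= h j w}.
  apply: ae_ord => j; have [_ _ H] := Hh j.
  by apply: ae_mono H _ => w [_].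
apply: ae_mono Hhae _ => w le.
have le' n : \sum_(t < n) `|z (a t w) (pi t w (a t w)) w * slot q (T w) (path w) t| <= \sum_j h j w.
  have sp := strategy_path Hpi Ha w.
  apply: (@le_trans _ _ (\sum_(t < n) (fun j s => `|z j s w| * dsc q (W j) s w) (a t w) (pi t w (a t w)))).
    apply: ler_sum => t _; rewrite normrM ler_wpM2l//.
    have sl0 : 0 <= slot q (T w) (path w) t.
      exact: (@slot_ge0 R J q (T w) q0 (fun k s => optime_leS Harm k s w) (path w) (fun t => a t w) t sp).
    rewrite ger0_norm// -(lag_slot q0 Harm Ha) ler_piMl ?(lag_le1 q0 Harm)//.
    exact: (dsc_ge0 q0 (Harm _)).
  rewrite (path_sum (fun j s => `|z j s w| * dsc q (W j) s w) n sp).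
  by apply: ler_sum => j _; exact: le.
split=> [|n].
  exact: (@cvgn_sum_norm _ (fun t => z (a t w) (pi t w (a t w)) w * slot q (T w) (path w) t) _ le').
exact: le_trans (ler_norm_sum _ _ _) (le' n).
Qed.

Lemma L1_earned n : L1 (earned z n).
Proof.
have [h [Lh H]] := earned_dom; apply: (L1_le_ae (measurable_earned n) Lh).
by apply: ae_mono H _ => w [_ /(_ n)] /le_trans; apply; exact: ler_norm.
Qed.

End discounted_sums.

(** * Comparison with the index strategy *)

Section optimality.
Context {R : realType} {d : measure_display} {Omega : measurableType d}.
Variables (P : probability Omega R) (J : nat) (q : R).
Variables (F : 'I_J -> nat -> set (set Omega)) (X W : 'I_J -> nat -> Omega -> R).
Variable Gam : 'I_J -> nat -> Omega -> \bar R.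
Hypothesis J0 : (0 < J)%N.
Hypothesis q0 : 0 < q.
Hypothesis Harm : forall j, arm_model P (F j) (X j) (W j).
Hypothesis Hindep : indep_sigmas P (fun j => Finf (F j)).
Hypothesis Hint : forall j, arm_integrable P q (X j) (W j).
Hypothesis HGam : forall j s, gittins_index P q (F j) (X j) (W j) s (Gam j s).
Notation L1 := (L1 P).
Notation Ex := (Ex P).
Notation T w := (fun k s => optime (W k) s w).

Let sF j s : sub_sigma (F j s). Proof. exact: (arm_sub_sigma (Harm j)). Qed.
Let g j := charge_min (Gam j).
Let al j s w := dsc q (W j) s w * (X j s w - g j s w).

Let mX j s : measurable_fun setT (X j s).
Proof. by apply: Gmeas_mf (arm_FX (Harm j) s); case: (sF j s). Qed.

Let mg j s : measurable_fun setT (g j s).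
Proof. by apply: Gmeas_mf (charge_min_F (Harm j) (HGam j) s); case: (sF j s). Qed.

Let LX j : (forall s, L1 (fun w => `|X j s w| * dsc q (W j) s w)) /\
  exists M, forall n, \sum_(u < n) Ex (fun w => `|X j u w| * dsc q (W j) u w) <= M.
Proof. exact: (L1_dscX q0 (Harm j) (Hint j)). Qed.

Let Lg j : (forall s, L1 (fun w => `|g j s w| * dsc q (W j) s w)) /\
  exists M, forall n, \sum_(u < n) Ex (fun w => `|g j u w| * dsc q (W j) u w) <= M.
Proof.
have [h1 h2] := L1_charge q0 (Harm j) (Hint j) (HGam j).
exact: (L1_dsc q0 (Harm j) h1 h2 (mg j)).
Qed.

Let mal j s : measurable_fun setT (al j s).
Proof.
by apply: measurable_funM; [exact: (mdsc q0 Harm j s)|exact: measurable_funB].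
Qed.

Let al_le j s w : `|al j s w| <= `|X j s w| * dsc q (W j) s w + `|g j s w| * dsc q (W j) s w.
Proof.
rewrite normrM (ger0_norm (dsc_ge0 q0 (Harm j) s w)) -mulrDl mulrC ler_wpM2r//.
  exact: (dsc_ge0 q0 (Harm j) s w).
exact: ler_normB.
Qed.

Let Lal j s : L1 (al j s).
Proof. exact: (@L1_le _ _ _ P _ _ (mal j s) (L1D ((LX j).1 s) ((Lg j).1 s)) (al_le j s)). Qed.

Let alM j : exists M, forall n, \sum_(u < n) Ex (fun w => `|al j u w|) <= M.
Proof.
have [l1 [M1 H1]] := LX j; have [l2 [M2 H2]] := Lg j; exists (M1 + M2) => n.
apply: le_trans (lerD (H1 n) (H2 n)); rewrite -big_split/=; apply: ler_sum => u _.
rewrite -ExD//; apply: Ex_le => //; [exact: (L1_abs (Lal j u))|exact: L1D].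
Qed.

Let Gal j s : Gmeas (F j s.+1) (al j s).
Proof.
have [sa _] := sF j s.+1; apply: (GmM sa).
  have -> : dsc q (W j) s = fun w => edisc q (W j) s w * bdisc q (W j) s w * q^-1.
    by apply/funext => w; rewrite (dscE q0 (Harm j)).
  apply: (GmM sa); last exact: Gm_cst.
  apply: (GmM sa); last exact: bdisc_F (Harm j) s.
  by apply: Gmeas_sub (edisc_F q (Harm j) s); exact: (arm_FS (Harm j)).
apply: (GmB sa).
  by apply: Gmeas_sub (arm_FX (Harm j) s); exact: (arm_FS (Harm j)).
by apply: Gmeas_sub (charge_min_F (Harm j) (HGam j) s); exact: (arm_FS (Harm j)).
Qed.

Lemma arms_martingale : exists S : 'I_J -> nat -> Omega -> R, forall j,
 [/\ forall u, Gmeas (F j u) (S j u),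
  forall u, L1 (S j u) /\ forall w, 0 <= S j u w,
  forall u w, g j u w = charge_gam (Gam j) u w -> S j u w = 0,
  forall u C, F j u C -> Ex (fun w => \1_C w * S j u w) =
    Ex (fun w => \1_C w * (al j u w + S j u.+1 w)) &
  (fun n => Ex (S j n)) @ \oo --> 0].
Proof.
have h j := arm_martingale q0 (Harm j) (Hint j) (HGam j).
by have [S HS] := choice h; exists S.
Qed.

Variables (pi' : nat -> Omega -> 'I_J -> nat) (a' : nat -> Omega -> 'I_J).
Hypothesis Hpi' : is_strategy F pi'.
Hypothesis Ha' : forall t w k, pi' t.+1 w k = (pi' t w k + (k == a' t w))%N.
Hypothesis greedy : forall t w k, (Gam k (pi' t w k) w <= Gam (a' t w) (pi' t w (a' t w)) w)%E.

Let greedy_ae : {ae P, forall w, forall t,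
  (forall k, k != a' t w -> g k (pi' t w k) w = charge_gam (Gam k) (pi' t w k) w) /\
  forall k, g k (pi' t w k) w <= g (a' t w) (pi' t w (a' t w)) w}.
Proof.
have fin : {ae P, forall w, forall j, forall u, Gam j u w = (charge_gam (Gam j) u w)%:E}.
  by apply: ae_ord => j; exact: (gam_fin q0 (Harm j) (Hint j) (HGam j)).
apply: ae_mono fin _ => w fin.
apply: (@greedy_charge R J (fun t => pi' t w) (fun t => a' t w)
  (fun j s => charge_gam (Gam j) s w) (fun j s => g j s w) (strategy_path Hpi' Ha' w)) => //.
by move=> t k; rewrite -lee_fin -!fin.
Qed.

Variables (pi : nat -> Omega -> 'I_J -> nat) (a : nat -> Omega -> 'I_J).
Hypothesis Hpi : is_strategy F pi.
Hypothesis Ha : forall t w k, pi t.+1 w k = (pi t w k + (k == a t w))%N.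

Notation V := (earned q W pi a).
Notation V' := (earned q W pi' a').

Let LVX n : L1 (V X n). Proof. by apply: (L1_earned q0 Harm Hpi Ha) => // j; case: (LX j). Qed.
Let LVg n : L1 (V g n). Proof. by apply: (L1_earned q0 Harm Hpi Ha) => // j; case: (Lg j). Qed.
Let LVX' n : L1 (V' X n). Proof. by apply: (L1_earned q0 Harm Hpi' Ha') => // j; case: (LX j). Qed.
Let LVg' n : L1 (V' g n). Proof. by apply: (L1_earned q0 Harm Hpi' Ha') => // j; case: (Lg j). Qed.

Lemma total_rewardE (p : nat -> Omega -> 'I_J -> nat) b w : is_strategy F p ->
  (forall t w k, p t.+1 w k = (p t w k + (k == b t w))%N) ->
  total_reward q X W p w = limn (fun n => earned q W p b X n w).
Proof.
move=> Hp Hb; rewrite /total_reward; congr (limn _); apply/funext => n.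
by apply: eq_bigr => t _; rewrite (sum_sel Hb) (disc_slot q0 Harm Hp Hb).
Qed.

(** In [greedy_optimal], [N] goes to infinity first, with [n] fixed, because the correction carries
    the factor [M n], possibly unbounded below. Then [M n <= |M 0|] suffices for the limit in [n],
    since both clocks exhaust time by [clk_cvg0]. *)
Let charges_le : {ae P, forall w, limn (fun n => V g n w) <= limn (fun n => V' g n w)}.
Proof.
have [h [_ H]] := earned_dom q0 Harm Hpi Ha (fun j => (Lg j).1) (fun j => (Lg j).2).
have [h' [_ H']] := earned_dom q0 Harm Hpi' Ha' (fun j => (Lg j).1) (fun j => (Lg j).2).
apply: ae_mono2 (ae_mono2 H H' (fun w a b => conj a b)) (ae_mono2 greedy_ae (ae_mono2
  (clk_cvg0 J0 q0 Harm Hpi) (clk_cvg0 J0 q0 Harm Hpi') (fun w a b => conj a b))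
  (fun w a b => conj a b)) _ => w [[cV _] [cV' _]] [gr [ck ck']].
have sp := strategy_path Hpi Ha w; have sp' := strategy_path Hpi' Ha' w.
have gS j s : g j s.+1 w <= g j s w by exact: charge_min_leS.
have gr' t k : g k (pi' t w k) w <= g (a' t w) (pi' t w (a' t w)) w by have [_] := gr t; apply.
pose M t := g (a' t w) (pi' t w (a' t w)) w.
have MS t : M t.+1 <= M t.
  exact: (@greedy_nonincreasing R J (fun j s => g j s w) gS (fun t => pi' t w) (fun t => a' t w) sp' gr').
have M0 t : M t <= M 0%N by elim: t => // t; exact: le_trans (MS t).
have opt N n := @greedy_optimal R J q (T w) q0 (fun k => optime0 W k w)
  (fun k s => optime_leS Harm k s w) (fun j s => g j s w) gS (fun t => pi t w) (fun t => a t w)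
  sp (fun t => pi' t w) (fun t => a' t w) sp' gr' N n.
pose dd (p : nat -> Omega -> 'I_J -> nat) n := ddisc q (clock (T w) (fun t => p t w) n).
have cdd : dd pi n @[n --> \oo] --> 0.
  by rewrite -[X in _ --> X](mul0r q^-1); apply: (cvgM ck (cvg_cst q^-1)).
have cdd' : dd pi' n @[n --> \oo] --> 0.
  by rewrite -[X in _ --> X](mul0r q^-1); apply: (cvgM ck' (cvg_cst q^-1)).
have step n : limn (fun n => V g n w) <= V' g n w + `|M 0%N| * dd pi' n.
  have cv : (V g N w + M n * dd pi N) @[N --> \oo] --> limn (fun n => V g n w).
    rewrite -[X in _ --> X]addr0; apply: cvgD; first exact: cV.
    by rewrite -[X in _ --> X](mulr0 (M n)); apply: (cvgM (cvg_cst (M n)) cdd).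
  apply: (le_cvgn cv); apply: nearW => N; have := opt N n.
  have d0 : 0 <= dd pi' n by exact: ddisc_ge0.
  have : M n * dd pi' n <= `|M 0%N| * dd pi' n.
    by rewrite ler_wpM2r// (le_trans (M0 n))// ler_norm.
  rewrite /earned -/(M n) -/(dd pi' n) -/(dd pi N) mulrBr; lra.
have cv' : (V' g n w + `|M 0%N| * dd pi' n) @[n --> \oo] --> limn (fun n => V' g n w).
  rewrite -[X in _ --> X]addr0; apply: cvgD; first exact: cV'.
  by rewrite -[X in _ --> X](mulr0 `|M 0%N|); apply: (cvgM (cvg_cst `|M 0%N|) cdd').
by apply: (ge_cvgn cv'); exact: nearW.
Qed.

(** The domination of the charges holds only in the limit; at a finite horizon it fails by at most
    this amount, which tends to 0 in mean. *)
Let gap n w := Num.max (V g n w - V' g n w) 0.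

Let mgap n : measurable_fun setT (gap n).
Proof.
apply: measurable_maxr => //; apply: measurable_funB.
  exact: (L1_meas (LVg n)).
exact: (L1_meas (LVg' n)).
Qed.

Let gap_dom : exists h : Omega -> R, L1 h /\ {ae P, forall w, (gap n w @[n --> \oo] --> 0) /\
  forall n, `|gap n w| <= h w}.
Proof.
have [h [Lh H]] := earned_dom q0 Harm Hpi Ha (fun j => (Lg j).1) (fun j => (Lg j).2).
have [h' [Lh' H']] := earned_dom q0 Harm Hpi' Ha' (fun j => (Lg j).1) (fun j => (Lg j).2).
exists (fun w => h w + h' w); split; first exact: L1D.
apply: ae_mono2 (ae_mono2 H H' (fun w a b => conj a b)) charges_le _ =>
  w [[cV lV] [cV' lV']] le.
have g0 n : 0 <= gap n w by rewrite le_max lexx orbT.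
split=> [|n].
  set l := limn _ in le; set l' := limn _ in le.
  have cv : `|V g n w - V' g n w - (l - l')| @[n --> \oo] --> 0.
    rewrite -[X in _ --> X](@normr0 R R) -(subrr (l - l')); apply: cvg_norm.
    exact: (cvgB (cvgB cV cV') (cvg_cst (l - l'))).
  apply: (@squeeze_cvgr _ _ _ _ (cst 0) (fun n => `|V g n w - V' g n w - (l - l')|)) => //.
  - apply: nearW => n; rewrite g0/= ge_max normr_ge0 andbT.
    by apply: le_trans (ler_norm _); rewrite lerBrDr gerDl subr_le0.
  - exact: cvg_cst.
rewrite ger0_norm// ge_max; apply/andP; split.
  apply: le_trans (ler_norm _) _; apply: le_trans (ler_normB _ _) _.
  exact: lerD.
by rewrite addr_ge0//; [apply: le_trans (lV n)|apply: le_trans (lV' n)].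
Qed.

Let Ex_gap : Ex (gap n) @[n --> \oo] --> 0.
Proof.
have [h [Lh H]] := gap_dom; rewrite -[X in _ --> X](Ex_cst P 0).
apply: (fun h1 h2 h3 h4 h5 => proj2 (@Ex_dct _ _ _ P gap (cst 0) h h1 h2 h3 h4 h5)) => //.
- by apply: ae_mono H _ => w [].
- by apply: ae_mono H _ => w [].
Qed.

Let Lgap n : L1 (gap n).
Proof.
have [h [Lh H]] := gap_dom; apply: (L1_le_ae (mgap n) Lh).
by apply: ae_mono H _ => w [_ /(_ n)] /le_trans; apply; exact: ler_norm.
Qed.

(** At horizon [n], in mean on [C]: rewards of [pi] are at most its charges, these at most the
    charges of [pi'] plus [gap n], and the latter charges equal the rewards of [pi'] plus the
    potential left. Both error terms vanish as [n] grows. *)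
Lemma gittins_dominates C : joinF F (fun=> 0%N) C ->
  L1 (total_reward q X W pi) -> L1 (total_reward q X W pi') ->
  Ex (fun w => \1_C w * total_reward q X W pi w) <=
  Ex (fun w => \1_C w * total_reward q X W pi' w).
Proof.
move=> FC Ltot Ltot'.
have mC : measurable C.
  have : joinF F (fun=> 0%N) `<=` @measurable _ Omega.
    apply: smallest_sub; first by case: (@sub_sigma_measurable _ Omega).
    by move=> A [k _ FA]; case: (sF k 0) => _; exact.
  exact.
have C0 w : 0 <= \1_C w :> R by case/andP: (@indic01 R _ _ C w).
have C1 w : \1_C w <= 1 :> R by case/andP: (@indic01 R _ _ C w).
have [S HS] := arms_martingale.
have GS j s : Gmeas (F j s) (S j s) by case: (HS j).
have LS j s : L1 (S j s) by case: (HS j) => _ h _ _ _; case: (h s).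
have S0 j s w : 0 <= S j s w by case: (HS j) => _ h _ _ _; case: (h s).
have Srec j u w : g j u w = charge_gam (Gam j) u w -> S j u w = 0.
  by case: (HS j) => _ _ h _ _; exact: h.
have mart j s D : F j s D -> Ex (fun w => \1_D w * S j s w) =
    Ex (fun w => \1_D w * (al j s w + S j s.+1 w)).
  by case: (HS j) => _ _ _ h _; exact: h.
have Scvg j : (fun n => Ex (S j n)) @ \oo --> 0 by case: (HS j).
(* Before any operation the index is its own running minimum, so every [S j 0] is 0. *)
have pot0 p : is_strategy F p -> Ex (fun w => \1_C w * potential q W p S 0 w) = 0.
  move=> [p0 _]; rewrite (eq_Ex _ (g := cst 0)) ?Ex_cst// => w.
  rewrite /potential big1 ?mulr0// => j _.
  by rewrite p0 Srec ?mulr0.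
have Lind (f : Omega -> R) : L1 f -> L1 (fun w => \1_C w * f w) by exact: L1_ind.
(* The excess of period [t] is the increment of rewards minus charges, so the sum telescopes. *)
have exE p b n : is_strategy F p -> (forall t w k, p t.+1 w k = (p t w k + (k == b t w))%N) ->
    (forall m, L1 (earned q W p b X m)) -> (forall m, L1 (earned q W p b g m)) ->
    \sum_(t < n) Ex (fun w => \1_C w * (lag q W p t (b t w) w * al (b t w) (p t w (b t w)) w)) =
    Ex (fun w => \1_C w * earned q W p b X n w) - Ex (fun w => \1_C w * earned q W p b g n w).
  move=> Hp Hb LpX Lpg.
  have incr t w : lag q W p t (b t w) w * al (b t w) (p t w (b t w)) w =
      (earned q W p b X t.+1 w - earned q W p b g t.+1 w) -
      (earned q W p b X t w - earned q W p b g t w).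
    by rewrite /earned !big_ord_recr/= /al mulrA (lag_slot q0 Harm Hb); ring.
  have LE t : L1 (fun w => \1_C w * (lag q W p t (b t w) w * al (b t w) (p t w (b t w)) w)).
    apply: Lind; rewrite (_ : (fun w => _) = fun w =>
      (earned q W p b X t.+1 w - earned q W p b g t.+1 w) -
      (earned q W p b X t w - earned q W p b g t w)); last by apply/funext => w; exact: incr.
    by apply: L1B; exact: L1B.
  rewrite -Ex_sum// -(ExB (Lind _ (LpX n)) (Lind _ (Lpg n))); apply: eq_Ex => w.
  rewrite -mulr_sumr -mulrBr; congr (_ * _).
  under eq_bigr do rewrite incr.
  elim: n => [|n IH]; first by rewrite /earned !big_ord0 subrr.
  by rewrite big_ord_recr/= IH; ring.
have le1 n : Ex (fun w => \1_C w * V X n w) <= Ex (fun w => \1_C w * V g n w).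
  rewrite -subr_le0 -(exE pi a)//.
  apply: le_trans (potential_sum_le q0 Harm Hindep Hpi Ha GS LS S0 Gal Lal mart FC n) _.
  by rewrite pot0.
have eq1 n : Ex (fun w => \1_C w * V' X n w) - Ex (fun w => \1_C w * V' g n w) =
    - Ex (fun w => \1_C w * potential q W pi' S n w).
  rewrite -(exE pi' a')// (potential_sum_eq q0 Harm Hindep Hpi' Ha' GS LS Gal Lal mart FC).
    by rewrite pot0// sub0r.
  move=> t; apply: ae_mono greedy_ae _ => w /(_ t) [h _] j ja.
  exact/Srec/h.
have le2 n : Ex (fun w => \1_C w * V g n w) <= Ex (fun w => \1_C w * V' g n w) + Ex (gap n).
  rewrite -lerBlDl -(ExB (Lind _ (LVg n)) (Lind _ (LVg' n))); apply: Ex_le => //.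
    by apply: L1B; exact: Lind.
  move=> w; rewrite -mulrBr; apply: (@le_trans _ _ (\1_C w * gap n w)).
    by rewrite ler_wpM2l// le_max lexx.
  by rewrite ler_piMl// le_max lexx orbT.
have cvtot p b : is_strategy F p -> (forall t w k, p t.+1 w k = (p t w k + (k == b t w))%N) ->
    (forall m, L1 (earned q W p b X m)) -> L1 (total_reward q X W p) ->
    Ex (fun w => \1_C w * earned q W p b X n w) @[n --> \oo] -->
    Ex (fun w => \1_C w * total_reward q X W p w).
  move=> Hp Hb LpX Lp.
  have [h [Lh H]] := earned_dom q0 Harm Hp Hb (fun j => (LX j).1) (fun j => (LX j).2).
  apply: (fun h1 h2 h3 h4 h5 => proj2 (@Ex_dct _ _ _ P (fun n w => \1_C w * earned q W p b X n w)
    (fun w => \1_C w * total_reward q X W p w) h h1 h2 h3 h4 h5)).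
  - by move=> n; exact: L1_meas (Lind _ (LpX n)).
  - exact: L1_meas (Lind _ Lp).
  - exact: Lh.
  - apply: ae_mono H _ => w [cv _]; rewrite (total_rewardE w Hp Hb).
    by apply: cvgM => //; exact: cvg_cst.
  - apply: ae_mono H _ => w [_ le] n; apply: le_trans (le n).
    by rewrite normrM (ger0_norm (C0 w)) ler_piMl.
have cvpot := potential_cvg0 J0 q0 Harm Hindep Hpi' GS LS S0 Gal Lal mart Scvg alM FC.
have cv : (fun n => Ex (fun w => \1_C w * V X n w) - (Ex (fun w => \1_C w * V' X n w) +
    (Ex (fun w => \1_C w * potential q W pi' S n w) + Ex (gap n)))) @ \oo -->
    Ex (fun w => \1_C w * total_reward q X W pi w) -
    Ex (fun w => \1_C w * total_reward q X W pi' w).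
  rewrite -[X in _ - X]addr0 -[X in _ - (_ + X)]addr0; apply: cvgB; first exact: cvtot.
  by apply: cvgD; [exact: cvtot|exact: cvgD].
rewrite -subr_le0; apply: (le_cvgn cv); apply: nearW => n.
by move: (le1 n) (le2 n) (eq1 n); rewrite /=; lra.
Qed.

End optimality.
Unset Implicit Arguments.

Theorem mainTheorem1 (R : realType) (d : measure_display) (Omega : measurableType d)
  (P : probability Omega R) (J : nat) (q : R)
  (F : 'I_J -> nat -> set (set Omega)) (X W : 'I_J -> nat -> Omega -> R)
  (HJ : (0 < J)%N) (Hq : 0 < q)
  (Hcomplete : measure_is_complete P)
  (Harm : forall j, arm_model P (F j) (X j) (W j))
  (Hindep : indep_sigmas P (fun j => Finf (F j)))
  (Hint : forall j, arm_integrable P q (X j) (W j))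
  (Gam : 'I_J -> nat -> Omega -> \bar R)
  (HGam : forall j s, gittins_index P q (F j) (X j) (W j) s (Gam j s))
  (pistar : nat -> Omega -> 'I_J -> nat)
  (Hpistar : is_strategy F pistar)
  (Hgittins : forall t w j, sel pistar t w j ->
     forall k, (Gam k (pistar t w k) w <= Gam j (pistar t w j) w)%E) :
  forall pi, is_strategy F pi ->
  forall V Vstar : Omega -> R,
    cond_exp P (joinF F (fun _ => 0%N)) (total_reward q X W pi) V ->
    cond_exp P (joinF F (fun _ => 0%N)) (total_reward q X W pistar) Vstar ->
    {ae P, forall w, V w <= Vstar w}.
Proof.
move=> pi Hpi V Vstar HV HVs.
have choice_sel p : is_strategy F p ->
    exists a : nat -> Omega -> 'I_J, forall t w k, p t.+1 w k = (p t w k + (k == a t w))%N.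
  move=> [_ [_ [h _]]].
  by exists (fun t w => projT1 (choice (h t)) w) => t w; exact: (projT2 (choice (h t))).
have [a Ha] := choice_sel pi Hpi.
have [a' Ha'] := choice_sel pistar Hpistar.
have greedy t w k :
    (Gam k (pistar t w k) w <= Gam (a' t w) (pistar t w (a' t w)) w)%E.
  by apply: Hgittins; rewrite /sel Ha' eqxx addn1.
have sG : sub_sigma (joinF F (fun=> 0%N)).
  split; first exact: smallest_sigma_algebra.
  apply: smallest_sub; first by case: (@sub_sigma_measurable _ Omega).
  by move=> A [k _ FA]; case: (arm_sub_sigma (Harm k) 0) => _; exact.
have [LY GV LV EV] := (cond_expP P sG _ _).1 HV.
have [LYs GVs LVs EVs] := (cond_expP P sG _ _).1 HVs.
(* Comparing conditional values amounts to comparing mean total rewards on each event known at time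
   0. *)
apply: (Ex_test sG GV GVs LV LVs) => C GC.
rewrite (EV C GC) (EVs C GC).
exact: (gittins_dominates HJ Hq Harm Hindep Hint HGam Hpistar Ha' greedy Hpi Ha GC LY LYs).
Qed.
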